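(* For every $\eta,q>0$ and for every $c\in\mathbb N$ there is an $n_0\in\mathbb N$ so that for each graph $G$ on $n\geq n_0$ vertices and each $k\in\mathbb N$ with $k\geq qn$ the following is true. If at least $n/2$ vertices of $G$ have degree at least $(1+\eta)k$, then each connected bipartite graph $Q$ on $k+1$ vertices with at most $k+c$ edges is a subgraph of $G$.
   Context: Graphs are finite and simple. Subgraphs are not necessarily induced. *)

(* Defs.v *)
From mathcomp Require Import all_boot all_order all_algebra.
From mathcomp Require Import reals.

Set Implicit Arguments.
Unset Strict Implicit.
Unset Printing Implicit Defensive.

Record sgraph := SGraph {
  vertex :> finType;
  edge : rel vertex;
  edge_sym : symmetric edge;
  edge_irrefl : irreflexive edge
}.

Definition degree (G : sgraph) (x : G) : nat := #|[set y : G | edge x y]|.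

(* An edge is identified with the 2-element set of its endpoints, so each edge
   is counted once. *)
Definition edges (G : sgraph) : {set {set G}} :=
  [set A : {set G} | [exists x, exists y, edge x y && (A == [set x; y])]].

(* The empty graph counts as connected under this definition. *)
Definition connected (G : sgraph) : Prop :=
  forall x y : G, connect (@edge G) x y.

(* A and its complement are the two colour classes. *)
Definition bipartite (G : sgraph) : Prop :=
  exists A : {set G}, forall x y : G, edge x y -> (x \in A) != (y \in A).

(* H is isomorphic to a (not necessarily induced) subgraph of G. *)
Definition subgraph (H G : sgraph) : Prop :=
  exists2 f : H -> G, injective f & forall x y : H, edge x y -> edge (f x) (f y).

(* Main.v *)
Require Import Defs.
From HB Require Import structures.
From mathcomp Require Import all_boot all_order all_algebra.
From mathcomp Require Import reals.
From mathcomp Require Import zify.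

Set Implicit Arguments.
Unset Strict Implicit.
Unset Printing Implicit Defensive.

(** G is partitioned into boundedly many clusters of equal size.  Instead of regular pairs, as in the
    regularity lemma, one only asks that almost all edges lie in pairs of clusters without holes, a
    hole being a pair of large subsets whose edges are very sparse; refining along holes increases
    the number of pairs of vertices covered by sparse pairs, so this stops.  In a pair without
    holes, small trees are embedded greedily as long as both clusters have some unused vertices.

    A deficiency version of Hall's theorem, applied first to the clusters of small degree and then
    to the rest, yields adjacent vertices u, v such that either both see at least about k vertices
    of a 2-matching of clusters, or u sees about k vertices on one side of a matching and v sees
    about k/2 vertices in clusters of large degree and in a second matching.

    A bounded set of seeds cuts Q into small trees, each attached to at most two seeds, which
    belong to the same colour class.  All seeds are embedded at once into a complete bipartite
    graph between vertices that see every cluster like u, respectively v; this takes care of the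
    edges off the spanning tree.  The small trees are then scheduled into the matched pairs. *)

(** * Matchings and deficiency *)

(** The sparseness of a hole is an absolute degree bound [h], a constant fraction of n. Pieces have
    at most [h] vertices, so the number of seeds is bounded, and a minimum degree [h] is all that
    the greedy embedding of a piece requires. Rounding the degrees of a vertex into the halves of
    the clusters gives boundedly many types. Edges between two types that span few edges are deleted
    beforehand, so every surviving edge uv lies between types dense enough to contain a complete
    bipartite graph with room for all seeds. The two seeds of a piece need the same colour because
    both have to see the same half of a cluster. That v sees only about k/2 is enough: v represents
    the colour whose seeds carry at most k/2 vertices of the pieces. One of the two outcomes always
    occurs, by a count: if no vertex in a large cluster of the critical independent set leads to the
    second, the 2-matching misses so few vertices that every edge between large clusters yields the
    first. *)

HB.lock Definition nbhd (T : finType) (H : rel T) (A : {set T}) : {set T} :=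
  [set y | [exists x in A, H x y]].

Lemma nbhdP (T : finType) (H : rel T) (A : {set T}) y :
  reflect (exists2 x, x \in A & H x y) (y \in nbhd H A).
Proof. by rewrite nbhd.unlock inE; apply: (iffP exists_inP). Qed.

Lemma nbhdU (T : finType) (H : rel T) (A B : {set T}) :
  nbhd H (A :|: B) = nbhd H A :|: nbhd H B.
Proof.
apply/setP=> y; rewrite inE; apply/nbhdP/orP.
  by case=> x /setUP[xA|xB] h; [left|right]; apply/nbhdP; exists x.
by case=> /nbhdP[x xA h]; exists x => //; rewrite inE xA ?orbT.
Qed.

Lemma nbhdS (T : finType) (H : rel T) (A B : {set T}) :
  A \subset B -> nbhd H A \subset nbhd H B.
Proof. by move=> sAB; rewrite -(setUidPr sAB) nbhdU subsetUl. Qed.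

(** For A = B the injection is a permutation of A along edges of [H], so A is covered by disjoint
    cycles, where an edge traversed both ways and a loop count as cycles. This represents a
    2-matching. *)
Definition matched (T : finType) (H : rel T) (A B : {set T}) : Prop :=
  exists f : T -> T, {in A &, injective f} /\
    forall x, x \in A -> f x \in B /\ H x (f x).

Lemma matched0 (T : finType) (H : rel T) (A B : {set T}) :
  A = set0 -> matched H A B.
Proof. by move=> ->; exists id; split=> [x y|x]; rewrite inE. Qed.

Lemma matchedU (T : finType) (H : rel T) (A A' B B' : {set T}) :
  [disjoint B & B'] ->
  matched H A B -> matched H A' B' -> matched H (A :|: A') (B :|: B').
Proof.
move=> dB [f [fi fH]] [f' [fi' fH']].
exists (fun x => if x \in A then f x else f' x); split.
  move=> x y; rewrite !inE.
  case: ifP => xA; case: ifP => yA /= xA' yA'; [exact: fi| | | exact: fi'].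
    have [fx _] := fH _ xA; have [fy _] := fH' _ yA'.
    by move=> e; have := disjointFr dB fx; rewrite e fy.
  have [fx _] := fH' _ xA'; have [fy _] := fH _ yA.
  by move=> e; have := disjointFr dB fy; rewrite -e fx.
move=> x; rewrite inE; case: ifP => xA /= xA'.
  by have [? ?] := fH _ xA; rewrite inE; split=> //; apply/orP; left.
by have [? ?] := fH' _ xA'; rewrite inE; split=> //; apply/orP; right.
Qed.

Lemma matchedS (T : finType) (H : rel T) (A A' B B' : {set T}) :
  A' \subset A -> B \subset B' -> matched H A B -> matched H A' B'.
Proof.
move=> /subsetP sA /subsetP sB [f [fi fH]]; exists f; split.
  by move=> x y /sA xA /sA yA; apply: fi.
by move=> x /sA /fH[/sB ? ?].
Qed.

(** Induction on the size of A. A critical proper nonempty J is matched into its neighbourhood and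
    the rest of A outside it. Without critical sets any edge may be used, as the condition survives
    the loss of one vertex of B. *)
Lemma hall (T : finType) (H : rel T) (A B : {set T}) :
  (forall J : {set T}, J \subset A -> #|J| <= #|nbhd H J :&: B|) ->
  matched H A B.
Proof.
have [n] := ubnP #|A|; elim: n => // n IH in A B * => ltA hA.
have [A0|[x xA]] := set_0Vmem A; first exact: matched0.
case: (boolP [exists J : {set T},
    [&& J \subset A, J != set0, J != A & #|nbhd H J :&: B| <= #|J|]]).
  case/existsP=> J /and4P[sJA J0 JA leJ].
  have ltJ : #|J| < #|A| by apply: proper_card; rewrite properEneq JA.
  have cA : #|J| + #|A :\: J| = #|A| by rewrite -(cardsID J A) (setIidPr sJA).
  have gtJ : 0 < #|J| by rewrite card_gt0.
  have mJ : matched H J (B :&: nbhd H J).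
    apply: IH; first by lia.
    move=> J' sJ'; rewrite setIA -setIA setICA setIA.
    apply: leq_trans (hA J' (subset_trans sJ' sJA)) _.
    apply: subset_leq_card; apply/subsetP=> y; rewrite !inE => /andP[yN yB].
    by rewrite yB yN (subsetP (nbhdS H sJ')).
  have mJ' : matched H (A :\: J) (B :\: nbhd H J).
    apply: IH; first by lia.
    move=> J' sJ'.
    have sJ'A : J' \subset A := subset_trans sJ' (subsetDl _ _).
    have dJ : [disjoint J & J'].
      rewrite disjoint_sym; apply: disjointWl sJ' _.
      by rewrite -setI_eq0; apply/eqP/setP=> y; rewrite !inE; case: (y \in J); rewrite ?andbF.
    have := hA (J :|: J') (_ : _ \subset A).
    rewrite subUset sJA sJ'A => /(_ isT).
    have -> : #|J :|: J'| = #|J| + #|J'|.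
      by have := (leq_card_setU J J').2; rewrite dJ => /eqP.
    have : nbhd H (J :|: J') :&: B \subset
      (nbhd H J :&: B) :|: (nbhd H J' :&: (B :\: nbhd H J)).
      rewrite nbhdU; apply/subsetP=> y; rewrite !(in_setU, in_setI, in_setD).
      by case: (y \in nbhd H J); case: (y \in nbhd H J'); case: (y \in B).
    move=> /subset_leq_card; have := (leq_card_setU (nbhd H J :&: B)
      (nbhd H J' :&: (B :\: nbhd H J))).1; lia.
  have dB : [disjoint B :&: nbhd H J & B :\: nbhd H J].
    rewrite -setI_eq0; apply/eqP/setP=> y; rewrite !(in_setI, in_setD, in_set0).
    by case: (y \in nbhd H J); rewrite ?andbF.
  have := matchedU dB mJ mJ'; apply: matchedS.
    by apply/subsetP=> y; rewrite !inE; case: (y \in J).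
  by apply/subsetP=> y; rewrite !(in_setU, in_setI, in_setD);
    case: (y \in B); case: (y \in nbhd H J).
move=> noJ.
have := hA [set x]; rewrite sub1set cards1 => /(_ xA) /card_gt0P[y].
rewrite in_setI => /andP[/nbhdP[x' /set1P -> Hxy] yB].
have m1 : matched H [set x] [set y].
  exists (fun=> y); split; first by move=> ? ? /set1P-> /set1P->.
  by move=> z /set1P->; rewrite inE.
have m2 : matched H (A :\ x) (B :\ y).
  apply: IH; first by have := cardsD1 x A; rewrite xA; lia.
  move=> J sJ; have [->|J0] := eqVneq J set0; first by rewrite cards0.
  have sJA : J \subset A := subset_trans sJ (subsetDl _ _).
  have JA : J != A.
    by apply/eqP=> e; have /subsetP /(_ x) := sJ; rewrite e !inE eqxx xA => /(_ isT).
  have : ~~ (#|nbhd H J :&: B| <= #|J|).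
    by apply/negP=> l; case/existsP: noJ; exists J; rewrite sJA J0 JA.
  have -> : nbhd H J :&: (B :\ y) = (nbhd H J :&: B) :\ y.
    by rewrite setIDA.
  by have := cardsD1 y (nbhd H J :&: B); case: (y \in _) => /=; lia.
have d : [disjoint [set y] & B :\ y] by rewrite disjoints1 !inE eqxx.
have := matchedU d m1 m2; apply: matchedS; first by rewrite setD1K.
by rewrite setD1K.
Qed.

Definition stable (T : finType) (H : rel T) (J : {set T}) : bool :=
  [disjoint J & nbhd H J].

Lemma stableS (T : finType) (H : rel T) (J J' : {set T}) :
  J' \subset J -> stable H J -> stable H J'.
Proof. by move=> s; apply: disjointW => //; apply: nbhdS. Qed.

Lemma stableP (T : finType) (H : rel T) (J : {set T}) :
  reflect {in J &, forall x y, H x y = false} (stable H J).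
Proof.
apply: (iffP idP) => [dJ x y xJ yJ|h].
  apply/negP=> Hxy; have := disjointFr dJ yJ.
  by move/nbhdP; apply; exists x.
rewrite /stable -setI_eq0; apply/eqP/setP=> y; rewrite in_setI in_set0.
by apply/negP=> /andP[yJ /nbhdP[x xJ]]; rewrite h.
Qed.

Lemma max_deficiency (T : finType) (H : rel T) (C D : {set T}) :
  symmetric H ->
  exists I : {set T}, [/\ I \subset C, stable H I,
    matched H (nbhd H I :&: D) I,
    forall J : {set T}, J \subset C :\: (I :|: nbhd H I) -> stable H J ->
      J != set0 -> #|J| < #|nbhd H J :&: D :\: nbhd H I| &
    forall J : {set T}, J \subset C -> stable H J ->
      #|J| + #|nbhd H I :&: D| <= #|I| + #|nbhd H J :&: D|].
Proof.
move=> Hs.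
pose P (J : {set T}) := (J \subset C) && stable H J.
(* A lexicographic order in one number: the deficiency, shifted by |T| to stay natural, and then the
   size of J. *)
pose w (J : {set T}) := (#|J| + #|T| - #|nbhd H J :&: D|) * #|T|.+1 + #|J|.
have P0 : P set0 by rewrite /P sub0set; apply/stableP=> x y; rewrite inE.
case: (arg_maxnP w P0) => I /andP[sI stI] Imax.
have bnd (J : {set T}) : #|J| <= #|T| by apply: max_card.
have defM (J : {set T}) : J \subset C -> stable H J ->
    #|J| + #|nbhd H I :&: D| <= #|I| + #|nbhd H J :&: D|.
  move=> sJ stJ; have /Imax : P J by rewrite /P sJ.
  have := bnd J; have := bnd I; have := bnd (nbhd H J :&: D).
  have := bnd (nbhd H I :&: D); rewrite /w.
  move=> b1 b2 b3 b4 leW; rewrite leqNgt; apply/negP=> lt.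
  have : #|I| + #|T| - #|nbhd H I :&: D| < #|J| + #|T| - #|nbhd H J :&: D| by lia.
  move: leW; set a := _ - _; set b := _ - _; nia.
exists I; split=> //.
  apply: hall => J sJ.
  (* If J violated Hall's condition, removing its neighbours from I would discard fewer vertices
     than it frees, and so raise the deficiency. *)
  have st' : stable H (I :\: nbhd H J) := stableS (subsetDl _ _) stI.
  have := defM _ (subset_trans (subsetDl _ _) sI) st'.
  have : nbhd H (I :\: nbhd H J) :&: D \subset (nbhd H I :&: D) :\: J.
    apply/subsetP=> y; rewrite !in_setI in_setD in_setI => /andP[/nbhdP[x]].
    rewrite in_setD => /andP[xN xI] Hxy yD; rewrite yD andbT.
    apply/andP; split; last by apply/nbhdP; exists x.
    by apply: contra xN => yJ; apply/nbhdP; exists y; rewrite // Hs.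
  move=> /subset_leq_card; have := cardsID (nbhd H J) I.
  have := cardsID J (nbhd H I :&: D); rewrite (setIidPr sJ) (setIC I); lia.
(* A J with no more new neighbours than vertices could be added to I: the deficiency would not drop
   and the size would grow. *)
move=> J sJ stJ J0.
have JC : J \subset C := subset_trans sJ (subsetDl _ _).
have dI : [disjoint I & J].
  rewrite disjoint_sym; apply: disjointWl sJ _; rewrite -setI_eq0.
  by apply/eqP/setP=> y; rewrite !inE; case: (y \in I); rewrite ?andbF.
have cIJ : #|I :|: J| = #|I| + #|J|.
  by have := (leq_card_setU I J).2; rewrite dI => /eqP.
have PIJ : P (I :|: J).
  rewrite /P subUset sI JC /=; apply/stableP=> x y.
  have nIJ z t : z \in I -> t \in J -> H z t = false.
    move=> zI tJ; apply/negP=> Hzt; have /subsetP /(_ t tJ) := sJ.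
    rewrite in_setD in_setU negb_or => /andP[/andP[_ tN] _]; case/negP: tN.
    by apply/nbhdP; exists z.
  case/setUP=> xI /setUP[yI|yI].
  - exact: (stableP _ _ stI).
  - exact: nIJ.
  - by rewrite Hs nIJ.
  - exact: (stableP _ _ stJ).
have := Imax _ PIJ; rewrite /w cIJ => leW.
rewrite ltnNge; apply/negP=> leJ.
have : #|nbhd H (I :|: J) :&: D| <=
       #|nbhd H I :&: D| + #|nbhd H J :&: D :\: nbhd H I|.
  apply: leq_trans (leq_card_setU _ _).1; apply: subset_leq_card.
  rewrite nbhdU; apply/subsetP=> y; rewrite !(in_setU, in_setI, in_setD).
  by case: (y \in nbhd H I); case: (y \in nbhd H J); case: (y \in D).
have gtJ : 0 < #|J| by rewrite card_gt0.
move=> h; have := bnd (nbhd H I :&: D).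
have : #|I| + #|T| - #|nbhd H I :&: D| <=
  #|I| + #|J| + #|T| - #|nbhd H (I :|: J) :&: D| by lia.
move: leW; set b := _ - #|nbhd H (I :|: J) :&: D|.
set a := _ - _; nia.
Qed.

Lemma matched_inv (T : finType) (H : rel T) (A B : {set T}) :
  symmetric H -> matched H A B ->
  exists B' : {set T},
    [/\ B' \subset B, #|B'| = #|A|, matched H A B' & matched H B' A].
Proof.
move=> Hs [f [fi fH]]; exists (f @: A); split.
- by apply/subsetP=> _ /imsetP[x xA ->]; case: (fH _ xA).
- exact: card_in_imset.
- by exists f; split=> // x xA; rewrite imset_f //; case: (fH _ xA).
pose h y := odflt y [pick x in A | f x == y].
have hP y : y \in f @: A -> h y \in A /\ f (h y) = y.
  case/imsetP=> x xA ->; rewrite /h; case: pickP => /= [z /andP[zA /eqP] //|].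
  by move/(_ x); rewrite xA eqxx.
exists h; split.
  by move=> y y' /hP[_ e] /hP[_ e'] ee; rewrite -e -e' ee.
by move=> y yA; have [hA e] := hP _ yA; split=> //; rewrite -{1}e Hs; case: (fH _ hA).
Qed.

(** Each matching edge is traversed in both directions, which permutes A together with its image. *)
Lemma matched_fcover (T : finType) (H : rel T) (A B : {set T}) :
  symmetric H -> [disjoint A & B] -> matched H A B ->
  exists B' : {set T}, [/\ B' \subset B, #|B'| = #|A| &
    matched H (A :|: B') (A :|: B')].
Proof.
move=> Hs dAB /(matched_inv Hs)[B' [sB cB m m']]; exists B'; split=> //.
have d : [disjoint B' & A] by rewrite disjoint_sym; apply: disjointWr dAB.
by have := matchedU d m m'; rewrite (setUC B').
Qed.

Lemma fcoverU (T : finType) (H : rel T) (A B : {set T}) :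
  [disjoint A & B] -> matched H A A -> matched H B B ->
  matched H (A :|: B) (A :|: B).
Proof. exact: matchedU. Qed.

(* X and I are the critical sets of two deficiency arguments: among the small clusters S, and in
   what remains after removing X and its neighbours. *)
Lemma structure_sets (T : finType) (H : rel T) (S : {set T}) :
  symmetric H -> {in S &, forall x y, H x y = false} ->
  exists X I : {set T}, let Z := nbhd H X in let R := ~: (X :|: Z) in
    let N := nbhd H I :&: R in let R' := R :\: (I :|: N) in
    [/\ X \subset S, [disjoint Z & S], matched H Z X &
        matched H (S :\: X) (~: S :\: Z)] /\
    [/\ I \subset R, stable H I & matched H N I] /\
    [/\ matched H R' R',
        R' = set0 \/ (exists x y, [/\ x \in R' :\: S, y \in R' :\: S & H x y]) &
        forall J : {set T}, J \subset R -> stable H J ->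
           #|J| + #|N| <= #|I| + #|nbhd H J :&: R|].
Proof.
move=> Hs Sst.
have stS (J : {set T}) : J \subset S -> stable H J.
  move=> /subsetP sJ; apply/stableP=> x y /sJ xS /sJ yS; exact: Sst.
have [X [sX stX mZ ltX _]] := max_deficiency S setT Hs.
rewrite setIT in mZ.
set Z := nbhd H X in mZ ltX *.
have dZ : [disjoint Z & S].
  rewrite -setI_eq0; apply/eqP/setP=> y; rewrite in_setI in_set0.
  apply/negP=> /andP[/nbhdP[x xX Hxy] yS].
  by rewrite Sst // in Hxy; apply: (subsetP sX).
pose R := ~: (X :|: Z).
have [I [sI stI mN ltI defI]] := max_deficiency R R Hs.
exists X, I => /=; rewrite -/Z -/R.
set N := nbhd H I :&: R in mN defI *.
set R' := R :\: (I :|: N).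
split; [split=> //|split; [split=> //|split=> //]].
- apply: hall => J sJ.
  have [->|J0] := eqVneq J set0; first by rewrite cards0.
  have JS : J \subset S := subset_trans sJ (subsetDl _ _).
  have sJ' : J \subset S :\: (X :|: Z).
    apply/subsetP=> x xJ; move/subsetP/(_ x xJ): sJ; rewrite !in_setD in_setU.
    by case/andP=> /negPf-> xS; rewrite xS (disjointFl dZ xS).
  have := ltX J sJ' (stS _ JS) J0; rewrite setIT => /ltnW.
  move/leq_trans; apply; apply: subset_leq_card; apply/subsetP=> y.
  rewrite !(in_setI, in_setD, in_setC) => /andP[-> yN]; rewrite yN /=.
  apply/negP=> yS; case/nbhdP: yN => x xJ.
  by rewrite Sst // (subsetP JS).
- apply: hall => J sJ.
  (* Vertices of J with a neighbour in J already count as neighbours of J. The others form a stable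
     set, to which the maximality of I applies, and the neighbours of that set lie outside J. *)
  pose J0 := J :\: nbhd H J.
  have stJ0 : stable H J0.
    apply/stableP=> x y; rewrite !in_setD => /andP[_ xJ] /andP[yN _].
    by apply: contraNF yN => Hxy; apply/nbhdP; exists x.
  have notI x y : x \in R' -> H x y -> y \notin I.
    rewrite in_setD in_setU negb_or => /andP[/andP[_ xN] xR] Hxy.
    apply: contra xN => yI; rewrite in_setI xR andbT; apply/nbhdP; exists y => //.
    by rewrite Hs.
  have sJR : J \subset R := subset_trans sJ (subsetDl _ _).
  have c1 : #|J0| <= #|nbhd H J0 :&: R'|.
    have [->|J00] := eqVneq J0 set0; first by rewrite cards0.
    have sJ0 : J0 \subset R :\: (I :|: nbhd H I).
      apply/subsetP=> x /setDP[xJ _]; move/subsetP/(_ x xJ): sJ.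
      rewrite !(in_setD, in_setU, in_setI) => /andP[h xR].
      by move: h; rewrite xR andbT => ->.
    apply: leq_trans (ltnW (ltI _ sJ0 stJ0 J00)) _; apply: subset_leq_card.
    apply/subsetP=> y; rewrite !(in_setD, in_setU, in_setI) => /and3P[yI yJ yR].
    rewrite yJ yR (negPf yI) /= orbF andbT; case/nbhdP: yJ => x /setDP[xJ _].
    by apply: notI; apply: (subsetP sJ).
  have : (J :&: nbhd H J) :|: (nbhd H J0 :&: R') \subset nbhd H J :&: R'.
    apply/subsetP=> y; rewrite in_setU !in_setI => /orP[] /andP[yJ yN].
      by rewrite yN (subsetP sJ).
    by rewrite yN andbT (subsetP (nbhdS H (subsetDl J (nbhd H J)))).
  move=> /subset_leq_card; apply: leq_trans.
  have d : [disjoint J :&: nbhd H J & nbhd H J0 :&: R'].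
    rewrite -setI_eq0; apply/eqP/setP=> y; rewrite !in_setI in_set0.
    apply/negP=> /andP[/andP[yJ _] /andP[/nbhdP[x /setDP[xJ xN] Hxy] _]].
    by case/negP: xN; apply/nbhdP; exists y; rewrite // Hs.
  have := (leq_card_setU (J :&: nbhd H J) (nbhd H J0 :&: R')).2.
  rewrite d => /eqP ->; rewrite -(cardsID (nbhd H J) J) leq_add2l; exact: c1.
- case: (boolP [exists x in R' :\: S, exists y in R' :\: S, H x y]) => [|no].
    by case/exists_inP=> x xR /exists_inP[y yR Hxy]; right; exists x, y.
  left.
  have st2 : stable H (R' :\: S).
    apply/stableP=> x y xR yR; apply: contraNF no => Hxy.
    by apply/exists_inP; exists x => //; apply/exists_inP; exists y.
  (* Without an edge inside R' minus S, both R' minus S and R' within S are stable; each would be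
     strictly smaller than its neighbourhood in R', hence than the other. *)
  have strict (J J' : {set T}) : J \subset R' -> stable H J -> J != set0 ->
      (forall x y, x \in J -> y \in R' -> H x y -> y \in J') -> #|J| < #|J'|.
    move=> sJ stJ J0 JJ'.
    have sJ0 : J \subset R :\: (I :|: nbhd H I).
      apply/subsetP=> x xJ; move/subsetP/(_ x xJ): sJ.
      rewrite !(in_setD, in_setU, in_setI) => /andP[h xR].
      by move: h; rewrite xR andbT => ->.
    apply: leq_trans (ltI _ sJ0 stJ J0) _; apply: subset_leq_card.
    apply/subsetP=> y; rewrite !(in_setD, in_setI) => /and3P[yI yJ yR].
    case/nbhdP: yJ => x xJ Hxy; apply: (JJ' x y xJ _ Hxy).
    rewrite !(in_setD, in_setU, in_setI) (negPf yI) yR /= orbF andbT.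
    apply: contra yI => yI; move/subsetP: sJ0 => /(_ x xJ).
    rewrite in_setD in_setU negb_or => /andP[/andP[_ xN] _]; case/negP: xN.
    by apply/nbhdP; exists y; rewrite // Hs.
  have [L0|LN] := eqVneq (R' :\: S) set0.
    have sR'S : R' \subset S by rewrite -setD_eq0 L0.
    apply/eqP/negPn/negP=> R0.
    have := strict _ set0 (subxx _) (stS _ sR'S) R0; rewrite cards0.
    have h x y : x \in R' -> y \in R' -> H x y -> y \in set0.
      by move=> xR yR; rewrite Sst // (subsetP sR'S).
    by move/(_ h).
  have lt1 : #|R' :\: S| < #|R' :&: S|.
    apply: strict => //; first exact: subsetDl.
    move=> x y xR yR Hxy; rewrite in_setI yR /=; apply: contraTT Hxy => yS.
    by rewrite (stableP _ _ st2) // in_setD yS.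
  have : #|R' :&: S| < #|R' :\: S|.
    apply: strict; [exact: subsetIl|exact/stS/subsetIr| |].
      by rewrite -card_gt0; apply: leq_ltn_trans lt1.
    move=> x y /setIP[_ xS] yR Hxy; rewrite in_setD yR andbT.
    by apply: contraTN Hxy => yS; rewrite Sst.
  by lia.
Qed.

(** * The matching structure of the cluster graph *)

Definition deg_in (V : finType) (g : rel V) (x : V) (A : {set V}) : nat :=
  #|[set y in A | g x y]|.

Lemma deg_inS (V : finType) (g : rel V) (x : V) (A B : {set V}) :
  A \subset B -> deg_in g x A <= deg_in g x B.
Proof.
move=> /subsetP sAB; apply/subset_leq_card/subsetP=> y.
by rewrite !inE => /andP[/sAB -> ->].
Qed.

Lemma deg_inU (V : finType) (g : rel V) (x : V) (A B : {set V}) :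
  deg_in g x (A :|: B) <= deg_in g x A + deg_in g x B.
Proof.
apply: leq_trans (leq_card_setU _ _).1; apply/subset_leq_card/subsetP=> y.
by rewrite !inE => /andP[/orP[]-> ->]; rewrite ?orbT.
Qed.

Lemma deg_in_le (V : finType) (g : rel V) (x : V) (A : {set V}) :
  deg_in g x A <= #|A|.
Proof. by apply/subset_leq_card/subsetP=> y; rewrite inE => /andP[]. Qed.

Lemma deg_in_sum (V : finType) (g : rel V) (x : V) (A : {set V}) :
  deg_in g x A = \sum_(y in A) g x y.
Proof.
rewrite /deg_in -sum1_card big_mkcond [RHS]big_mkcond; apply: eq_bigr => y _.
by rewrite inE; case: (y \in A) => //=; case: (g x y).
Qed.

Lemma double_count (V : finType) (g : rel V) (A B : {set V}) :
  symmetric g ->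
  \sum_(x in A) deg_in g x B = \sum_(y in B) deg_in g y A.
Proof.
move=> gs; under eq_bigr do rewrite deg_in_sum.
under [RHS]eq_bigr do rewrite deg_in_sum.
rewrite exchange_big /=; apply: eq_bigr => y _; apply: eq_bigr => x _.
by rewrite gs.
Qed.

(** In the last case of [structure], [U], [tau], [NZ], [Y] count vertices and [e1], [e2], [e3]
    edges. The degree bounds give 2U <= tau + NZ. Eliminating the edges and [Y] bounds 2(K - K')(tau
    + NZ) by 2 sig U plus an error of order K(b + gam); as sig <= K - K', this makes U small. *)
Lemma counting_bound (K K' sig b gam U tau NZ Y e1 e2 e3 LI : nat) :
  K' <= K -> 0 < K -> sig <= K - K' -> sig <= K ->
  K * U <= e1 + e2 -> 2 * e1 <= K' * tau -> 2 * e2 <= K' * NZ ->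
  e2 + (K - K') * NZ <= e3 -> e3 <= (K + sig) * Y ->
  Y + tau <= LI + gam -> LI <= U + b ->
  (K - K') * U <= 2 * K * (b + gam).
Proof.
move=> K'K Kp sK sK2 h1 h2 h3 h4 h5 h6 h7.
have [d Ed] : exists d, K = K' + d by exists (K - K'); lia.
rewrite (_ : K - K' = d) in sK h4 *; last lia.
have ii : 2 * U <= tau + NZ.
  have : K * (2 * U) <= K * (tau + NZ); last by rewrite leq_pmul2l.
  have : 2 * (K * U) <= K' * tau + K' * NZ by lia.
  by rewrite -mulnDr => h; have := leq_mul K'K (leqnn (tau + NZ)); lia.
have h8 : (K + sig) * (Y + tau) <= (K + sig) * (U + b + gam).
  by apply: leq_mul => //; lia.
have h9 : d * (2 * U) <= d * (tau + NZ) by apply: leq_mul.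
have h10 : sig * U <= d * U by apply: leq_mul.
have h11 : sig * (b + gam) <= K * (b + gam) by apply: leq_mul.
have : 2 * (K * U) + 2 * (d * NZ) <= K' * tau + 2 * ((K + sig) * Y) by lia.
rewrite !mulnDr !mulnDl in h8 h9 h10 h11 h5 *; move: h8 h9 h10 h11.
have := leq0n (sig * tau); have := leq0n (K' * tau).
have -> : K * tau = K' * tau + d * tau by rewrite Ed mulnDl.
clear; lia.
Qed.

Section Structure.

Variables (V T : finType) (g : rel V) (C : V -> option T) (H : rel T).
Variables (L : {set T}) (s K K' sig gam b : nat).

Definition span (D : {set T}) : {set V} :=
  [set x | if C x is Some i then i \in D else false].

Lemma spanP (D : {set T}) x :
  reflect (exists2 i, i \in D & C x = Some i) (x \in span D).
Proof.
rewrite inE; case: (C x) => [i|]; last by right; case.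
by apply: (iffP idP) => [iD|[j jD [->]]//]; exists i.
Qed.

Lemma spanU D D' : span (D :|: D') = span D :|: span D'.
Proof. by apply/setP=> x; rewrite !inE; case: (C x) => // i; rewrite inE. Qed.

Lemma spanS (D D' : {set T}) : D \subset D' -> span D \subset span D'.
Proof. by move=> s'; rewrite -(setUidPr s') spanU subsetUl. Qed.

Hypothesis card_cluster : forall i, #|[set x | C x == Some i]| = s.

Lemma card_span D : #|span D| = s * #|D|.
Proof.
have -> : #|span D| = \sum_(x | C x != None) \sum_(i in D) (C x == Some i).
  rewrite -sum1_card big_mkcond [RHS]big_mkcond; apply: eq_bigr => x _.
  rewrite inE; case: (C x) => [j|] //=.
  case: (boolP (j \in D)) => jD.
    rewrite (bigD1 j) //= eqxx big1 // => i /andP[_ ij].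
    by apply/eqP; rewrite eqb0; apply: contra ij => /eqP[->].
  rewrite big1 // => i iD; case: eqP => // -[ji].
  by rewrite ji iD in jD.
rewrite exchange_big /= mulnC -sum_nat_const; apply: eq_bigr => i _.
rewrite -(card_cluster i) -sum1_card big_mkcond [RHS]big_mkcond.
by apply: eq_bigr => x _; rewrite inE; case: (C x) => [j|] //=; case: ifP => // ->.
Qed.

Hypothesis gs : symmetric g.
Hypothesis gC : forall x y, g x y -> C x != None.
Hypothesis HE : forall i j, reflect
  (exists x y, [/\ C x = Some i, C y = Some j & g x y]) (H i j).
Hypothesis Hsmall : forall i j, i \notin L -> j \notin L -> H i j = false.
Hypothesis degL : forall x y i, C x = Some i -> i \in L -> g x y ->
  K <= deg_in g x setT.
Hypothesis degS : forall x i, C x = Some i -> i \notin L ->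
  deg_in g x setT <= K + sig.
Hypothesis cardLS : s * #|~: L| <= s * #|L| + gam.
Hypothesis edgeLL : exists i j, [/\ i \in L, j \in L & H i j].
Hypothesis isolated :
  #|[set x in span L | deg_in g x setT == 0]| <= b.
Hypothesis K'K : K' <= K.
Hypothesis sigK : sig <= K - K'.
Hypothesis sigK2 : sig <= K.
Hypothesis small_err :
  4 * K * (b + gam) + (2 * b + gam) * (K - K') <= (K - K') * (K - K').
Hypothesis Kpos : 0 < K - K'.

Lemma Hsym : symmetric H.
Proof.
by move=> i j; apply/HE/HE => -[x [y [? ? ?]]]; exists y, x; split=> //; rewrite gs.
Qed.

Lemma deg_span x (D : {set T}) :
  (forall y j, g x y -> C y = Some j -> j \in D) ->
  deg_in g x (span D) = deg_in g x setT.
Proof.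
move=> h; apply/eqP; rewrite eqn_leq deg_inS ?subsetT //=.
apply/subset_leq_card/subsetP=> y; rewrite !in_set /= => gxy; rewrite gxy andbT.
case E: (C y) => [j|]; first exact: h gxy E.
by move: (gxy); rewrite gs => /gC; rewrite E.
Qed.

Lemma deg_span_miss x (D : {set T}) :
  deg_in g x setT <= deg_in g x (span D) + s * #|~: D|.
Proof.
have sub : deg_in g x setT = deg_in g x (span setT).
  by rewrite deg_span // => y j; rewrite inE.
rewrite sub -(setUCr D) spanU -card_span.
by apply: leq_trans (deg_inU _ _ _ _) _; rewrite leq_add2l deg_in_le.
Qed.

Definition caseI : Prop := exists u v (D : {set T}),
  [/\ g u v, matched H D D,
      K' <= deg_in g u (span D) & K' <= deg_in g v (span D)].

(** Only half of [K'] is asked of v, which will represent the colour whose seeds carry at most half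
    of the vertices to be placed. *)
Definition caseII : Prop := exists u v (A B A' B' : {set T}),
  [/\ g u v, [disjoint A & B], matched H A B & K' <= deg_in g u (span A)] /\
  [/\ [disjoint A' & B'], matched H A' B' &
      exists B'' : {set T}, [/\ B'' \subset B', matched H A' B'', #|B''| = #|A'|
        & K' <= 2 * deg_in g v (span (L :|: (A' :|: B'')))]].

(** If R' contains an edge between large clusters, the ends of an underlying edge of [g] see only D.
    Otherwise R' is empty. Then either a vertex in a large cluster of I has a neighbour that sees
    K'/2 vertices outside the unmatched part Y of X, which leads to case II, or counting shows that
    D misses at most K - K' vertices. *)
Lemma structure : caseI \/ caseII.
Proof.
have Sst : {in ~: L &, forall x y, H x y = false}.
  by move=> i j; rewrite !inE => iL jL; exact: Hsmall.
have [X [I]] := structure_sets Hsym Sst.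
set Z := nbhd H X; set R := ~: (X :|: Z); set N := nbhd H I :&: R.
set R' := R :\: (I :|: N); move=> /=.
rewrite setCK -/R -/N -/R' => -[[sX dZ mZ mS] [[sI stI mN] [mR' R'0 maxI]]].
have sZL : Z \subset L by move: dZ; rewrite disjoints_subset setCK.
have XR i : i \in X -> i \notin R by rewrite !in_set => ->.
have ZR i : i \in Z -> i \notin R by rewrite !in_set => ->; rewrite orbT.
have notX i j : i \in R -> H i j -> j \notin X.
  move=> iR Hij; apply: contraL iR => jX; apply: ZR.
  by apply/nbhdP; exists j; rewrite // Hsym.
have dXZ : [disjoint Z & X].
  exact: disjointWr sX dZ.
have [X1 [sX1 cX1 mZ1 m1Z]] := matched_inv Hsym mZ.
have dNI : [disjoint N & I].
  apply/pred0P=> i /=; apply/negP=> /andP[/setIP[iN _] iI].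
  by have := disjointFr stI iI; rewrite iN.
have [I1 [sI1 cI1 mcN]] := matched_fcover Hsym dNI mN.
have mcZ : matched H (Z :|: X1) (Z :|: X1).
  have d : [disjoint X1 & Z] by rewrite disjoint_sym; apply: disjointWr dXZ.
  by have := matchedU d mZ1 m1Z; rewrite (setUC X1).
have sNR : N \subset R by apply: subsetIr.
pose D := (Z :|: X1) :|: (N :|: I1) :|: R'.
have mD : matched H D D.
  apply: fcoverU => //.
    apply/pred0P=> i /=; apply/negP=> /andP[iZ]; rewrite in_setD in_setU negb_or.
    case/andP=> /andP[iI iN] iR.
    case/setUP: iZ => /setUP[iZ|h].
    - by case/negP: (ZR _ iZ).
    - by case/negP: (XR _ (subsetP sX1 _ h)).
    - by rewrite iZ in iN.
    - by rewrite (subsetP sI1 _ h) in iI.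
  apply: fcoverU => //.
  apply/pred0P=> i /=; apply/negP=> /andP[iZ iN].
  have iR : i \in R.
    by case/setUP: iN => [/(subsetP sNR)//|/(subsetP sI1)/(subsetP sI)].
  by case/setUP: iZ => [/ZR/negP|/(subsetP sX1)/XR/negP].
have gH u v i j : g u v -> C u = Some i -> C v = Some j -> H i j.
  by move=> guv Ci Cj; apply/HE; exists u, v.
have nbrC u v : g u v -> exists j, C v = Some j.
  by rewrite gs => /gC; case: (C v) => // j; exists j.
case: R'0 => [R'0|[i [j [iR jR Hij]]]]; last first.
  have cov u v i' : g u v -> C u = Some i' -> i' \in R' :\: ~: L ->
      K' <= deg_in g u (span D).
    move=> guv Ci; rewrite in_setD in_setC negbK => /andP[iL iR'].
    rewrite deg_span; first exact: leq_trans K'K (degL Ci iL guv).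
    move=> y j' guy Cj; have Hij' := gH _ _ _ _ guy Ci Cj.
    move: (iR'); rewrite in_setD in_setU negb_or => /andP[/andP[iI iN] iRR].
    rewrite in_setU; case: (boolP (j' \in Z)) => jZ; first by rewrite !in_setU jZ.
    have jRR : j' \in R by rewrite in_setC in_setU negb_or (notX _ _ iRR Hij').
    case: (boolP (j' \in N)) => jN; first by rewrite !in_setU jN ?orbT.
    apply/orP; right; rewrite in_setD in_setU negb_or jN jRR !andbT.
    apply: contra iN => jI; rewrite in_setI iRR andbT; apply/nbhdP.
    by exists j'; rewrite // Hsym.
  have [u [v [Cu Cv guv]]] := HE _ _ Hij.
  left; exists u, v, D; split=> //; first exact: cov guv Cu iR.
  by apply: (cov v u j) => //; rewrite gs.
have RIN i : i \in R -> (i \in I) || (i \in N).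
  by move=> iR; have := in_set0 i; rewrite -R'0 in_setD iR andbT in_setU => /negbT /negPn.
pose LI := I :&: L; pose SN := N :\: L; pose SR := ~: L :\: X.
pose Y := X :\: X1.
have nbrI u v i j : C u = Some i -> i \in I -> g u v -> C v = Some j ->
    (j \in Z) || (j \in N).
  move=> Ci iI guv Cj; have Hij := gH _ _ _ _ guv Ci Cj.
  have iR := subsetP sI _ iI.
  case: (boolP (j \in Z)) => //= jZ; rewrite in_setI in_setC in_setU negb_or jZ.
  by rewrite (notX _ _ iR Hij) !andbT; apply/nbhdP; exists i.
case: (boolP [exists u, exists v,
   [&& u \in span LI, g u v & K' <= 2 * deg_in g v (span (~: Y))]]).
  case/existsP=> u /existsP[v /and3P[/spanP[i /setIP[iI iL] Ci] guv leK]].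
  right; have [B2 [sB2 cB2 mB2 _]] := matched_inv Hsym mS.
  have dX2 : [disjoint X1 & B2].
    apply/pred0P=> j /=; apply/negP=> /andP[/(subsetP sX1)/(subsetP sX) jX].
    by move/(subsetP sB2); rewrite in_setD; move: jX; rewrite in_setC => /negPf->; rewrite andbF.
  (* A vertex in I sees only Z and N, and both are matched. The second matching pairs Z with X1 and
     the small clusters outside X with large ones; together with L it leaves out nothing but Y. *)
  exists u, v, (Z :|: N), (X :|: I), (Z :|: SR), (X1 :|: B2).
  split; split=> //.
  - apply/pred0P=> j /=; apply/negP=> /andP[/setUP[jZ|jN] /setUP[jX|jI]].
    + by rewrite (disjointFr dXZ jZ) in jX.
    + by case/negP: (ZR _ jZ); apply: (subsetP sI).
    + by case/negP: (XR _ jX); apply: (subsetP sNR).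
    + by rewrite (disjointFr dNI jN) in jI.
  - apply: matchedU => //; apply/pred0P=> j /=; apply/negP=> /andP[jX].
    by move/(subsetP sI); rewrite (negPf (XR _ jX)).
  - rewrite deg_span; first exact: leq_trans K'K (degL Ci iL guv).
    by move=> y j guy Cj; rewrite in_setU; apply: (nbrI _ _ _ _ Ci iI guy Cj).
  - apply/pred0P=> j /=; apply/negP=> /andP[/setUP[jZ|jS] /setUP[jX|jI]].
    + by move/(subsetP sX1): jX; rewrite (disjointFr dXZ jZ).
    + by move/(subsetP sB2): jI; rewrite in_setD jZ.
    + by move/(subsetP sX1): jX => jX; rewrite in_setD jX in jS.
    + move/(subsetP sB2): jI; rewrite in_setD => /andP[_ jL].
      by rewrite in_setD in_setC jL andbF in jS.
  - exact: matchedU.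
  exists (X1 :|: B2); split=> //.
  - exact: matchedU.
  - rewrite !cardsU cX1 cB2; have -> : X1 :&: B2 = set0 by apply/eqP; rewrite setI_eq0.
    have -> : Z :&: SR = set0; last by rewrite !cards0.
    apply/setP=> j; rewrite in_setI in_set0; apply/negP=> /andP[/(subsetP sZL) jL].
    by rewrite in_setD in_setC jL andbF.
  apply: leq_trans leK _; rewrite leq_mul2l /=; apply: deg_inS; apply: spanS.
  apply/subsetP=> j; rewrite in_setC in_setD !in_setU in_setD in_setC.
  by case: (j \in L) => //=; case: (j \in X) => /=; rewrite ?orbT // andbT negbK => ->; rewrite !orbT.
move=> no2.
have lowdeg u v i : C u = Some i -> i \in LI -> g u v ->
    2 * deg_in g v (span (~: Y)) < K'.
  move=> Ci iI guv; rewrite ltnNge; apply: contra no2 => h.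
  by apply/existsP; exists u; apply/existsP; exists v; rewrite guv h !andbT; apply/spanP; exists i.
(* A vertex in a large cluster of N has no neighbour in X, so its whole degree counts outside Y and
   case II would have occurred. *)
have noLN i j : i \in LI -> j \in N -> H i j -> j \notin L.
  move=> iI jN /HE[u [v [Cu Cv guv]]]; apply/negP=> jL.
  have := lowdeg _ _ _ Cu iI guv; rewrite deg_span.
    have gvu : g v u by rewrite gs.
    by have := degL Cv jL gvu; move: K'K; clear; lia.
  move=> y l gvy Cl; rewrite in_setC in_setD negb_and.
  by rewrite (notX _ _ _ (gH _ _ _ _ gvy Cv Cl)) ?orbT // (subsetP sNR).
left; have [i0 [j0 [i0L j0L Hij0]]] := edgeLL.
have [u0 [v0 [Cu0 Cv0 guv0]]] := HE _ _ Hij0.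
have gvu0 : g v0 u0 by rewrite gs.
(* The ends of an edge between large clusters have degree at least K and can afford to lose K - K'
   neighbours. *)
suff sD : s * #|~: D| <= K - K'.
  exists u0, v0, D; split=> //.
    have := deg_span_miss u0 D; have := degL Cu0 i0L guv0.
    by move: sD K'K; clear; lia.
  have := deg_span_miss v0 D; have := degL Cv0 j0L gvu0.
  by move: sD K'K; clear; lia.
(* All edges at [U] lead to the small clusters [SN] of N or to [NZ]; these are counted by [e1] and
   [e2], and the edges from [NZ] to Y by [e3]. *)
pose U := [set x in span LI | deg_in g x setT != 0].
pose NZ := [set v in span Z | deg_in g v U != 0].
have cLI : s * #|LI| <= #|U| + b.
  rewrite -card_span -(cardsID [set x | deg_in g x setT != 0] (span LI)).
  apply: leq_add; first by apply: subset_leq_card; apply/subsetP=> x; rewrite !in_set.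
  apply: leq_trans isolated; apply: subset_leq_card; apply/subsetP=> x.
  rewrite in_setD in_set negbK => /andP[d0 xL].
  by rewrite in_set d0 andbT (subsetP (spanS (subsetIr I L))).
have UP x : x \in U -> exists i, [/\ C x = Some i, i \in LI & K <= deg_in g x setT].
  rewrite in_set -lt0n => /andP[/spanP[i iI Ci] /card_gt0P[y]].
  rewrite in_set in_setT /= => gxy; exists i; split=> //.
  by apply: degL gxy; [exact: Ci | case/setIP: iI].
pose e1 := \sum_(x in U) deg_in g x (span SN).
pose e2 := \sum_(x in U) deg_in g x NZ.
pose e3 := \sum_(y in NZ) deg_in g y (span Y).
have h1 : K * #|U| <= e1 + e2.
  rewrite -big_split /= mulnC -sum_nat_const; apply: leq_sum => x xU.
  have [i [Ci iI le]] := UP _ xU; apply: leq_trans le _.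
  apply: leq_trans (deg_inU _ _ _ _); apply/subset_leq_card/subsetP=> y.
  rewrite in_set => /andP[_ gxy]; rewrite in_set gxy andbT in_setU.
  have [j Cj] := nbrC _ _ gxy.
  have iI' : i \in I by case/setIP: iI.
  case/orP: (nbrI _ _ _ _ Ci iI' gxy Cj) => jj.
    apply/orP; right; rewrite in_set; apply/andP; split; first by apply/spanP; exists j.
    by rewrite -lt0n; apply/card_gt0P; exists x; rewrite in_set xU gs.
  apply/orP; left; apply/spanP; exists j => //; rewrite in_setD jj andbT.
  exact: (noLN i j iI jj (gH _ _ _ _ gxy Ci Cj)).
have sUY : U \subset span (~: Y).
  apply/subsetP=> x; rewrite in_set => /andP[xL _]; apply: (subsetP (spanS _)) xL.
  apply/subsetP=> i /setIP[/(subsetP sI) iR _]; rewrite in_setC in_setD negb_and.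
  by apply/orP; right; apply: contraL iR => /XR.
have lowU y : deg_in g y U != 0 -> 2 * deg_in g y (span (~: Y)) < K'.
  rewrite -lt0n => /card_gt0P[x]; rewrite in_set => /andP[xU gyx].
  by have [i [Ci iI _]] := UP _ xU; apply: lowdeg Ci iI _; rewrite gs.
have lowU' y : 2 * deg_in g y U <= K'.
  case: (eqVneq (deg_in g y U) 0) => [->//|/lowU lt].
  by have := deg_inS g y sUY; move: lt; clear; lia.
have h2 : 2 * e1 <= K' * (s * #|SN|).
  rewrite /e1 double_count // big_distrr /= -card_span mulnC -sum_nat_const.
  exact: leq_sum.
have h3 : 2 * e2 <= K' * #|NZ|.
  rewrite /e2 double_count // big_distrr /= mulnC -sum_nat_const.
  exact: leq_sum.
(* A vertex of [NZ] has degree at least K and fewer than K'/2 neighbours outside Y, those in U among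
   them; so it has at least K - K' more neighbours in Y than in U. *)
have h4 : e2 + (K - K') * #|NZ| <= e3.
  rewrite /e2 double_count // [_ * #|NZ|]mulnC -sum_nat_const -big_split /=.
  apply: leq_sum => y; rewrite in_set => /andP[/spanP[j jZ Cj] dy].
  have lt := lowU _ dy.
  move: (dy); rewrite -lt0n => /card_gt0P[x]; rewrite in_set => /andP[_ gyx].
  have := degL Cj (subsetP sZL _ jZ) gyx.
  have -> : deg_in g y setT = deg_in g y (span setT).
    by rewrite deg_span // => z l; rewrite in_setT.
  have := deg_inU g y (span Y) (span (~: Y)); rewrite -spanU setUCr.
  by have := deg_inS g y sUY; move: lt K'K; clear; lia.
have h5 : e3 <= (K + sig) * (s * #|Y|).
  rewrite /e3 double_count // -card_span mulnC -sum_nat_const.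
  apply: leq_sum => x /spanP[i /setDP[iX _] Ci].
  apply: leq_trans (deg_inS _ _ (subsetT _)) _.
  by apply: degS Ci _; move/(subsetP sX): iX; rewrite in_setC.
have cS : #|~: L| = #|X| + #|SR|.
  by rewrite -(cardsID X (~: L)) (setIidPr sX).
have cL : #|L| = #|Z| + #|L :\: Z|.
  by rewrite -(cardsID Z L) (setIidPr sZL).
have cSR : #|SR| = #|I :\: L| + #|SN|.
  have -> : SR = (I :\: L) :|: SN.
    apply/setP=> i; rewrite in_setU !in_setD in_setC.
    case: (boolP (i \in L)) => iL /=; first by rewrite andbF.
    rewrite andbT; apply/idP/idP => [iX|].
      apply: RIN; rewrite in_setC in_setU negb_or iX /=.
      by apply: contra iL => /(subsetP sZL).
    by case/orP=> [/(subsetP sI)|/(subsetP sNR)] iR; apply: contraL iR => /XR.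
  rewrite cardsU (_ : _ :&: _ = set0) ?cards0 ?subn0 //.
  apply/setP=> i; rewrite in_setI in_set0 !in_setD.
  by case: (boolP (i \in N)) => iN; rewrite ?andbF // (disjointFr dNI iN) !andbF.
have cLR : #|L :\: Z| = #|LI| + #|N :&: L|.
  have -> : L :\: Z = LI :|: (N :&: L).
    apply/setP=> i; rewrite in_setU !in_setI in_setD.
    case: (boolP (i \in L)) => iL /=; last by rewrite !andbF.
    rewrite !andbT; apply/idP/idP => [iZ|].
      rewrite -(in_setI i); apply: RIN; rewrite in_setC in_setU negb_or iZ andbT.
      by apply: contraL iL => /(subsetP sX); rewrite in_setC.
    by case/orP=> [/(subsetP sI)|/andP[_]] iR; apply: contraL iR => /ZR.
  rewrite cardsU (_ : LI :&: (N :&: L) = set0) ?cards0 ?subn0 //.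
  apply/setP=> i; rewrite in_setI in_set0 [i \in LI]in_setI [i \in N :&: L]in_setI.
  by case: (boolP (i \in N)) => iN; rewrite ?(disjointFr dNI iN) /= ?andbF.
have cI : #|I| = #|LI| + #|I :\: L| by rewrite cardsID.
have cN : #|N| = #|N :&: L| + #|SN| by rewrite cardsID.
(* Small clusters of I lie outside X, and their partners under [mS] are large clusters of N. *)
have c1 : #|I :\: L| <= #|N :&: L|.
  case: mS => f [fi fH].
  have sIS : I :\: L \subset SR.
    apply/subsetP=> i; rewrite !in_setD in_setC => /andP[-> iI]; rewrite andbT.
    by apply: contraTN (subsetP sI _ iI) => /XR.
  rewrite -(card_in_imset (f := f)); last first.
    by move=> i j iI jI; apply: fi; apply: (subsetP sIS).
  apply/subset_leq_card/subsetP=> _ /imsetP[i iI ->].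
  have [] := fH _ (subsetP sIS _ iI); rewrite in_setD => /andP[fZ fL] Hif.
  case/setDP: iI => iI _; have iR := subsetP sI _ iI.
  rewrite !in_setI fL andbT in_setC in_setU negb_or fZ (notX _ _ iR Hif) !andbT.
  by apply/nbhdP; exists i.
(* Maximality of I is compared with its large clusters alone, whose neighbours in R are small
   clusters of N by [noLN]. *)
have c2 : #|N :&: L| <= #|I :\: L|.
  have sLI : LI \subset I by apply: subsetIl.
  have := maxI LI (subset_trans sLI sI) (stableS sLI stI).
  have : #|nbhd H LI :&: R| <= #|SN|; last by move: cI cN; clear; lia.
  apply/subset_leq_card/subsetP=> j /setIP[/nbhdP[i iI Hij] jR].
  have jN : j \in N.
    rewrite in_setI jR andbT; apply/nbhdP; exists i => //; exact: (subsetP sLI).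
  by rewrite in_setD jN andbT; apply: noLN iI jN Hij.
have cY : #|Y| + #|Z| = #|X|.
  by rewrite -cX1 addnC -(cardsID X1 X) (setIidPr sX1).
(* Small clusters outnumber large ones by no more than [gam] vertices; X1 cancels against Z, and the
   small clusters of I against the large ones of N. *)
have h6 : s * #|Y| + s * #|SN| <= s * #|LI| + gam.
  have : s * (#|Y| + #|Z| + (#|I :\: L| + #|SN|)) <=
         s * (#|Z| + (#|LI| + #|N :&: L|)) + gam.
    by rewrite cY -cSR -cLR -cS -cL.
  have : s * #|N :&: L| <= s * #|I :\: L| by rewrite leq_mul2l c2 orbT.
  rewrite !mulnDr; clear; lia.
have Kp : 0 < K by move: Kpos; clear; lia.
have hU := counting_bound K'K Kp sigK sigK2 h1 h2 h3 h4 h5 h6 cLI.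
have cD : #|~: D| <= #|Y| + (#|LI| - #|SN|).
  have : ~: D \subset Y :|: (I :\: I1).
    apply/subsetP=> i; rewrite in_setC !in_setU !negb_or in_setD.
    case/andP=> /andP[/andP[iZ iX1] /andP[iN iI1]] _.
    rewrite /Y ?in_setD iX1 iI1 /=; apply/orP.
    case: (boolP (i \in X)) => iX; first by left.
    right; have : i \in R by rewrite in_setC in_setU negb_or iX.
    by move/RIN; rewrite (negPf iN) orbF.
  move=> /subset_leq_card /leq_trans; apply.
  apply: leq_trans (leq_card_setU _ _).1 _; rewrite leq_add2l.
  have : #|I1| + #|I :\: I1| = #|I| by rewrite -(cardsID I1 I) (setIidPr sI1).
  by move: cI cN c1 c2 cI1; clear; lia.
have : (K - K') * (s * #|~: D|) <= (K - K') * (K - K').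
  apply: leq_trans small_err.
  have : s * #|~: D| <= s * #|Y| + (s * #|LI| - s * #|SN|).
    by rewrite -mulnBr -mulnDr leq_mul2l cD orbT.
  move=> hD; have : s * #|~: D| <= 2 * #|U| + (2 * b + gam).
    by move: hD cLI h6; clear; lia.
  move=> hD'; apply: leq_trans (leq_mul (leqnn _) hD') _.
  by rewrite mulnDr; move: hU; clear; lia.
by rewrite leq_pmul2l.
Qed.

End Structure.

(** * Scheduling small pieces into matched pairs *)

Lemma pair_step (m e be d1 d2 x1 x2 a b : nat) :
  d1 <= m -> d2 <= m -> a + b <= be ->
  (x1 <= x2 + be /\ x2 <= x1 + be) \/ minn d1 d2 <= minn x1 x2 + e + be ->
  x1 + x2 + 2 * e + 2 * be < d1 + d2 ->
  exists o : bool, let y1 := x1 + (if o then a else b) in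
    let y2 := x2 + (if o then b else a) in
    [/\ (if o then x1 + e <= d1 else x2 + e <= d2),
        (if o then x2 + e <= m else x1 + e <= m) &
        (y1 <= y2 + be /\ y2 <= y1 + be) \/
        minn d1 d2 <= minn y1 y2 + e + be].
Proof.
move=> h1 h2 hab inv lt.
case: (leqP (x1 + e) d1) => f1; case: (leqP (x2 + e) d2) => f2.
- case: inv => [inv|inv].
    exists ((x1 <= x2) == (b <= a)) => /=.
    by case: (leqP x1 x2); case: (leqP b a) => /= *; split; try left; lia.
  by exists true => /=; split; [|lia|right; lia].
- exists true => /=; split=> //; first by lia.
  by right; lia.
- by exists false => /=; split=> //; [lia|right; lia].
- lia.
Qed.

(** Elements are deleted one at a time, each with a ratio y/x at least the average over A0, so that
    the ratio of the rest stays at most that average. If there is no such element, all ratios are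
    below the average and any element may go. A deletion lowers the x-sum by at most M. *)
Lemma knapsack (I : finType) (x y : I -> nat) (M s : nat) (A0 : {set I}) :
  (forall i, x i <= M) -> s <= \sum_(i in A0) x i ->
  exists A : {set I}, [/\ A \subset A0, s <= \sum_(i in A) x i,
    \sum_(i in A) x i <= s + M &
    (\sum_(i in A) y i) * \sum_(i in A0) x i <=
    (\sum_(i in A0) y i) * \sum_(i in A) x i].
Proof.
move=> xM; set X := \sum_(i in A0) x i; set Y := \sum_(i in A0) y i => sX.
suff h n (A : {set I}) : #|A| <= n -> A \subset A0 -> s <= \sum_(i in A) x i ->
    (\sum_(i in A) y i) * X <= Y * \sum_(i in A) x i ->
    exists A : {set I}, [/\ A \subset A0, s <= \sum_(i in A) x i,
    \sum_(i in A) x i <= s + M &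
    (\sum_(i in A) y i) * X <= Y * \sum_(i in A) x i].
  by apply: (h #|A0| A0) => //; rewrite mulnC.
elim: n A => [|n IH] A cA sA h1 h2.
  by exists A; split=> //; move: cA; rewrite leqn0 cards_eq0 => /eqP->; rewrite big_set0.
case: (leqP (\sum_(i in A) x i) (s + M)) => [le|lt]; first by exists A.
case: (boolP [exists i in A, Y * x i <= y i * X]) => [/exists_inP[i iA hi]|].
  have Ex := big_setD1 i iA (F := x) (aop := addn).
  have Ey := big_setD1 i iA (F := y) (aop := addn).
  move: Ex Ey => /= Ex Ey; have := cardsD1 i A; rewrite iA => cA'.
  apply: (IH (A :\ i)); first by lia.
  - by apply: subset_trans sA; apply: subsetDl.
  - by have := xM i; lia.
  - by move: h2; rewrite Ex Ey mulnDl mulnDr; lia.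
rewrite negb_exists_in => /forall_inP hA.
have [A0'|[i iA]] := set_0Vmem A; first by move: lt; rewrite A0' big_set0.
have := cardsD1 i A; rewrite iA => cA'.
have Ex := big_setD1 i iA (F := x) (aop := addn).
apply: (IH (A :\ i)); first by lia.
- by apply: subset_trans sA; apply: subsetDl.
- by move: Ex (xM i) => /=; lia.
rewrite big_distrl big_distrr /=; apply: leq_sum => j /setD1P[_ /hA].
by rewrite -ltnNge => /ltnW.
Qed.

Section Schedule.

Variables (P : finType) (HP : rel P) (d : bool -> P -> nat) (m e be : nat).

Definition bump (use : P -> nat) (p q : P) (a b : nat) : P -> nat :=
  fun r => use r + (r == p) * a + (r == q) * b.

(* An item (y, (a, b)) is a bipartite piece with classes of sizes a and b that hangs from a seed of
   side y; it goes to an adjacent pair (p, q) in which every seed of side y still sees e unused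
   vertices of p, and e vertices of q are unused. *)
Fixpoint sched (use : P -> nat) (l : seq (bool * (nat * nat))) : Prop :=
  if l is (y, (a, b)) :: l' then
    exists p q, [/\ HP p q, use p + e <= d y p, use q + e <= m &
      sched (bump use p q a b) l']
  else True.

Definition total (l : seq (bool * (nat * nat))) : nat :=
  \sum_(it <- l) (it.2.1 + it.2.2).

Lemma sum_indicator (p : P) (a : nat) : \sum_r (r == p) * a = a.
Proof. by rewrite (bigD1 p) //= eqxx mul1n big1 ?addn0 // => r /negPf->. Qed.

Lemma total_bump use p q a b :
  \sum_r bump use p q a b r = \sum_r use r + (a + b).
Proof. by rewrite !big_split /= !sum_indicator addnA. Qed.

Lemma bump_ge use p q a b r : use r <= bump use p q a b r.
Proof. by rewrite /bump -addnA leq_addr. Qed.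

Hypothesis HPsym : symmetric HP.
Hypothesis dm : forall y p, d y p <= m.

Section Matching.

Variables (J : finType) (f : J * bool -> P).
Hypothesis f_inj : injective f.
Hypothesis fH : forall i, HP (f (i, true)) (f (i, false)).

Definition balanced (y : bool) (use : P -> nat) (i : J) : Prop :=
  (use (f (i, true)) <= use (f (i, false)) + be /\
   use (f (i, false)) <= use (f (i, true)) + be) \/
  minn (d y (f (i, true))) (d y (f (i, false))) <=
  minn (use (f (i, true))) (use (f (i, false))) + e + be.

Definition psum (F : P -> nat) (i : J) : nat := F (f (i, true)) + F (f (i, false)).

Lemma psum_bump_neq use (i j : J) o o' a b : i != j ->
  forall z, bump use (f (i, o)) (f (i, o')) a b (f (j, z)) = use (f (j, z)).
Proof.
move=> ij z; rewrite /bump !(inj_eq f_inj) !xpair_eqE.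
by rewrite eq_sym (negPf ij) !mul0n !addn0.
Qed.

Lemma matching_step y use i a b : a + b <= be -> balanced y use i ->
  psum use i + 2 * e + 2 * be < psum (d y) i ->
  exists o : bool, [/\ HP (f (i, o)) (f (i, ~~ o)),
    use (f (i, o)) + e <= d y (f (i, o)), use (f (i, ~~ o)) + e <= m &
    let use' := bump use (f (i, o)) (f (i, ~~ o)) a b in
    balanced y use' i /\ psum use' i = psum use i + (a + b)].
Proof.
move=> hab inv lt.
have [o [h1 h2 h3]] := pair_step (dm _ _) (dm _ _) hab inv lt.
exists o; have nb (z : bool) : (z == ~~ z) = false by case: z.
case: o h1 h2 h3 => /= h1 h2 h3; split=> //; try by rewrite HPsym.
  rewrite /balanced /psum /bump !(inj_eq f_inj) !xpair_eqE !eqxx /=.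
  by rewrite !mul1n !mul0n !addn0; split=> //; lia.
rewrite /balanced /psum /bump !(inj_eq f_inj) !xpair_eqE !eqxx /=.
by rewrite !mul1n !mul0n !addn0; split=> //; lia.
Qed.

Lemma psum_le (F : P -> nat) : \sum_i psum F i <= \sum_p F p.
Proof.
have -> : \sum_i psum F i = \sum_(ib : J * bool) F (f ib).
  rewrite (eq_bigr (fun p => F (f (p.1, p.2)))); last by case.
  rewrite -(pair_bigA _ (fun i b => F (f (i, b)))) /=; apply: eq_bigr => i _.
  by rewrite big_bool.
rewrite (eq_bigl (fun ib => ib \in [set: J * bool])); last by move=> ib; rewrite inE.
rewrite -(big_imset F (h := f)) /=; last by move=> ? ? _ _; exact: f_inj.
by rewrite big_mkcond; apply: leq_sum => p _; case: ifP.
Qed.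

Definition side_total (y : bool) (l : seq (bool * (nat * nat))) : nat :=
  total [seq it <- l | it.1 == y].

(* The pairs are split between the two sides by the knapsack lemma; each side then fills its own
   pairs, which stay balanced until a seed sees no more of one of the two classes. *)
Lemma sched_split (A : {set J}) (l : seq (bool * (nat * nat))) use :
  (forall it, it \in l -> it.2.1 + it.2.2 <= be) ->
  (forall i, balanced (i \in A) use i) ->
  (forall y, \sum_(i | (i \in A) == y) psum use i + side_total y l +
      #|J| * (2 * e + 2 * be) < \sum_(i | (i \in A) == y) psum (d y) i) ->
  sched use l.
Proof.
elim: l use => //= -[y [a b]] l IH use hl inv bud.
have hab : a + b <= be by apply: (hl (y, (a, b))); rewrite inE eqxx.
have [i /eqP iy lt] : exists2 i, (i \in A) == y &
    psum use i + 2 * e + 2 * be < psum (d y) i.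
  case: (boolP [exists i, ((i \in A) == y) &&
      (psum use i + 2 * e + 2 * be < psum (d y) i)]) => [/existsP[i /andP[]]|no].
    by exists i.
  have := bud y; rewrite ltnNge => /negP[].
  apply: (@leq_trans (\sum_(i | (i \in A) == y) (psum use i + (2 * e + 2 * be)))).
    apply: leq_sum => i iA; rewrite addnA leqNgt; apply: contra no => lt.
    by apply/existsP; exists i; rewrite iA.
  rewrite big_split /= sum_nat_const; set c := #|_|.
  have : c <= #|J| by apply: max_card.
  move=> hc; rewrite -addnA leq_add2l.
  by apply: leq_trans (leq_addl _ _); apply: leq_mul.
have inv_i : balanced y use i by rewrite -iy.
have [o [h1 h2 h3 [h4 h5]]] := matching_step hab inv_i lt.
exists (f (i, o)), (f (i, ~~ o)); split=> //; apply: IH.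
- by move=> it itl; apply: hl; rewrite inE itl orbT.
- move=> j; case: (eqVneq i j) => [<-|ij]; first by rewrite iy.
  rewrite /balanced !(psum_bump_neq _ _ _ _ _ ij); exact: inv.
move=> y'; have := bud y'; rewrite /side_total /= [y == y']eq_sym.
set use' := bump _ _ _ _ _.
case: (eqVneq y' y) => [->|yy'] /=.
  rewrite {1}/total big_cons /= -/(total _).
  rewrite !(bigD1 i (P := fun i => (i \in A) == y)) ?iy //= h5.
  rewrite [X in _ -> X + _ + _ < _](_ : _ = psum use i + (a + b) + \sum_(j | ((j \in A) == y) && (j != i)) psum use j); first by clear; lia.
  congr (_ + _); apply: eq_bigr => j /andP[_ ij].
  by rewrite /psum /use' !psum_bump_neq // eq_sym.
rewrite [X in _ -> X + _ + _ < _](eq_bigr (psum use)) // => j /eqP jy.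
have ij : i != j by apply: contra yy' => /eqP ij; rewrite -jy -ij iy.
by rewrite /psum /use' !psum_bump_neq.
Qed.

(** Pairs whose capacity just exceeds the need of side [true] are reserved for it; [2 * m] is the
    possible overshoot by one pair. They take from side [false] no more than their proportional
    share, and since either capacity exceeds the joint need, the remaining pairs suffice for side
    [false]. *)
Lemma sched_I (k : nat) (l : seq (bool * (nat * nat))) :
  (forall it, it \in l -> it.2.1 + it.2.2 <= be) -> total l <= k ->
  (forall y, k + 2 * (#|J| * (2 * e + 2 * be)) + 2 * m + 2 <=
     \sum_i psum (d y) i) ->
  sched (fun=> 0) l.
Proof.
move=> hl tl hd; set eps := #|J| * _ in hd.
set tt := side_total true l; set tf := side_total false l.
have tE : tt + tf = total l.
  rewrite /tt /tf /side_total /total !big_filter.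
  rewrite [RHS](bigID (fun it => it.1 == true)) /=; congr (_ + _).
  by apply: eq_bigl => -[[] ?].
have xM i : psum (d true) i <= 2 * m.
  by rewrite /psum; have := dm true (f (i, true)); have := dm true (f (i, false)); lia.
have /= := knapsack (psum (d false)) (A0 := setT) (s := tt + eps + 1) xM.
case.
  rewrite (eq_bigl xpredT); last by move=> i; rewrite inE.
  by have := hd true; lia.
move=> A [_ h1 h2 h3].
have e0 y : \sum_(i in [set: J]) psum (d y) i = \sum_i psum (d y) i.
  by apply: eq_bigl => i; rewrite inE.
rewrite !e0 in h3.
apply: (sched_split (A := A)) => // [i|y]; first by left; rewrite add0n.
rewrite (eq_bigr (fun=> 0)) // big1 // add0n -/eps.
have split_sum : \sum_i psum (d false) i =
    \sum_(i in A) psum (d false) i + \sum_(i | (i \in A) == false) psum (d false) i.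
  rewrite (bigID (mem A)) /=; congr (_ + _); apply: eq_bigl => i.
  by case: (i \in A).
case: y.
  by rewrite -/tt (eq_bigl (fun i => i \in A)); [move: h1; clear; lia|move=> i; case: (i \in A)].
rewrite -/tf; have := hd false; have := hd true; move: split_sum h2 h3.
set X := \sum_i psum (d true) i; set Y := \sum_i psum (d false) i.
move: tl; rewrite -tE.
set YA := \sum_(i in A) psum (d false) i; set XA := \sum_(i in A) _; set YC := \sum_(i | _) _.
move=> tl EY h2 h3 hX hY; rewrite ltnNge; apply/negP=> le.
case: (leqP X XA) => [le'|/ltnW lt]; first by move: tl h2 hX le'; clear; lia.
have [r Er] : exists r, X = XA + r by exists (X - XA); lia.
(* The pairs not chosen hold at least the proportion r / X of Y. *)
have h4 : Y * r <= X * YC by move: h3; rewrite EY Er !mulnDr !mulnDl; clear; nia.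
have h5 : X * YC <= X * (tf + eps) by apply: leq_mul.
have h6 := leq_mul hY (leqnn r).
have h7 := leq_mul hX (leqnn XA).
have : (k + 2 * eps + 2 * m + 2) * X <= (tf + eps + XA) * X.
  rewrite {1}Er mulnDr !mulnDl; move: h4 h5 h6 h7; rewrite !mulnDl !mulnDr; clear; lia.
rewrite leq_pmul2r; first by move: h2 tl; clear; lia.
by move: hX; clear; lia.
Qed.

End Matching.

Lemma total_cons y a b l : total ((y, (a, b)) :: l) = a + b + total l.
Proof. by rewrite /total big_cons. Qed.

(** A pair refuses a piece only when one of its two uses exceeds d - e, where d is the number of
    vertices seen on its [true] side. Hence both uses may be charged against d alone, and the other
    side of the pair need not be seen. *)
Lemma sched_oneside (J : finType) (f : J * bool -> P) y
    (l : seq (bool * (nat * nat))) use :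
  injective f -> (forall i, HP (f (i, true)) (f (i, false))) ->
  (forall it, it \in l -> it.1 = y) ->
  \sum_p use p + total l + #|J| * e < \sum_i d y (f (i, true)) ->
  sched use l.
Proof.
move=> f_inj fH; elim: l use => //= -[y' [a b]] l IH use hl lt.
have -> : y' = y by apply: (hl (y', (a, b))); rewrite inE eqxx.
case: (boolP [exists i, (use (f (i, true)) + e <= d y (f (i, true))) &&
    (use (f (i, false)) + e <= m)]) => [/existsP[i /andP[h1 h2]]|no].
  exists (f (i, true)), (f (i, false)); split=> //; apply: IH.
    by move=> it itl; apply: hl; rewrite inE itl orbT.
  by move: lt; rewrite total_bump total_cons; clear; lia.
have := psum_le f_inj use.
have : \sum_i d y (f (i, true)) <= \sum_i (psum f use i + e).
  apply: leq_sum => i _; rewrite leqNgt; apply: contra no => lt'.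
  apply/existsP; exists i; move: lt' (dm y (f (i, true))); rewrite /psum.
  by clear; lia.
rewrite big_split /= sum_nat_const => h1 h2.
by exfalso; move: h1 h2 lt; rewrite total_cons; set c := #|_|; rewrite (_ : c = #|J|); [clear; lia|apply: eq_card].
Qed.

(* First the matched pairs are filled from both ends; then the first classes go to the parts of LP
   and the second classes anywhere, which is possible as parts of LP have many neighbours. *)
Lemma sched_twoside (J : finType) (f : J * bool -> P) (LP : {set P}) y
    (l l' : seq (bool * (nat * nat))) (k : nat) use :
  injective f -> (forall i, HP (f (i, true)) (f (i, false))) ->
  (forall it, it \in l -> it.1 = y) ->
  (forall it, it \in l -> it.2.1 + it.2.2 <= be) ->
  (forall p, p \in LP -> k + #|P| * e < #|[set q | HP p q]| * m) ->
  (forall p, p \in LP -> p \notin codom f) ->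
  (forall i, balanced f y use i) \/
    \sum_i psum f (d y) i <= \sum_i psum f use i + #|J| * (2 * e + 2 * be) ->
  \sum_p use p + total l + #|J| * (2 * e + 2 * be) + #|P| * e <
    \sum_i psum f (d y) i + \sum_(p in LP) d y p ->
  \sum_p use p + total l <= k ->
  (forall use', \sum_p use' p <= \sum_p use p + total l -> sched use' l') ->
  sched use (l ++ l').
Proof.
move=> f_inj fH; elim: l use => /= [|[y' [a b]] l IH] use hl hb hLP LPf st lt hk cont.
  by apply: cont; rewrite leq_addr.
have -> : y' = y by apply: (hl (y', (a, b))); rewrite inE eqxx.
have hl' it : it \in l -> it.1 = y by move=> itl; apply: hl; rewrite inE itl orbT.
have hb' it : it \in l -> it.2.1 + it.2.2 <= be.
  by move=> itl; apply: hb; rewrite inE itl orbT.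
have hab : a + b <= be by apply: (hb (y', (a, b))); rewrite inE eqxx.
rewrite total_cons in lt hk cont.
have cont' p q use' : \sum_r use' r <= \sum_r bump use p q a b r + total l ->
    sched use' l'.
  by rewrite total_bump => h; apply: cont; move: h; clear; lia.
have lt' p q : \sum_r bump use p q a b r + total l + #|J| * (2 * e + 2 * be) +
    #|P| * e < \sum_i psum f (d y) i + \sum_(p in LP) d y p.
  by rewrite total_bump -(addnA (\sum_p use p)); exact: lt.
have hk' p q : \sum_r bump use p q a b r + total l <= k.
  by rewrite total_bump; move: hk; clear; lia.
have [[i [bal lti]]|st2] : (exists i, (forall i, balanced f y use i) /\
     psum f use i + 2 * e + 2 * be < psum f (d y) i) \/
     \sum_i psum f (d y) i <= \sum_i psum f use i + #|J| * (2 * e + 2 * be).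
- case: st => [bal|]; last by right.
  case: (boolP [exists i, psum f use i + 2 * e + 2 * be < psum f (d y) i]).
    by case/existsP=> i lti; left; exists i.
  move=> no; right; apply: (@leq_trans (\sum_i (psum f use i + (2 * e + 2 * be)))).
    apply: leq_sum => i _; rewrite addnA leqNgt; apply: contra no => lti.
    by apply/existsP; exists i.
  by rewrite big_split /= sum_nat_const leq_add2l leq_mul2r max_card orbT.
- have [o [h1 h2 h3 [h4 h5]]] := matching_step f_inj fH hab (bal i) lti.
  exists (f (i, o)), (f (i, ~~ o)); split=> //; apply: IH => //.
  + left=> j; case: (eqVneq i j) => [<-|ij]; first exact: h4.
    by rewrite /balanced !(psum_bump_neq f_inj _ _ _ _ _ ij); exact: bal.
  + exact: cont'.
have [p pLP hp] : exists2 p, p \in LP & use p + e <= d y p.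
  case: (boolP [exists p in LP, use p + e <= d y p]) => [/exists_inP[p]|no].
    by exists p.
  exfalso; have h1 : \sum_(p in LP) d y p <= \sum_(p in LP) use p + #|P| * e.
    apply: (@leq_trans (\sum_(p in LP) (use p + e))).
      apply: leq_sum => p pLP; rewrite leqNgt; apply: contra no => lti.
      by apply/exists_inP; exists p => //; apply: ltnW.
    by rewrite big_split /= sum_nat_const leq_add2l leq_mul2r max_card orbT.
  have h2 : \sum_i psum f use i + \sum_(p in LP) use p <= \sum_p use p.
    pose F p := if p \in LP then 0 else use p.
    have -> : \sum_i psum f use i = \sum_i psum f F i.
      apply: eq_bigr => i _; rewrite /psum /F.
      have nLP z : (f (i, z) \in LP) = false.
        by apply/negP=> /LPf /negP[]; apply: codom_f.
      by rewrite !nLP.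
    apply: leq_trans (leq_add (psum_le f_inj F) (leqnn _)) _.
    rewrite [X in _ + X]big_mkcond -big_split /=; apply: leq_sum => p _.
    by rewrite /F; case: ifP => _; rewrite ?add0n ?addn0.
  by move: lt h1 h2 st2; clear; move: (#|P| * e) (#|J| * _); lia.
have [q Hpq hq] : exists2 q, HP p q & use q + e <= m.
  case: (boolP [exists q, HP p q && (use q + e <= m)]) => [/existsP[q /andP[]]|no].
    by exists q.
  exfalso; have := hLP p pLP; rewrite ltnNge => /negP[].
  rewrite -sum_nat_const.
  apply: (@leq_trans (\sum_(q in [set q | HP p q]) (use q + e))).
    apply: leq_sum => q; rewrite inE => Hpq; rewrite leqNgt; apply: contra no => lti.
    by apply/existsP; exists q; rewrite Hpq ltnW.
  rewrite big_split /= sum_nat_const; apply: leq_add; last first.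
    by rewrite leq_mul2r max_card orbT.
  apply: leq_trans (leq_trans (leq_addr _ _) hk).
  by rewrite big_mkcond; apply: leq_sum => q _; case: ifP.
exists p, q; split=> //; apply: IH => //.
  right; apply: leq_trans st2 _; rewrite leq_add2r; apply: leq_sum => i _.
  by rewrite /psum leq_add // bump_ge.
exact: cont'.
Qed.

(** Side [y] comes first, since its guarantee covers only half of k and depends on balanced filling.
    The other side copes with any distribution of the vertices used before: it sees more than k
    vertices on one side of a matching, and at most k are used altogether. *)
Lemma sched_II (J0 J1 : finType) (f0 : J0 * bool -> P) (f1 : J1 * bool -> P)
    (LP : {set P}) (l : seq (bool * (nat * nat))) (k : nat) (y : bool) :
  injective f0 -> (forall i, HP (f0 (i, true)) (f0 (i, false))) ->
  injective f1 -> (forall i, HP (f1 (i, true)) (f1 (i, false))) ->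
  (forall it, it \in l -> it.2.1 + it.2.2 <= be) ->
  total l <= k -> 2 * side_total y l <= k ->
  (forall p, p \in LP -> k + #|P| * e < #|[set q | HP p q]| * m) ->
  (forall p, p \in LP -> p \notin codom f0) ->
  k + #|J1| * e < \sum_i d (~~ y) (f1 (i, true)) ->
  k + 2 * (#|J0| * (2 * e + 2 * be) + #|P| * e) <
    2 * (\sum_i psum f0 (d y) i + \sum_(p in LP) d y p) ->
  sched (fun=> 0) ([seq it <- l | it.1 == y] ++ [seq it <- l | it.1 == ~~ y]).
Proof.
move=> f0i f0H f1i f1H hb tl ty hLP LPf h1 h0.
have s0 : \sum_(p : P) 0 = 0 by rewrite big1.
have tE : side_total y l + side_total (~~ y) l = total l.
  rewrite /side_total /total !big_filter [RHS](bigID (fun it => it.1 == y)) /=.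
  by congr (_ + _); apply: eq_bigl => -[[] ?]; case: (y).
apply: (sched_twoside (y := y) (k := k) f0i f0H _ _ hLP LPf).
- by move=> it; rewrite mem_filter => /andP[/eqP].
- by move=> it; rewrite mem_filter => /andP[_]; apply: hb.
- by left=> i; left; rewrite add0n.
- by rewrite s0 -/(side_total y l); move: h0 ty; clear; lia.
- by rewrite s0 -/(side_total y l) add0n; move: tl; rewrite -tE; clear; lia.
move=> use'; rewrite s0 add0n -/(side_total y l) => hu.
apply: (sched_oneside (y := ~~ y) f1i f1H) => [it|].
  by rewrite mem_filter => /andP[/eqP].
by rewrite -/(side_total (~~ y) l); move: hu h1 tl; rewrite -tE; clear; lia.
Qed.

End Schedule.

(** * Partitions without holes *)

Definition cell (V T : finType) (C : V -> option T) (i : T) : {set V} :=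
  [set x | C x == Some i].

(** The bound on degrees is absolute and not a density, so it passes to subsets of Y of any size: a
    pair of classes once declared dead stays dead under refinement. *)
Definition holey (V : finType) (g : rel V) (E s h : nat) (A B : {set V}) : bool :=
  [exists X : {set V}, exists Y : {set V},
    [&& X \subset A, Y \subset B, s <= E * #|X|, s <= E * #|Y| &
        [forall x in X, deg_in g x Y < h]]].

Lemma chop (V K : finType) (key : V -> K) (s M : nat) :
  0 < s -> #|V| < M * s ->
  exists (T : finType) (C : V -> option T) (kT : T -> K),
    [/\ #|T| <= #|K| * M, forall i, #|cell C i| = s,
        forall x i, C x = Some i -> key x = kT i &
        #|[set x | C x == None]| <= #|K| * s].
Proof.
move=> s0 hM; pose cls k := [set x | key x == k].
(* The complete blocks of [s] consecutive vertices of a class become the clusters; the remainder of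
   each class stays unassigned. *)
pose ok (kc : K * 'I_M) := (kc.2.+1 * s <= #|cls kc.1|).
pose idx x := index x (enum (cls (key x))).
have xcls x : x \in enum (cls (key x)) by rewrite mem_enum inE.
have idx_lt x : idx x < #|cls (key x)| by rewrite cardE index_mem.
have chk x : idx x %/ s < M.
  rewrite ltn_divLR //; apply: leq_trans (idx_lt x) _.
  by apply: leq_trans (max_card _) (ltnW hM).
pose C x : option {kc | ok kc} := insub (key x, Ordinal (chk x)).
have CE x (i : {kc | ok kc}) : (C x == Some i) =
    (key x == (val i).1) && (idx x %/ s == (val i).2).
  rewrite /C; case: insubP => [u _ eu|nok].
    have -> : (Some u == Some i) = (val u == val i) by [].
    by rewrite eu; case: (val i) => k c /=; rewrite xpair_eqE -val_eqE.
  symmetry; apply: contraNF nok => /andP[/eqP e1 /eqP e2].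
  rewrite (_ : (_, _) = val i); first exact: valP i.
  by case: (val i) e1 e2 => k c /= -> e2; congr (_, _); apply: val_inj.
have cnt k n : n <= #|cls k| ->
    #|[set x in cls k | index x (enum (cls k)) < n]| = n.
  move=> hn; have -> : [set x in cls k | index x (enum (cls k)) < n] =
      [set x in take n (enum (cls k))].
    apply/setP=> x; rewrite [LHS]inE [RHS]inE; case: (boolP (x \in cls k)) => xk.
      by rewrite in_take // mem_enum.
    by symmetry; apply: contraNF xk => /mem_take; rewrite mem_enum.
  rewrite cardsE (card_uniqP _) ?take_uniq ?enum_uniq // size_take -cardE.
  by case: ltngtP hn.
exists {kc | ok kc}, C, (fun i => (val i).1); split.
- by rewrite card_sig; apply: leq_trans (max_card _) _; rewrite card_prod card_ord.
- move=> i; have oki : ok (val i) := valP i; case Ei : (val i) => [k c].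
  rewrite /ok Ei /= in oki.
  have h1 := cnt k _ oki; have h2 := cnt k (c * s) (leq_trans (leq_mul (leqnSn _) (leqnn s)) oki).
  have -> : cell C i = [set x in cls k | index x (enum (cls k)) < c.+1 * s] :\:
      [set x in cls k | index x (enum (cls k)) < c * s].
    apply/setP=> x; rewrite inE CE Ei /= in_setD !in_set.
    case: eqP => //= ek.
    rewrite /idx ek -leqNgt -leq_divRL // -ltn_divLR // ltnS.
    by rewrite eqn_leq andbC.
  rewrite cardsD (setIidPr _) ?h1 ?h2 ?mulSn ?addnK //.
  apply/subsetP=> x; rewrite !inE => /andP[-> /= lt].
  by apply: leq_trans lt (leq_addl _ _).
- by move=> x i /eqP; rewrite CE => /andP[/eqP].
rewrite -sum1_card (partition_big key xpredT) //= -sum_nat_const.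
apply: leq_sum => k _; rewrite sum1dep_card.
have h := cnt k _ (leq_trunc_div #|cls k| s).
apply: (@leq_trans #|cls k :\: [set x in cls k | index x (enum (cls k)) < #|cls k| %/ s * s]|).
  apply/subset_leq_card/subsetP=> x; rewrite !inE => /andP[/eqP Cx /eqP ek].
  rewrite ek eqxx /= andbT -leqNgt -leq_divRL // -ltnS -/(cls k).
  have : ~~ ok (key x, Ordinal (chk x)).
    by move: Cx; rewrite /C; case: insubP.
  by rewrite /ok /= -ltnNge -ltn_divLR // ek /idx ek.
rewrite cardsD (setIidPr _) ?h; last by apply/subsetP=> x; rewrite inE => /andP[].
by rewrite {1}(divn_eq #|cls k| s) addKn ltnW // ltn_mod.
Qed.

Definition bad_pairs (V T : finType) (g : rel V) (C : V -> option T) (E s h : nat) :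
    {set V * V} :=
  [set p | g p.1 p.2 && (if (C p.1, C p.2) is (Some i, Some j)
     then holey g E s h (cell C i) (cell C j) else true)].

Lemma card_pairs_le (V : finType) (R : rel V) (A : {set V}) (b : nat) :
  (forall x, x \in A -> #|[set y | R x y]| <= b) ->
  #|[set p : V * V | (p.1 \in A) && R p.1 p.2]| <= #|A| * b.
Proof.
move=> hb; rewrite -sum1_card (partition_big fst (mem A)) /=; last first.
  by move=> p; rewrite inE => /andP[].
rewrite -sum_nat_const; apply: leq_sum => x xA; rewrite sum1dep_card.
apply: leq_trans (hb x xA).
rewrite -(card_imset [set y | R x y] (f := pair x)); last by move=> y y' [].
apply/subset_leq_card/subsetP=> -[x' y]; rewrite !inE /=.
by case/andP=> /andP[_ Rxy] /eqP ex; rewrite ex in Rxy *; rewrite imset_f // inE.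
Qed.

(** A vertex records its class, its cluster and the chosen holes it belongs to, so each hole becomes
    a union of dead pairs of new classes. A hole covers at least s^2 / E^2 of the s^2 vertex pairs
    of its two clusters, whence the factor E^2. *)
Lemma refine_step (V K : finType) (g : rel V) (key : V -> K) (dead : rel K)
    (T : finType) (C : V -> option T) (kT : T -> K) (E s h : nat) :
  (forall x j, dead (key x) j -> deg_in g x [set y | key y == j] < h) ->
  (forall i, #|cell C i| = s) -> (forall x i, C x = Some i -> key x = kT i) ->
  0 < h ->
  let HN := [set p : V * V | if (C p.1, C p.2) is (Some i, Some j)
     then holey g E s h (cell C i) (cell C j) && ~~ dead (kT i) (kT j) else false] in
  exists (K' : finType) (key' : V -> K') (dead' : rel K'),
    [/\ #|K'| = #|K| * #|T|.+1 * 4 ^ #|T|,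
     forall x y, key' x = key' y -> key x = key y,
     forall x j, dead' (key' x) j -> deg_in g x [set y | key' y == j] < h &
     E ^ 2 * #|[set p : V * V | dead (key p.1) (key p.2)]| + #|HN| <=
     E ^ 2 * #|[set p : V * V | dead' (key' p.1) (key' p.2)]|].
Proof.
move=> deadP cs ck h0 HN.
pose good i j (XY : {set V} * {set V}) := [&& XY.1 \subset cell C i, XY.2 \subset cell C j,
   s <= E * #|XY.1|, s <= E * #|XY.2| & [forall x in XY.1, deg_in g x XY.2 < h]].
pose hole i j := odflt (set0, set0) [pick XY | good i j XY].
have holeP i j : holey g E s h (cell C i) (cell C j) -> good i j (hole i j).
  case/existsP=> X /existsP[Y XYg]; rewrite /hole; case: pickP => //= /(_ (X, Y)).
  by rewrite /good XYg.
have hole_lt i j x : x \in (hole i j).1 -> deg_in g x (hole i j).2 < h.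
  rewrite /hole; case: pickP => [XY /and5P[_ _ _ _ /forall_inP]|_] /=; first exact.
  by rewrite inE.
pose f x : {ffun T -> bool * bool} :=
  if C x is Some i then [ffun j => (x \in (hole i j).1, x \in (hole j i).2)]
  else [ffun=> (false, false)].
pose K' : finType := (K * option T * {ffun T -> bool * bool})%type.
pose key' x : K' := (key x, C x, f x).
pose dead' (a b : K') := dead a.1.1 b.1.1 ||
  (if (a.1.2, b.1.2) is (Some i, Some j) then
     [&& holey g E s h (cell C i) (cell C j), (a.2 j).1 & (b.2 i).2] else false).
exists K', key', dead'; split.
- by rewrite /K' !card_prod card_option card_ffun card_prod card_bool.
- by move=> x y [].
- move=> x [[j1 j2] j3]; rewrite /dead' /=; case/orP.
    move=> d; apply: leq_ltn_trans (deadP _ _ d); apply: deg_inS.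
    by apply/subsetP=> y; rewrite !inE => /eqP[-> _ _].
  case Cx : (C x) => [i|] //; case: j2 => [j|] // /and3P[_].
  rewrite /f Cx ffunE /= => /hole_lt lt h3; apply: leq_ltn_trans lt.
  apply: deg_inS; apply/subsetP=> y; rewrite inE => /eqP[_ Cy ey].
  by move: h3; rewrite -ey /f Cy ffunE.
pose DD := [set p : V * V | dead (key p.1) (key p.2)].
pose DD' := [set p : V * V | dead' (key' p.1) (key' p.2)].
pose G := [set p : V * V | if (C p.1, C p.2) is (Some i, Some j)
   then [&& holey g E s h (cell C i) (cell C j), ~~ dead (kT i) (kT j),
         p.1 \in (hole i j).1 & p.2 \in (hole i j).2] else false].
have sD : DD :|: G \subset DD'.
  apply/subsetP=> -[x y]; rewrite !inE /= /dead' /=; case/orP=> [->//|].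
  case Cx: (C x) => [i|] //; case Cy : (C y) => [j|] //.
  by rewrite /f Cx Cy !ffunE /= => /and4P[-> _ -> ->]; rewrite orbT.
have dG : DD :&: G = set0.
  apply/setP=> -[x y]; rewrite !inE /=; apply/negP=> /andP[d].
  case Cx: (C x) => [i|] //; case Cy : (C y) => [j|] //.
  by move: d; rewrite (ck _ _ Cx) (ck _ _ Cy) => -> /and4P[].
have := subset_leq_card sD; rewrite cardsU dG cards0 subn0 => le.
apply: leq_trans (leq_mul (leqnn (E ^ 2)) le); rewrite mulnDr leq_add2l.
pose c (p : V * V) := if (C p.1, C p.2) is (Some i, Some j) then Some (i, j) else None.
rewrite -!sum1_card (partition_big c xpredT) //=.
rewrite [X in _ <= _ * X](partition_big c xpredT) //= big_distrr /=.
apply: leq_sum => -[[i j]|] _; rewrite !sum1dep_card; last first.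
  rewrite (_ : [set p | _] = set0) ?cards0 //; apply/setP=> -[x y].
  by rewrite !inE /c /=; case: (C x) => [i|] //; case: (C y) => [j|] //; rewrite andbF.
have cP p : (c p == Some (i, j)) = (p.1 \in cell C i) && (p.2 \in cell C j).
  rewrite !inE /c; case: (C p.1) => [i'|] //; case: (C p.2) => [j'|] //.
  by rewrite andbF.
case: (boolP (holey g E s h (cell C i) (cell C j) && ~~ dead (kT i) (kT j))); last first.
  move=> no; rewrite (_ : [set p | _] = set0) ?cards0 //; apply/setP=> -[x y].
  rewrite !inE cP; apply/negP=> /andP[+ /andP[]].
  by rewrite /= !inE => + /eqP Cx /eqP Cy; rewrite Cx Cy (negPf no).
case/andP=> ho nd; have /and5P[s1 s2 c1 c2 _] := holeP _ _ ho.
apply: (@leq_trans (s * s)).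
  rewrite -{1}(cs i) -(cs j) -cardsX; apply/subset_leq_card/subsetP=> p.
  by case: p => x y; rewrite in_set cP in_setX /= => /andP[_].
apply: (@leq_trans (E ^ 2 * (#|(hole i j).1| * #|(hole i j).2|))).
  by have := leq_mul c1 c2; rewrite -mulnn; clear; lia.
rewrite leq_mul2l -cardsX; apply/orP; right; apply/subset_leq_card/subsetP=> -[x y].
rewrite in_setX => /andP[xX yY].
have xC := subsetP s1 _ xX; have yC := subsetP s2 _ yY.
rewrite in_set cP /= xC yC !andbT in_set /=.
by move: xC yC; rewrite !in_set => /eqP-> /eqP->; rewrite ho nd xX yY.
Qed.

(** The error 3 |V|^2 has three sources: the first vertex outside the clusters, the second vertex
    outside the clusters, and live pairs with holes. The term with [N * h] accounts for edges in
    dead pairs. *)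
Definition regular (V T K : finType) (g : rel V) (key : V -> K) (E N h s : nat)
    (C : V -> option T) : Prop :=
  [/\ 0 < s, #|T| <= N, #|V| <= N * s & E * s <= #|V|] /\
  [/\ forall i, #|cell C i| = s,
      forall x y, C x = C y -> C x != None -> key x = key y,
      E * #|[set x | C x == None]| <= #|V| &
      E * #|bad_pairs g C E s h| <= 3 * #|V| ^ 2 + E * (#|V| * N * h)].

(* N does not depend on h, so h can be chosen of order n / N afterwards, which makes the edges in
   dead pairs negligible. *)
Lemma regularity_round (E kap : nat) : 0 < E -> exists N kap',
  forall (V : finType) (g : rel V) (h : nat) (K : finType) (key : V -> K) (dead : rel K),
  symmetric g -> N <= #|V| -> 0 < h -> #|K| <= kap ->
  (forall x j, dead (key x) j -> deg_in g x [set y | key y == j] < h) ->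
  (exists (T : finType) (C : V -> option T) s, regular g key E N h s C) \/
  exists (K' : finType) (key' : V -> K') (dead' : rel K'), [/\ #|K'| <= kap',
     forall x y, key' x = key' y -> key x = key y,
     forall x j, dead' (key' x) j -> deg_in g x [set y | key' y == j] < h &
     E ^ 3 * #|[set p : V * V | dead (key p.1) (key p.2)]| + #|V| ^ 2 <=
     E ^ 3 * #|[set p : V * V | dead' (key' p.1) (key' p.2)]|].
Proof.
move=> E0; pose M := 2 * kap.+1 * E; pose N := kap.+1 * E + kap * M + 2 * M + kap.
exists N, (kap * (kap * M).+1 * 4 ^ (kap * M)) => V g h K key dead gs hN h0 hK deadP.
(* With this size the incomplete blocks of at most [kap] classes contain at most n / E vertices. *)
set n := #|V| in hN *; pose s := n %/ (kap.+1 * E).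
have kE0 : 0 < kap.+1 * E by rewrite muln_gt0.
have s0 : 0 < s by rewrite divn_gt0 //; move: hN; rewrite /N; clear; lia.
have hns : n < s.+1 * (kap.+1 * E) by rewrite -ltn_divLR.
have sn : s * (kap.+1 * E) <= n by apply: leq_trunc_div.
have nM : n < M * s.
  rewrite /M -(mulnA 2); move: hns s0 kE0; set kE := kap.+1 * E.
  by case: (s) => // s'; clear; nia.
have [T [C [kT [cT cs ck cN]]]] := chop key s0 nM.
have TN : #|T| <= kap * M by apply: leq_trans cT _; rewrite leq_mul2r hK orbT.
have [K' [key' [dead' [cK' r' dP' gain]]]] := refine_step E deadP cs ck h0.
pose HN := [set p : V * V | if (C p.1, C p.2) is (Some i, Some j)
     then holey g E s h (cell C i) (cell C j) && ~~ dead (kT i) (kT j) else false].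
rewrite -[X in _ + X <= _]/(#|HN|) in gain.
(* Either the live cluster pairs with holes cover at most n^2 / E vertex pairs, or the refinement
   makes n^2 / E^3 further vertex pairs dead. *)
case: (leqP (E * #|HN|) (n ^ 2)) => [le|lt]; last first.
  right; exists K', key', dead'; split=> //.
    rewrite cK'; apply: leq_mul; first by apply: leq_mul.
    by rewrite leq_exp2l.
  rewrite (expnS E 2) -!(mulnA E (E ^ 2)); have := leq_mul (leqnn E) gain; rewrite mulnDr => gain'.
  apply: leq_trans gain'; rewrite leq_add2l. exact: ltnW lt.
have cG : E * #|[set x | C x == None]| <= n.
  apply: leq_trans sn; rewrite mulnC; apply: (@leq_trans (#|K| * s * E)).
    by rewrite leq_mul2r cN orbT.
  rewrite (mulnC #|K|) -mulnA leq_mul2l leq_mul2r.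
  by rewrite (leq_trans hK (leqnSn _)) !orbT.
left; exists T, C, s; split; split=> //.
- by apply: leq_trans TN _; rewrite /N; clear; lia.
- apply: leq_trans (ltnW nM) _; rewrite leq_mul2r /N; apply/orP; right; clear; lia.
- by apply: leq_trans sn; rewrite mulnC leq_mul2l leq_pmull ?orbT.
- by move=> x y Cxy; case Cx: (C x) => [i|] // _; rewrite (ck x i Cx) (ck y i) // -Cxy.

pose B0 := [set p : V * V | C p.1 == None].
pose B1 := [set p : V * V | C p.2 == None].
pose B2 := [set p : V * V | g p.1 p.2 && dead (key p.1) (key p.2)].
have sB : bad_pairs g C E s h \subset B0 :|: B1 :|: B2 :|: HN.
  apply/subsetP=> -[x y]; rewrite !inE /= => /andP[gxy].
  case Cx: (C x) => [i|] //=; case Cy: (C y) => [j|] //= ->.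
  by rewrite gxy (ck _ _ Cx) (ck _ _ Cy) /=; case: (dead _ _).
have cB0 : E * #|B0| <= n ^ 2.
  have -> : B0 = setX [set x | C x == None] setT.
    by apply/setP=> p; rewrite !inE andbT.
  by rewrite cardsX cardsT mulnA -mulnn leq_mul.
have cB1 : E * #|B1| <= n ^ 2.
  have -> : B1 = setX setT [set x | C x == None].
    by apply/setP=> p; rewrite !inE.
  by rewrite cardsX cardsT mulnCA -mulnn leq_mul.
have cB2 : #|B2| <= n * (kap * h).
  rewrite -[n]cardsT; pose R x y := g x y && dead (key x) (key y).
  have -> : B2 = [set p : V * V | (p.1 \in [set: V]) && R p.1 p.2].
    by apply/setP=> p; rewrite !inE.
  apply: card_pairs_le => x _; rewrite /R.
  rewrite -sum1_card (partition_big key (fun j => dead (key x) j)) /=; last first.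
    by move=> y; rewrite inE => /andP[].
  apply: (@leq_trans (\sum_(j | dead (key x) j) h)).
    apply: leq_sum => j dj; rewrite sum1dep_card; apply: leq_trans (ltnW (deadP _ _ dj)).
    apply/subset_leq_card/subsetP=> y; rewrite !inE => /andP[/andP[-> _] /eqP->].
    by rewrite eqxx.
  by rewrite sum_nat_const; apply: leq_mul => //; apply: leq_trans (max_card _) hK.
have : #|bad_pairs g C E s h| <= #|B0| + #|B1| + #|B2| + #|HN|.
  apply: leq_trans (subset_leq_card sB) _.
  apply: leq_trans (leq_card_setU _ _).1 _; rewrite leq_add2r.
  apply: leq_trans (leq_card_setU _ _).1 _; rewrite leq_add2r.
  exact: (leq_card_setU _ _).1.
move=> h1; have h2 := leq_mul (leqnn E) h1; rewrite !mulnDr in h2; rewrite -/n.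
apply: leq_trans h2 _.
have h3 : E * #|B2| <= E * (n * N * h).
  rewrite leq_mul2l; apply/orP; right; apply: leq_trans cB2 _.
  rewrite -(mulnA n) leq_mul2l; apply/orP; right; apply: leq_mul => //.
  by rewrite /N; clear; lia.
move: cB0 cB1 h3 le; move: (E * #|B0|) (E * #|B1|) (E * #|B2|) (E * #|HN|).
move: (E * (n * N * h)); clear. lia.
Qed.

Lemma regular_mono (V T K : finType) (g : rel V) (key : V -> K) (E N N' h s : nat)
    (C : V -> option T) :
  N <= N' -> regular g key E N h s C -> regular g key E N' h s C.
Proof.
move=> hN [[s0 cT cV Es] [h1 h2 h3 h4]]; split; split=> //.
- exact: leq_trans hN.
- by apply: leq_trans cV _; rewrite leq_mul2r hN orbT.
apply: leq_trans h4 _; rewrite leq_add2l leq_mul2l leq_mul2r leq_mul2l.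
by rewrite hN !orbT.
Qed.

Lemma regularity (E kap : nat) : 0 < E -> exists N,
  forall (V : finType) (g : rel V) (h : nat) (K : finType) (key : V -> K),
  symmetric g -> N <= #|V| -> 0 < #|V| -> 0 < h -> #|K| <= kap ->
  exists (T : finType) (C : V -> option T) s, regular g key E N h s C.
Proof.
move=> E0.
(* [r] bounds the rounds that remain. A failed round makes n^2 / E^3 more of the n^2 vertex pairs
   dead, so E^3 rounds are enough. *)
suff H r kap' : exists N, forall (V : finType) (g : rel V) (h : nat) (K : finType)
    (key : V -> K) (dead : rel K), symmetric g -> N <= #|V| -> 0 < #|V| -> 0 < h ->
    #|K| <= kap' ->
    (forall x j, dead (key x) j -> deg_in g x [set y | key y == j] < h) ->
    E ^ 3 * #|V| ^ 2 <= E ^ 3 * #|[set p : V * V | dead (key p.1) (key p.2)]| +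
      r * #|V| ^ 2 ->
    exists (T : finType) (C : V -> option T) s, regular g key E N h s C.
  have [N hN] := H (E ^ 3) kap.
  exists N => V g h K key gs nN n0 h0 hK; apply: (hN V g h K key (fun _ _ => false)) => //.
  by rewrite leq_addl.
elim: r kap' => [|r IH] kap'; have [N [kap2 hN]] := regularity_round kap' E0.
  exists N => V g h K key dead gs nN n0 h0 hK dP pot.
  have [//|[K' [key' [dead' [_ _ _ gain]]]]] := hN V g h K key dead gs nN h0 hK dP.
  have : E ^ 3 * #|[set p : V * V | dead' (key' p.1) (key' p.2)]| <= E ^ 3 * #|V| ^ 2.
    by rewrite leq_mul2l -mulnn -card_prod max_card orbT.
  have : 0 < #|V| ^ 2 by rewrite expn_gt0 n0.
  move: pot gain; rewrite mul0n addn0.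
  move: (E ^ 3 * #|V| ^ 2) (E ^ 3 * #|_|) (E ^ 3 * #|_|) (#|V| ^ 2); clear; lia.
have [N2 hN2] := IH kap2; exists (N + N2) => V g h K key dead gs nN n0 h0 hK dP pot.
have [|[T [C [s reg]]]|[K' [key' [dead' [cK' ref dP' gain]]]]] :=
  hN V g h K key dead gs _ h0 hK dP; first by apply: leq_trans nN; apply: leq_addr.
  by exists T, C, s; apply: regular_mono reg; apply: leq_addr.
have [||T [C [s reg]]] := hN2 V g h K' key' dead' gs _ n0 h0 cK' dP'.
- by apply: leq_trans nN; apply: leq_addl.
- move: pot gain; rewrite mulSn.
  move: (E ^ 3 * #|V| ^ 2) (E ^ 3 * #|_|) (E ^ 3 * #|_|) (#|V| ^ 2) (r * _); clear; lia.
exists T, C, s; case: reg => [r1 [r2 r3 r4 r5]].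
apply: (regular_mono (leq_addl N N2)); split=> //; split=> //.
by move=> x y Cxy Cx; apply: ref; apply: r3.
Qed.

(** * Complete bipartite subgraphs *)

Lemma subset_of_card (T : finType) (A : {set T}) n :
  n <= #|A| -> exists2 B : {set T}, B \subset A & #|B| = n.
Proof.
move=> /card_geqP[s [us ss sA]]; exists [set x in s].
  by apply/subsetP=> x; rewrite inE => /sA.
by rewrite cardsE -ss; apply/card_uniqP.
Qed.

(** Keep the vertices of A with at least n / (2D) neighbours in B, then choose vertices of B one by
    one, each adjacent to a proportion 1 / (4D) of what is left of A. At most t earlier choices cost
    at most half of these degrees, thanks to the summand 4D(t + 1) of the bound on n. *)
Lemma biclique (D t : nat) : 0 < D -> exists n0, forall (V : finType) (g : rel V)
    (A B : {set V}), symmetric g -> n0 <= #|V| ->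
  #|V| * #|V| <= D * \sum_(x in A) deg_in g x B ->
  exists S T : {set V}, [/\ S \subset A, T \subset B, #|S| = t, #|T| = t &
    {in S & T, forall x y, g x y}].
Proof.
move=> D0; exists ((t.+1 * (4 * D) ^ t * (2 * D)) + 4 * D * t.+1) => V g A B gs.
set n := #|V| => hn hD.
have n0 : 0 < n by move: hn D0; clear; nia.
pose A1 := [set x in A | n <= 2 * D * deg_in g x B].
have cA1 : n <= 2 * D * #|A1|.
  have h : D * \sum_(x in A) deg_in g x B <= D * (n * #|A1|) + n * n %/ 2.
    rewrite (bigID (fun x => n <= 2 * D * deg_in g x B)) /= mulnDr.
    apply: leq_add.
      rewrite leq_mul2l; apply/orP; right; rewrite (mulnC n) -sum_nat_const.
      rewrite (eq_bigl (fun x => x \in A1)); last by move=> x; rewrite inE.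
      by apply: leq_sum => x _; apply: leq_trans (deg_in_le _ _ _) (max_card _).
    rewrite leq_divRL // mulnC mulnA big_distrr /=.
    apply: (@leq_trans (\sum_(x in V) n)); last by rewrite sum_nat_const mulnC.
    rewrite big_mkcond; apply: leq_sum => x _; case: ifP => // /andP[_].
    by rewrite -ltnNge => /ltnW.
  have : n * n <= n * (2 * D * #|A1|) by move: hD h; clear; nia.
  by rewrite leq_pmul2l.
have step i : i <= t -> exists Ai Ti : {set V},
    [/\ Ai \subset A1, Ti \subset B, #|Ti| = i,
        {in Ai & Ti, forall x y, g x y} & n <= (4 * D) ^ i * (2 * D) * #|Ai|].
  elim: i => [_|i IH lti].
    exists A1, set0; split; rewrite ?sub0set ?cards0 // ?mul1n //.
    by move=> x y _; rewrite inE.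
  have [Ai [Ti [sA sT cT gAT hA]]] := IH (ltnW lti).
  have Ai0 : 0 < #|Ai| by rewrite lt0n; apply/eqP=> e; move: hA n0; rewrite e muln0; clear; lia.
  have [y yB hy] : exists2 y, y \in B :\: Ti & #|Ai| <= 4 * D * deg_in g y Ai.
    case: (boolP [exists y in B :\: Ti, #|Ai| <= 4 * D * deg_in g y Ai]).
      by case/exists_inP=> y; exists y.
    move=> no; exfalso.
    have h1 : #|Ai| * n <= 4 * D * \sum_(x in Ai) deg_in g x (B :\: Ti).
      rewrite -sum_nat_const big_distrr /=; apply: leq_sum => x xA.
      have : deg_in g x B <= deg_in g x (B :\: Ti) + #|Ti|.
        rewrite -{1}(setID B Ti) addnC; apply: leq_trans (deg_inU _ _ _ _) _.
        rewrite leq_add2r; apply: leq_trans (deg_in_le _ _ _) _.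
        by apply: subset_leq_card; apply: subsetIr.
      have := subsetP sA _ xA; rewrite inE => /andP[_]; rewrite cT.
      move: hn lti; set d := deg_in _ _ _; set d' := deg_in _ _ _; clear.
      by nia.
    have h2 : 4 * D * \sum_(y in B :\: Ti) deg_in g y Ai <= n * #|Ai|.-1.
      rewrite big_distrr /=; apply: (@leq_trans (\sum_(y in B :\: Ti) #|Ai|.-1)).
        apply: leq_sum => y yB; rewrite -ltnS prednK // ltnNge.
        by apply: contra no => h; apply/exists_inP; exists y.
      by rewrite sum_nat_const leq_mul2r max_card orbT.
    rewrite double_count // in h1.
    by move: (leq_trans h1 h2) n0 Ai0; case: #|Ai| => //= a; clear; nia.
  exists [set x in Ai | g y x], (y |: Ti); split.
  - by apply: subset_trans sA; apply/subsetP=> x; rewrite inE => /andP[].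
  - by rewrite subUset sT sub1set andbT; case/setDP: yB.
  - by rewrite cardsU1; case/setDP: yB => _ ->; rewrite cT.
  - move=> x z; rewrite inE => /andP[xA gyx] /setU1P[->|zT]; first by rewrite gs.
    exact: gAT.
  - move: hA hy; rewrite -/(deg_in g y Ai) expnS; set c := _ ^ _; set d := deg_in _ _ _.
    by set a := #|Ai| => h1 h2; have := leq_mul (leqnn (c * (2 * D))) h2; move: h1; clear; lia.
have [At [Tt [sA sT cT gAT hA]]] := step t (leqnn t).
have tA : t <= #|At|.
  rewrite leqNgt; apply/negP=> lt; have := leq_trans hn hA.
  set c := _ ^ t; rewrite -(mulnA t.+1) => h.
  have : #|At| * (c * (2 * D)) <= t * (c * (2 * D)) by rewrite leq_mul2r ltnW ?orbT.
  by move: h D0; clear; nia.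
have [S sS cS] := subset_of_card tA; exists S, Tt; split=> //.
  by apply: subset_trans sS (subset_trans sA _); apply/subsetP=> x; rewrite inE => /andP[].
by move=> x y /(subsetP sS); apply: gAT.
Qed.

(** * Cutting a tree at a bounded set of seeds *)

Section Tree.

Variables (Q : finType) (r : Q) (par : Q -> Q) (dp : Q -> nat).
Hypothesis par_root : par r = r.
Hypothesis dp_root : dp r = 0.
Hypothesis dp_par : forall x, x != r -> dp x = (dp (par x)).+1.

Lemma dp_par_pred x : dp (par x) = (dp x).-1.
Proof. by case: (eqVneq x r) => [->|/dp_par->//]; rewrite par_root dp_root. Qed.

Lemma dp_eq0 x : (dp x == 0) = (x == r).
Proof. by case: (eqVneq x r) => [->|/dp_par->//]; rewrite dp_root. Qed.

Definition anc (a y : Q) : bool := (dp a <= dp y) && (iter (dp y - dp a) par y == a).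

Lemma dp_iter n y : dp (iter n par y) = dp y - n.
Proof. by elim: n => [|n IH]; rewrite ?subn0 // iterS dp_par_pred IH; lia. Qed.

Lemma ancP a y : reflect (exists2 n, n <= dp y & iter n par y = a) (anc a y).
Proof.
apply: (iffP andP) => [[le /eqP e]|[n le <-]].
  by exists (dp y - dp a); first exact: leq_subr.
by rewrite dp_iter leq_subr subKn.
Qed.

Lemma anc_refl a : anc a a.
Proof. by apply/ancP; exists 0. Qed.

Lemma anc_dp a y : anc a y -> dp a <= dp y.
Proof. by case/andP. Qed.

Lemma anc_trans b a y : anc a b -> anc b y -> anc a y.
Proof.
case/ancP=> n le <- /ancP[m le' e']; apply/ancP; exists (n + m).
  by move: le; rewrite -e' dp_iter; lia.
by rewrite iterD e'.
Qed.

Lemma anc_par x : anc (par x) x.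
Proof.
apply/ancP; case: (eqVneq x r) => [->|xr]; first by exists 0; rewrite //= par_root.
by exists 1; rewrite // dp_par.
Qed.

Lemma anc_strict a y : anc a y -> a != y -> y != r /\ anc a (par y).
Proof.
case/ancP=> -[|n] le <-; first by rewrite eqxx.
move=> _; have yr : y != r by rewrite -dp_eq0; lia.
by split=> //; apply/ancP; exists n; [rewrite dp_par_pred; lia|rewrite iterSr].
Qed.

Lemma anc_linear a b y : anc a y -> anc b y -> dp a <= dp b -> anc a b.
Proof.
case/ancP=> n le <- /ancP[m le' <-]; rewrite !dp_iter => h.
apply/ancP; exists (n - m); first by rewrite dp_iter; lia.
by rewrite -iterD subnK //; lia.
Qed.

Lemma anc_eq a b y : anc a y -> anc b y -> dp a = dp b -> a = b.
Proof. by move=> /andP[_ /eqP ea] /andP[_ /eqP eb] e; rewrite -ea -eb e. Qed.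

Lemma anc_antisym a b : anc a b -> anc b a -> a = b.
Proof.
move=> h1 h2; apply: (anc_eq h1 (anc_refl b)).
by apply/eqP; rewrite eqn_leq !anc_dp.
Qed.

Lemma anc_at y n : n <= dp y -> exists2 z, anc z y & dp z = n.
Proof.
move=> h; exists (iter (dp y - n) par y); last by rewrite dp_iter subKn.
by apply/ancP; exists (dp y - n); rewrite // leq_subr.
Qed.

Definition child (x y : Q) : bool := (y != r) && (par y == x).

Lemma child_anc x y : child x y -> anc x y.
Proof. by case/andP=> _ /eqP <-; apply: anc_par. Qed.

Lemma child_dp x y : child x y -> dp y = (dp x).+1.
Proof. by case/andP=> /dp_par -> /eqP ->. Qed.

Lemma child_towards x y : anc x y -> x != y -> exists2 c, child x c & anc c y.
Proof.
move=> h xy; have lt : dp x < dp y.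
  rewrite ltn_neqAle anc_dp // andbT; apply: contra xy => /eqP e.
  by apply/eqP; apply: (anc_eq h (anc_refl y)).
have [c cy dc] := anc_at lt; exists c => //.
have cr : c != r by rewrite -dp_eq0 dc.
rewrite /child cr /=; apply/eqP; apply: (anc_eq (anc_trans (anc_par c) cy) h).
by rewrite dp_par_pred dc.
Qed.

Variables (W0 : {set Q}) (be : nat).
Hypothesis be0 : 0 < be.
Hypothesis rW0 : r \in W0.

(* The extra weight of W0 forces every vertex of W0, and every branching point above two of them,
   to raise the level. *)
Definition weight (x : Q) : nat := 1 + be * (x \in W0).
Definition sub (a : Q) : {set Q} := [set y | anc a y].
Definition wsz (a : Q) : nat := \sum_(y in sub a) weight y.
Definition lev (a : Q) : nat := wsz a %/ be.
Definition wtot : nat := \sum_y weight y.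

Lemma wsz_anc a y : anc a y -> wsz y <= wsz a.
Proof.
move=> h; rewrite /wsz [X in _ <= X](big_setID (sub y)) /= (setIidPr _) ?leq_addr //.
by apply/subsetP=> z; rewrite !inE; apply: anc_trans.
Qed.

Lemma lev_anc a y : anc a y -> lev y <= lev a.
Proof. by move=> /wsz_anc h; apply: leq_div2r. Qed.

Lemma wsz_disjoint (S : {set Q}) (A : {set Q}) :
  {in S &, forall a b, a != b -> ~~ anc a b} ->
  (forall a, a \in S -> sub a \subset A) ->
  \sum_(a in S) wsz a <= \sum_(y in A) weight y.
Proof.
move=> anti sA; rewrite /wsz (exchange_big_dep (mem A)) /=; last first.
  by move=> a y aS; apply: (subsetP (sA a aS)).
apply: leq_sum => y yA; rewrite sum_nat_const.
suff : #|[pred a | (a \in S) && (y \in sub a)]| <= 1.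
  by move=> h; rewrite -[leqRHS]mul1n leq_mul2r h orbT.
apply/card_le1P=> a; rewrite inE => /andP[aS]; rewrite inE => ay b.
rewrite !inE; apply/andP/eqP => [[bS b_y]|->//].
apply/eqP/negPn/negP=> ba.
case/orP: (leq_total (dp a) (dp b)) => /anc_linear h.
  have := anti a b aS bS; rewrite eq_sym => /(_ ba) /negP[].
  by apply: h; eassumption.
by have := anti b a bS aS ba => /negP[]; apply: h; eassumption.
Qed.

Lemma child_incomparable x a b : child x a -> child x b -> a != b -> ~~ anc a b.
Proof.
move=> ca cb ab; apply: contra ab => h; apply/eqP.
by apply: (anc_eq h (anc_refl b)); rewrite (child_dp ca) (child_dp cb).
Qed.

Lemma child_sub x a : child x a -> sub a \subset sub x :\ x.
Proof.
move=> ca; apply/subsetP=> y; rewrite !inE => ay.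
rewrite (anc_trans (child_anc ca) ay) andbT; apply/eqP=> yx.
by have := anc_dp ay; rewrite yx (child_dp ca) ltnn.
Qed.

Lemma wsz_child x a : child x a -> weight x + wsz a <= wsz x.
Proof.
move=> ca; rewrite [X in _ <= X](big_setD1 x) ?inE ?anc_refl //= leq_add2l.
have := @wsz_disjoint [set a] (sub x :\ x); rewrite big_set1; apply.
  by move=> ? ? /set1P-> /set1P->; rewrite eqxx.
by move=> ? /set1P->; apply: child_sub.
Qed.

Lemma wsz_child2 x a b : child x a -> child x b -> a != b -> wsz a + wsz b <= wsz x.
Proof.
move=> ca cb ab; have := @wsz_disjoint [set a; b] (sub x).
rewrite big_setU1 ?inE // big_set1; apply.
  move=> y z /set2P[]-> /set2P[]->; rewrite ?eqxx // => _.
    exact: child_incomparable ca cb ab.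
  by apply: child_incomparable cb ca _; rewrite eq_sym.
by move=> ? /set2P[]->; apply: subset_trans (child_sub _) (subsetDl _ _); eassumption.
Qed.

(** Levels do not increase downwards. [W1] collects the vertices that are the last of their positive
    level whichever child one continues with; they are the first approximation of the seeds. *)
Definition W1 : {set Q} := [set x | (0 < lev x) && [forall y, child x y ==> (lev y < lev x)]].

Lemma W1P x : reflect (0 < lev x /\ forall y, child x y -> lev y < lev x) (x \in W1).
Proof.
rewrite inE; apply: (iffP andP) => [[-> /forall_inP]|[-> h]]; first by split.
by split=> //; apply/forall_inP.
Qed.

Lemma lev_add x u v : u + v <= wsz x -> be <= v -> u %/ be < lev x.
Proof.
move=> h1 h2; rewrite /lev; apply: leq_trans (leq_div2r be h1).
apply: (@leq_trans ((u + be) %/ be)); last by rewrite leq_div2r // leq_add2l.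
by rewrite divnDr // divnn be0 addn1.
Qed.

Lemma W0_W1 x : x \in W0 -> x \in W1.
Proof.
move=> xW; have wx : be <= weight x by rewrite /weight xW muln1 leq_addl.
apply/W1P; split.
  rewrite /lev divn_gt0 //; apply: leq_trans wx _.
  by rewrite /wsz (big_setD1 x) ?inE ?anc_refl // leq_addr.
by move=> y cy; apply: (@lev_add x _ (weight x)) => //; rewrite addnC wsz_child.
Qed.

Lemma wsz_lev y : 0 < lev y -> be <= wsz y.
Proof. by rewrite /lev divn_gt0. Qed.

(** With two children of weight at least [be], x would outweigh every child by at least [be], thus
    exceed the level of each and belong to [W1]. *)
Lemma unique_heavy_child x a b : x \notin W1 -> child x a -> child x b ->
  0 < lev a -> 0 < lev b -> a = b.
Proof.
move=> xW ca cb la lb; apply/eqP/negPn/negP=> ab; case/negP: xW; apply/W1P.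
split; first by apply: leq_trans la (lev_anc (child_anc ca)).
move=> y cy; case: (eqVneq y a) => [->|ya].
  by apply: (@lev_add x _ (wsz b)); [exact: wsz_child2|exact: wsz_lev].
by apply: (@lev_add x _ (wsz a)); [exact: wsz_child2|exact: wsz_lev].
Qed.

Lemma heavy_child x : x \notin W1 -> 0 < lev x -> exists2 y, child x y & lev y = lev x.
Proof.
move=> xW lx; case: (boolP [exists y, child x y && (lev x <= lev y)]).
  case/existsP=> y /andP[cy le]; exists y => //.
  by apply/eqP; rewrite eqn_leq le lev_anc // child_anc.
move=> no; case/negP: xW; apply/W1P; split=> // y cy.
by rewrite ltnNge; apply: contra no => h; apply/existsP; exists y; rewrite cy.
Qed.

Lemma card_antichain (S : {set Q}) :
  {in S &, forall a b, a != b -> ~~ anc a b} -> (forall a, a \in S -> 0 < lev a) ->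
  #|S| <= wtot %/ be.
Proof.
move=> anti hl; rewrite leq_divRL //.
have h : \sum_(a in S) wsz a <= \sum_(y in setT) weight y.
  by apply: wsz_disjoint => // a _; apply: subsetT.
have -> : wtot = \sum_(y in setT) weight y by apply: eq_bigl => y; rewrite inE.
apply: leq_trans h; rewrite -sum_nat_const.
by apply: leq_sum => a aS; apply: wsz_lev; apply: hl.
Qed.

Let tau := wtot %/ be.

Lemma lev_max x : lev x <= tau.
Proof.
apply: leq_div2r; rewrite /wsz /wtot big_mkcond.
by apply: leq_sum => y _; case: ifP.
Qed.

(** Vertices of [W1] of equal level form an antichain, since a proper descendant lies below a child
    of smaller level. Each level thus contributes at most [tau]. *)
Lemma card_W1 : #|W1| <= tau.+1 * tau.
Proof.
rewrite -sum1_card (partition_big (fun x => inord (lev x) : 'I_tau.+1) xpredT) //=.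
apply: (@leq_trans (\sum_(j < tau.+1) tau)); last by rewrite sum_nat_const card_ord.
apply: leq_sum => j _; rewrite sum1dep_card; apply: card_antichain.
  move=> a b; rewrite inE => /andP[/W1P[la ha] /eqP ja].
  rewrite inE => /andP[/W1P[lb hb] /eqP jb] ab.
  have eab : lev a = lev b.
    by have := congr1 val (etrans ja (esym jb)); rewrite /= !inordK // ltnS lev_max.
  apply/negP=> h; have [c ca cb] := child_towards h ab.
  by have := ha c ca; rewrite eab ltnNge lev_anc.
by move=> a; rewrite inE => /andP[/W1P[]].
Qed.

(* Parities are arranged so that consecutive seeds that are not adjacent have even depth. *)
Definition W2 : {set Q} := W1 :|: [set par x | x in W1 & odd (dp x)] :|:
  \bigcup_(x in W1 | odd (dp x)) [set y | child x y & 0 < lev y].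
(** The single vertex between two seeds of [W2] at distance two on a branch becomes a seed as well.
    Otherwise the top of a piece would have to be adjacent to both its upper and its lower seed. *)
Definition W3 : {set Q} := W2 :|: [set par x | x in W2 & par (par x) \in W2].

Lemma W2P x : reflect [\/ x \in W1,
    exists2 x0, x0 \in W1 & odd (dp x0) /\ x = par x0 |
    [/\ par x \in W1, odd (dp (par x)), child (par x) x & 0 < lev x]] (x \in W2).
Proof.
rewrite /W2 !in_setU -orbA; apply: (iffP or3P) => -[].
- by constructor 1.
- case/imsetP=> x0; rewrite inE => /andP[x0W od] ->.
  by constructor 2; exists x0.
- case/bigcupP=> w /andP[wW od]; rewrite inE => /andP[c l]; constructor 3.
  by have /andP[_ /eqP ->] := c.
- by constructor 1.
- case=> x0 x0W [od ->]; constructor 2; apply/imsetP; exists x0 => //.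
  by rewrite inE x0W.
case=> pW od c l; constructor 3; apply/bigcupP; exists (par x); first by rewrite pW.
by rewrite inE c.
Qed.

Lemma W3P x : reflect (x \in W2 \/ exists x0,
    [/\ x0 \in W2, par (par x0) \in W2 & x = par x0]) (x \in W3).
Proof.
rewrite /W3 in_setU; apply: (iffP orP) => -[].
- by left.
- by case/imsetP=> x0; rewrite inE => /andP[h1 h2] ->; right; exists x0.
- by left.
by case=> x0 [h1 h2 ->]; right; apply/imsetP; exists x0; rewrite // inE h1.
Qed.

Lemma W1_W2 x : x \in W1 -> x \in W2. Proof. by move=> h; apply/W2P; constructor 1. Qed.

Lemma W2_W3 x : x \in W2 -> x \in W3. Proof. by move=> h; apply/W3P; left. Qed.

Lemma W2_lev x : x \in W2 -> 0 < lev x.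
Proof.
case/W2P=> [/W1P[]//|[x0 /W1P[l _] [_ ->]]|[]//].
exact: leq_trans l (lev_anc (anc_par _)).
Qed.

Lemma W3_lev x : x \in W3 -> 0 < lev x.
Proof.
case/W3P=> [/W2_lev//|[x0 [/W2_lev l _ ->]]].
exact: leq_trans l (lev_anc (anc_par _)).
Qed.

Lemma card_W3 : #|W3| <= 2 * (tau.+1 * tau * (2 + tau)).
Proof.
have h2 : #|W2| <= tau.+1 * tau * (2 + tau).
  apply: (@leq_trans (#|W1| + #|W1| + #|W1| * tau)).
    apply: leq_trans (leq_card_setU _ _).1 _; apply: leq_add.
      apply: leq_trans (leq_card_setU _ _).1 _; rewrite leq_add2l.
      apply: leq_trans (leq_imset_card _ _) _; apply/subset_leq_card/subsetP=> x.
      by rewrite inE => /andP[].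
    apply: (@leq_trans (\sum_(x in W1 | odd (dp x)) tau)).
      elim/big_ind2: _ => [|A n B n' hA hB|x _]; first by rewrite cards0.
        by apply: leq_trans (leq_card_setU _ _).1 _; apply: leq_add.
      apply: card_antichain => [a b|a].
        rewrite !inE => /andP[ca _] /andP[cb _].
        exact: child_incomparable ca cb.
      by rewrite inE => /andP[].
    rewrite sum_nat_const leq_mul2r; apply/orP; right; apply/subset_leq_card/subsetP=> x.
    by case/andP.
  by move: card_W1; rewrite -/tau; set w := #|_|; clear; nia.
apply: leq_trans (leq_card_setU _ _).1 _; rewrite mul2n -addnn; apply: leq_add => //.
apply: leq_trans (leq_imset_card _ _) _; apply: leq_trans h2.
by apply/subset_leq_card/subsetP=> x; rewrite inE => /andP[].
Qed.

Definition component (t : Q) : {set Q} :=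
  [set y | anc t y & [forall z, anc t z && anc z y ==> (z \notin W3)]].

Lemma compP t y : reflect (anc t y /\ forall z, anc t z -> anc z y -> z \notin W3)
  (y \in component t).
Proof.
rewrite inE; apply: (iffP andP) => [[-> /forallP h]|[-> h]]; split=> //.
  by move=> z tz zy; have := h z; rewrite tz zy.
by apply/forallP=> z; apply/implyP=> /andP[]; apply: h.
Qed.

Definition top (t : Q) : bool := [&& t \notin W3, t != r & par t \in W3].

Lemma r_W3 : r \in W3. Proof. exact/W2_W3/W1_W2/W0_W1. Qed.

Lemma comp_top t : top t -> t \in component t.
Proof.
case/and3P=> tW _ _; apply/compP; split; first exact: anc_refl.
by move=> z tz zt; rewrite (anc_antisym zt tz).
Qed.

Lemma comp_cover y : y \notin W3 -> exists2 t, top t & y \in component t.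
Proof.
move: {2}(dp y) (erefl (dp y)) => n; elim: n y => [|n IH] y dy yW.
  by move/eqP: dy; rewrite dp_eq0 => /eqP e; move: yW; rewrite e r_W3.
have yr : y != r by rewrite -dp_eq0 dy.
case: (boolP (par y \in W3)) => pW.
  have ty : top y by rewrite /top yW yr.
  by exists y => //; apply: comp_top.
have [|t tt /compP[tp h]] := IH (par y) _ pW; first by rewrite dp_par_pred dy.
exists t => //; apply/compP; split; first exact: anc_trans tp (anc_par y).
move=> z tz zy; case: (eqVneq z y) => [->//|/(anc_strict zy)[_ zp]].
exact: h.
Qed.

Lemma comp_disjoint t t' y : top t -> top t' -> y \in component t -> y \in component t' -> t = t'.
Proof.
wlog le : t t' / dp t <= dp t'.
  move=> H ht ht' yt yt'; case/orP: (leq_total (dp t) (dp t')) => le.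
    exact: H.
  by symmetry; apply: H.
move=> ht /and3P[_ _ pt'] /compP[ty h] /compP[ty' _].
apply/eqP/negPn/negP=> tt'.
have [_ tp] := anc_strict (anc_linear ty ty' le) tt'.
by have := h _ tp (anc_trans (anc_par t') ty'); rewrite pt'.
Qed.

Lemma comp_notW t y : y \in component t -> y \notin W3.
Proof. by case/compP=> ty h; apply: h (anc_refl y). Qed.

Lemma comp_par t y : y \in component t -> y != t -> y != r /\ par y \in component t.
Proof.
case/compP=> ty h yt; have [|yr tp] := anc_strict ty; first by rewrite eq_sym.
split=> //; apply/compP; split=> // z tz zp.
by apply: h => //; apply: anc_trans zp (anc_par y).
Qed.

(** If [t] has level 0, its whole subtree weighs less than [be]. Otherwise a deepest descendant w of
    the same level lies in [W1]; the component avoids the subtree of w, and two weights of equal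
    level differ by less than [be]. *)
Lemma card_comp t : top t -> #|component t| <= be.
Proof.
case/and3P=> tW _ _; have tW1 : t \notin W1 by apply: contra tW => /W1_W2/W2_W3.
have cs : component t \subset sub t by apply/subsetP=> y /compP[ty _]; rewrite inE.
have le_wsz (A : {set Q}) : #|A| <= \sum_(y in A) weight y.
  by rewrite -sum1_card; apply: leq_sum => y _; rewrite /weight leq_addr.
case: (posnP (lev t)) => [l0|lt].
  apply: leq_trans (subset_leq_card cs) (leq_trans (le_wsz _) _).
  by rewrite -/(wsz t) ltnW // ltnNge -divn_gt0 // -/(lev t) l0.
pose P w := anc t w && (lev w == lev t).
have Pt : P t by rewrite /P anc_refl eqxx.
case: (arg_maxnP dp Pt) => w /andP[tw /eqP lw] wmax.
have wW : w \in W1.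
  apply/negPn/negP=> wW; have [|c wc lc] := heavy_child wW; first by rewrite lw.
  have := wmax c; rewrite /P (anc_trans tw (child_anc wc)) lc lw eqxx => /(_ isT).
  by move=> /=; rewrite (child_dp wc) ltnn.
have cd : component t \subset sub t :\: sub w.
  apply/subsetP=> y /compP[ty h]; rewrite !inE ty andbT; apply/negP=> wy.
  by have := h w tw wy; rewrite W2_W3 // W1_W2.
have h1 : #|component t| + wsz w <= wsz t.
  rewrite /wsz [X in _ <= X](big_setID (sub w)) /= (setIidPr _); last first.
    by apply/subsetP=> y; rewrite !inE; apply: anc_trans.
  rewrite addnC leq_add2l.
  exact: leq_trans (subset_leq_card cd) (le_wsz _).
have h2 := leq_trunc_div (wsz w) be; have h3 := ltn_ceil (wsz t) be0.
move: lw h1 h2 h3; rewrite /lev => ->.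
by set l := _ %/ _; rewrite mulSn; clear; lia.
Qed.

Definition lower (t x : Q) : bool := [&& x \in W3, x != r & par x \in component t].

(** Going up from equal depth, the parents coincide by induction; the common parent lies in the
    component, hence outside [W1], and has a unique heavy child. *)
Lemma same_depth_heavy t n y1 y2 :
  (forall y, y \in [set y1; y2] -> [/\ 0 < lev y, anc t y, dp y = dp t + n &
     y != t -> par y \in component t]) -> y1 = y2.
Proof.
elim: n y1 y2 => [|n IH] y1 y2 h.
  have e y : y \in [set y1; y2] -> y = t.
    by move=> /h[_ ty dy _]; symmetry; apply: (anc_eq ty (anc_refl y)); rewrite dy addn0.
  have y1i : y1 \in [set y1; y2] by rewrite !inE eqxx.
  have y2i : y2 \in [set y1; y2] by rewrite !inE eqxx orbT.
  exact: etrans (e _ y1i) (esym (e _ y2i)).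
have nt y : y \in [set y1; y2] -> y != t.
  by move=> /h[_ _ dy _]; apply/eqP=> e; move: dy; rewrite e; lia.
have st y : y \in [set y1; y2] ->
    [/\ y != r, anc t (par y), par y \in component t & dp (par y) = dp t + n].
  move=> yin; have [l ty dy pc] := h y yin; have ynt := nt y yin.
  have [|yr tp] := anc_strict ty; first by rewrite eq_sym.
  by split=> //; [exact: pc|rewrite dp_par_pred dy addnS].
have y1i : y1 \in [set y1; y2] by rewrite !inE eqxx.
have y2i : y2 \in [set y1; y2] by rewrite !inE eqxx orbT.
have e : par y1 = par y2.
  apply: IH => y; rewrite in_set2 => yp.
  have [z zin ->] : exists2 z, z \in [set y1; y2] & y = par z.
    by case/orP: yp => /eqP ->; [exists y1|exists y2].
  have [zr tp pc dz] := st z zin; have [lz _ _ _] := h z zin; split=> //.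
    exact: leq_trans lz (lev_anc (anc_par z)).
  by move=> /(comp_par pc)[_].
have [r1 _ p1 _] := st _ y1i; have [r2 _ _ _] := st _ y2i.
have [l1 _ _ _] := h _ y1i; have [l2 _ _ _] := h _ y2i.
apply: (@unique_heavy_child (par y1) y1 y2) => //.
- by apply: contra (comp_notW p1) => /W1_W2/W2_W3.
- by rewrite /child r1 eqxx.
- by rewrite /child r2 e eqxx.
Qed.

(** The ancestor y of the deeper seed at the depth of the other one is heavy, so the two agree by
    [same_depth_heavy]. If y were not the deeper seed itself, a seed would lie inside the
    component. *)
Lemma lower_unique t x1 x2 : lower t x1 -> lower t x2 -> x1 = x2.
Proof.
wlog le : x1 x2 / dp x1 <= dp x2.
  move=> H h1 h2; case/orP: (leq_total (dp x1) (dp x2)) => le; first exact: H.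
  by symmetry; apply: H.
move=> /and3P[W1x r1 p1] /and3P[W2x r2 p2].
have [tp1 h1] := compP _ _ p1; have [tp2 h2] := compP _ _ p2.
have [y yx dy] := anc_at le.
have d1 : dp t < dp x1 by rewrite (dp_par r1) ltnS anc_dp.
have ty : anc t y.
  by apply: anc_linear (anc_trans tp2 (anc_par x2)) yx _; rewrite dy ltnW.
have yr : y != r by rewrite -dp_eq0 dy; lia.
have tpy : anc t (par y).
  apply: (anc_linear ty (anc_par y)); rewrite dp_par_pred dy; lia.
have pyx : anc (par y) (par x2).
  apply: anc_linear (anc_trans (anc_par y) (anc_trans yx (anc_refl x2))) (anc_par x2) _.
  by rewrite !dp_par_pred dy; lia.
have py : par y \in component t.
  apply/compP; split=> // z tz zp; apply: h2 => //; exact: anc_trans zp pyx.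
have e : x1 = y.
  apply: (@same_depth_heavy t (dp x1 - dp t)) => z; rewrite in_set2 => /orP[] /eqP ->.
    have tx := anc_trans tp1 (anc_par x1).
    by split=> //; [exact: W3_lev | rewrite subnKC // ltnW].
  split=> //; first exact: leq_trans (W3_lev W2x) (lev_anc yx).
  by rewrite dy subnKC // ltnW.
case: (eqVneq y x2) => [eyx|yx2]; first by rewrite e eyx.
have [_ yp] := anc_strict yx yx2.
by have := h2 y ty yp; rewrite -e W1x.
Qed.

Lemma W3_par_even x : x \in W3 -> par x \notin W3 -> x \in W2 /\ ~~ odd (dp x).
Proof.
move=> /W3P[xW|[x0 [_ h ->]] /negP[]]; last exact: W2_W3.
move=> pW; split=> //; apply/negP=> od; case/negP: pW.
case/W2P: xW od => [xW od|[x0 x0W [od ->]]|[pW _ _ _] _].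
- by apply/W2_W3/W2P; constructor 2; exists x.
- have r0 : x0 != r by rewrite -dp_eq0; case: (dp x0) od.
  by move: od; rewrite (dp_par r0) /= => /negPf->.
exact/W2_W3/W1_W2.
Qed.

(** A lower seed makes the top [t] heavy. If [par t] had odd depth, it would be in [W1], since the
    vertices added in [W2] for parity have even depth; then its heavy child [t] would have been
    added. If [par x] were [t], then [t] would have been added in [W3]. *)
Lemma lower_even t x : top t -> lower t x ->
  [/\ ~~ odd (dp x), ~~ odd (dp (par t)) & par x != t].
Proof.
move=> /and3P[tW tr ptW] /and3P[xW xr px].
have pxW := comp_notW px; have [xW2 ex] := W3_par_even xW pxW.
have [tpx _] := compP _ _ px.
have lt : 0 < lev t.
  exact: leq_trans (W3_lev xW) (lev_anc (anc_trans tpx (anc_par x))).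
have ct : child (par t) t by rewrite /child tr eqxx.
have tW2 : t \notin W2 by apply: contra tW => /W2_W3.
have pt2 : par t \in W2.
  (* A seed that appears only in [W3] has a vertex of [W2] as its unique heavy child, which then
     would be [t]. *)
  case/W3P: ptW => // -[x0 [x0W p0 e]].
  case: (boolP (par t \in W1)) => [/W1_W2//|ptW1].
  case: (eqVneq x0 r) => [x0r|x0r].
    by case/negP: ptW1; rewrite e x0r par_root; apply: W0_W1.
  case/negP: tW2; rewrite (@unique_heavy_child (par t) t x0) // ?W2_lev //.
  by rewrite /child x0r e eqxx.
split=> //.
  apply/negP=> od; case/W2P: (pt2) od => [pW od|[x0 x0W [od ->]]|[_ od c _]].
  - by case/negP: tW2; apply/W2P; constructor 3.
  - have r0 : x0 != r by rewrite -dp_eq0; case: (dp x0) od.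
    by move: od; rewrite (dp_par r0) /= => /negPf->.
  by rewrite (child_dp c) /= od.
apply/eqP=> e; case/negP: pxW; apply/W3P; right; exists x; split=> //.
by rewrite e.
Qed.

End Tree.

Lemma spanning_tree (Q : sgraph) (r : Q) : connected Q ->
  exists (par : Q -> Q) (dp : Q -> nat), [/\ par r = r, dp r = 0,
    forall x, x != r -> dp x = (dp (par x)).+1 &
    forall x, x != r -> edge x (par x)].
Proof.
move=> conn.
(* [lv n] is the ball of radius n about [r], and the tree is a breadth-first tree. *)
pose lv n : {set Q} := iter n (fun S : {set Q} => [set y | (y \in S) || [exists x in S, edge x y]]) [set r].
have ex x : exists n, x \in lv n.
  have /connectP[p] := conn r x; elim/last_ind: p x => [|p y IH] x /=.
    by move=> _ ->; exists 0; rewrite /= inE.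
  rewrite rcons_path last_rcons => /andP[hp e] ->.
  have [n hn] := IH _ hp erefl; exists n.+1; rewrite /= inE; apply/orP; right.
  by apply/exists_inP; exists (last r p).
pose dp x := ex_minn (ex x).
have dpP x : x \in lv (dp x) by rewrite /dp; case: ex_minnP.
have dp_min x n : x \in lv n -> dp x <= n by rewrite /dp; case: ex_minnP => m _ h /h.
have dr : dp r = 0 by apply/eqP; rewrite -leqn0; apply: dp_min; rewrite /= inE.
have step x : x != r -> exists2 y, edge x y & dp x = (dp y).+1.
  move=> xr; have := dpP x; case E : (dp x) => [|n]; first by rewrite /= inE (negPf xr).
  rewrite /= inE => /orP[/dp_min|]; first by rewrite E ltnn.
  case/exists_inP=> y yn exy; exists y; first by rewrite edge_sym.
  congr _.+1; apply/eqP; rewrite eqn_leq (dp_min _ _ yn) andbT -ltnS -E.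
  by apply: dp_min; rewrite /= inE; apply/orP; right; apply/exists_inP; exists y; rewrite // dpP.
pose par x := if x == r then r else odflt r [pick y | edge x y && (dp x == (dp y).+1)].
have parP x : x != r -> edge x (par x) /\ dp x = (dp (par x)).+1.
  move=> xr; rewrite /par (negPf xr); case: pickP => /= [y /andP[? /eqP ?] //|].
  by have [y exy dy] := step x xr; move/(_ y); rewrite exy dy eqxx.
exists par, dp; split=> //; first by rewrite /par eqxx.
  by move=> x /parP[].
by move=> x /parP[].
Qed.

(** These seeds are prescribed: apart from the root they are the ends of edges off the tree, so any
    edge with an end outside this set joins a vertex to its parent. *)
Definition off_tree (Q : sgraph) (r : Q) (par : Q -> Q) : {set Q} :=
  r |: [set x | [exists y, [&& edge x y, ~~ ((x != r) && (par x == y)) &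
                              ~~ ((y != r) && (par y == x))]]].

Lemma card_off_tree (Q : sgraph) (r : Q) par dp k c :
  dp r = 0 -> (forall x, x != r -> dp x = (dp (par x)).+1) ->
  (forall x, x != r -> edge x (par x)) ->
  #|Q| = k.+1 -> #|edges Q| <= k + c -> #|off_tree r par| <= 2 * c + 1.
Proof.
move=> dr dpp ep cQ cE.
pose te x : {set Q} := [set x; par x].
pose TE := te @: [set x | x != r].
have cTE : #|TE| = k.
  rewrite card_in_imset.
    by have := cardsC1 r; rewrite cQ /= => <-; apply: eq_card => x; rewrite !inE.
  move=> x y; rewrite !inE => xr yr e; apply/eqP/negPn/negP=> xy.
  have : x \in te y by rewrite -e !inE eqxx.
  rewrite !inE (negPf xy) /= => /eqP ex.
  have : y \in te x by rewrite e !inE eqxx.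
  rewrite !inE eq_sym (negPf xy) /= => /eqP ey.
  by have := dpp x xr; have := dpp y yr; rewrite -ex -ey; lia.
have sTE : TE \subset edges Q.
  apply/subsetP=> _ /imsetP[x xr ->]; rewrite inE in xr; rewrite inE.
  by apply/existsP; exists x; apply/existsP; exists (par x); rewrite ep // eqxx.
have cX : #|edges Q :\: TE| <= c.
  have := cardsID TE (edges Q); rewrite (setIidPr sTE) cTE => e.
  by rewrite -(leq_add2l k) e.
have : off_tree r par \subset r |: cover (edges Q :\: TE).
  apply/subsetP=> x /setU1P[->|]; first by rewrite setU11.
  rewrite inE => /existsP[y /and3P[exy n1 n2]].
  apply/setU1P; right; apply/bigcupP; exists [set x; y]; last by rewrite !inE eqxx.
  rewrite inE; apply/andP; split; last first.
    by rewrite inE; apply/existsP; exists x; apply/existsP; exists y; rewrite exy eqxx.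
  apply/imsetP=> -[z]; rewrite inE => zr e.
  have xy : x != y by apply: contraL exy => /eqP->; rewrite edge_irrefl.
  have : z \in [set x; y] by rewrite e !inE eqxx.
  have : par z \in [set x; y] by rewrite e !inE eqxx orbT.
  have pz : par z != z.
    by apply/eqP=> pz; have := dpp z zr; rewrite pz; lia.
  rewrite !inE => /orP[] /eqP pe /orP[] /eqP ze.
  - by rewrite pe ze eqxx in pz.
  - by rewrite -ze zr pe eqxx in n2.
  - by rewrite -ze zr pe eqxx in n1.
  - by rewrite pe ze eqxx in pz.
move=> /subset_leq_card /leq_trans; apply.
rewrite cardsU1; apply: (@leq_trans (1 + 2 * c)); last by rewrite addnC.
apply: leq_add; first by case: (_ \in _).
apply: leq_trans (leq_card_cover _) _; apply: (@leq_trans (\sum_(A in edges Q :\: TE) 2)).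
  apply: leq_sum => A /setDP[]; rewrite inE => /existsP[x /existsP[y /andP[_ /eqP ->]]] _.
  by rewrite cards2; case: (_ != _).
by rewrite sum_nat_const mulnC leq_mul2l cX.
Qed.

(** * Embedding the pieces *)

Definition holefree (V : finType) (g : rel V) (e h : nat) (A B : {set V}) : Prop :=
  forall X Y : {set V}, X \subset A -> Y \subset B -> e <= #|X| -> e <= #|Y| ->
  exists2 x, x \in X & h <= deg_in g x Y.

(* A maximal family of discarded vertices of low degree: by hole-freeness fewer than e vertices of
   each kind are discarded, so the remaining sets have minimum degree h into each other. *)
Lemma min_degree_triple (V : finType) (g : rel V) (e h : nat) (A B X1 X2 Y : {set V}) :
  0 < e -> holefree g e h A B -> holefree g e h B A ->
  X1 \subset A -> X2 \subset A -> Y \subset B ->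
  2 * e <= #|X1| -> 2 * e <= #|X2| -> 3 * e <= #|Y| ->
  exists X1' X2' Y' : {set V},
    [/\ X1' \subset X1, X2' \subset X2, Y' \subset Y & X1' != set0] /\
    [/\ forall x, x \in X1' :|: X2' -> h <= deg_in g x Y',
        forall y, y \in Y' -> h <= deg_in g y X1' &
        forall y, y \in Y' -> h <= deg_in g y X2'].
Proof.
move=> e0 hAB hBA s1 s2 sY c1 c2 cY.
(* Discarded vertices: [A1], [A2] for low degree into what is left of Y, and [B1], [B2] for low
   degree into what is left of X1 and X2. Y loses two of these sets, hence its size 3e. *)
pose st (Z : {set V} * {set V} * ({set V} * {set V})) :=
  let: (A1, A2, (B1, B2)) := Z in
  [&& [&& A1 \subset X1, A2 \subset X2, B1 \subset Y & B2 \subset Y],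
      [&& #|A1| <= e, #|A2| <= e, #|B1| <= e & #|B2| <= e],
      [forall x in A1 :|: A2, deg_in g x (Y :\: (B1 :|: B2)) < h],
      [forall y in B1, deg_in g y (X1 :\: A1) < h] &
      [forall y in B2, deg_in g y (X2 :\: A2) < h]].
pose w (Z : {set V} * {set V} * ({set V} * {set V})) :=
  #|Z.1.1| + #|Z.1.2| + #|Z.2.1| + #|Z.2.2|.
have st0 : st (set0, set0, (set0, set0)).
  rewrite /st !sub0set !cards0 /= setU0.
  by apply/and3P; split; apply/forall_inP=> x; rewrite inE.
case: (arg_maxnP w st0) => -[[A1 A2] [B1 B2]] /=.
case/and5P=> /and4P[sA1 sA2 sB1 sB2] /and4P[cA1 cA2 cB1 cB2].
move=> /forall_inP lA /forall_inP lB1 /forall_inP lB2 wmax.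
set Y' := Y :\: (B1 :|: B2) in lA.
have cY' : e <= #|Y'|.
  have := cardsID (B1 :|: B2) Y; have := (leq_card_setU B1 B2).1.
  have : #|Y :&: (B1 :|: B2)| <= #|B1 :|: B2| by apply/subset_leq_card/subsetIr.
  by rewrite /Y'; move: cB1 cB2 cY; clear; lia.
have cX1' : e <= #|X1 :\: A1|.
  have := cardsID A1 X1; have : #|X1 :&: A1| <= #|A1| by apply/subset_leq_card/subsetIr.
  by move: cA1 c1; clear; lia.
have cX2' : e <= #|X2 :\: A2|.
  have := cardsID A2 X2; have : #|X2 :&: A2| <= #|A2| by apply/subset_leq_card/subsetIr.
  by move: cA2 c2; clear; lia.
have sY' : Y' \subset B := subset_trans (subsetDl _ _) sY.
have ltA1 : #|A1| < e.
  rewrite ltnNge; apply/negP=> h1.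
  have [x xA] := hAB A1 Y' (subset_trans sA1 s1) sY' h1 cY'.
  by rewrite leqNgt lA // inE xA.
have ltA2 : #|A2| < e.
  rewrite ltnNge; apply/negP=> h1.
  have [x xA] := hAB A2 Y' (subset_trans sA2 s2) sY' h1 cY'.
  by rewrite leqNgt lA // inE xA orbT.
have ltB1 : #|B1| < e.
  rewrite ltnNge; apply/negP=> h1.
  have [x xA] := hBA B1 _ (subset_trans sB1 sY) (subset_trans (subsetDl _ A1) s1) h1 cX1'.
  by rewrite leqNgt lB1.
have ltB2 : #|B2| < e.
  rewrite ltnNge; apply/negP=> h1.
  have [x xA] := hBA B2 _ (subset_trans sB2 sY) (subset_trans (subsetDl _ A2) s2) h1 cX2'.
  by rewrite leqNgt lB2.
have degS (x : V) (S S' : {set V}) : S' \subset S -> deg_in g x S < h -> deg_in g x S' < h.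
  by move=> ss; apply: leq_ltn_trans; apply: deg_inS.
have inD (S S' : {set V}) (x : V) : x \in S :\: S' -> x \in S /\ x \notin S'.
  by case/setDP.
exists (X1 :\: A1), (X2 :\: A2), Y'; split; split; rewrite ?subsetDl //.
- by rewrite -card_gt0; apply: leq_trans e0 cX1'.
- move=> x xX; rewrite leqNgt; apply/negP=> lx.
  case/setUP: xX => /inD[xX xA].
    have /negP[] : ~~ st (x |: A1, A2, (B1, B2)).
      by apply/negP=> /wmax; rewrite /w /= cardsU1 xA; clear; lia.
    rewrite /st subUset sub1set xX sA1 sA2 sB1 sB2 cardsU1 xA cA2 cB1 cB2 add1n ltA1 /=.
    apply/and3P; split; apply/forall_inP=> y.
    + by rewrite -setUA => /setU1P[->//|]; apply: lA.
    + by move=> /lB1; apply: degS; apply: setDS; apply: subsetUr.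
    + exact: lB2.
  have /negP[] : ~~ st (A1, x |: A2, (B1, B2)).
    by apply/negP=> /wmax; rewrite /w /= cardsU1 xA; clear; lia.
  rewrite /st subUset sub1set xX sA1 sA2 sB1 sB2 cardsU1 xA cA1 cB1 cB2 add1n ltA2 /=.
  apply/and3P; split; apply/forall_inP=> y.
  + by rewrite setUCA => /setU1P[->//|]; apply: lA.
  + exact: lB1.
  + by move=> /lB2; apply: degS; apply: setDS; apply: subsetUr.
- move=> y /inD[yY]; rewrite inE negb_or => /andP[yB1 yB2].
  rewrite leqNgt; apply/negP=> ly.
  have /negP[] : ~~ st (A1, A2, (y |: B1, B2)).
    by apply/negP=> /wmax; rewrite /w /= cardsU1 yB1; clear; lia.
  rewrite /st subUset sub1set yY sA1 sA2 sB1 sB2 cardsU1 yB1 cA1 cA2 cB2 add1n ltB1 /=.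
  apply/and3P; split; apply/forall_inP=> x.
  + by move=> /lA; apply: degS; rewrite -setUA; apply: setDS; apply: subsetUr.
  + by move=> /setU1P[->//|]; apply: lB1.
  + exact: lB2.
move=> y /inD[yY]; rewrite inE negb_or => /andP[yB1 yB2].
rewrite leqNgt; apply/negP=> ly.
have /negP[] : ~~ st (A1, A2, (B1, y |: B2)).
  by apply/negP=> /wmax; rewrite /w /= cardsU1 yB2; clear; lia.
rewrite /st subUset sub1set yY sA1 sA2 sB1 sB2 cardsU1 yB2 cA1 cA2 cB1 add1n ltB2 /=.
apply/and3P; split; apply/forall_inP=> x.
+ by move=> /lA; apply: degS; rewrite setUCA; apply: setDS; apply: subsetUr.
+ exact: lB1.
+ by move=> /setU1P[->//|]; apply: lB2.
Qed.

Section Embed.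

Variables (Q : sgraph) (r : Q) (par : Q -> Q) (dp : Q -> nat) (col : Q -> bool).
Variables (W : {set Q}) (component : Q -> {set Q}) (top : pred Q).
Hypothesis dp_par : forall x, x != r -> dp x = (dp (par x)).+1.
Hypothesis par_edge : forall x, x != r -> edge x (par x).
Hypothesis col_edge : forall x y : Q, edge x y -> col x != col y.
Hypothesis edge_cases : forall x y : Q, edge x y ->
  [\/ x \in W /\ y \in W, x != r /\ par x = y | y != r /\ par y = x].
Hypothesis comp_top : forall t, top t -> t \in component t.
Hypothesis top_par : forall t, top t -> t != r /\ par t \in W.
Hypothesis comp_par : forall t y, y \in component t -> y != t -> y != r /\ par y \in component t.
Hypothesis comp_notW : forall t y, y \in component t -> y \notin W.
Hypothesis comp_disjoint : forall t t' y, top t -> top t' ->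
  y \in component t -> y \in component t' -> t = t'.
Hypothesis comp_cover : forall y, y \notin W -> exists2 t, top t & y \in component t.
Hypothesis lower_unique : forall t x x', x \in W -> x' \in W -> x != r -> x' != r ->
  par x \in component t -> par x' \in component t -> x = x'.
Hypothesis lower_col : forall t x, top t -> x \in W -> x != r -> par x \in component t ->
  col x = col (par t) /\ par x != t.

Variables (V : finType) (g : rel V).
Hypothesis gs : symmetric g.

(** The piece is placed downwards from [t], the class of [t] in X1 and the other one in Y; every
    step has at least [h] candidates, as many as the piece has vertices. The vertex [z], later the
    parent of the lower seed, goes to X2 so that it can be joined to that seed. *)
Lemma comp_embed (t : Q) (z : option Q) (h : nat) (X1 X2 Y : {set V}) :
  top t -> #|component t| <= h -> z != Some t -> X1 != set0 ->
  (forall x, z = Some x -> col x = col t) ->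
  (forall x, x \in X1 :|: X2 -> h <= deg_in g x Y) ->
  (forall y, y \in Y -> h <= deg_in g y X1) ->
  (forall y, y \in Y -> h <= deg_in g y X2) ->
  exists f : Q -> V, [/\ {in component t &, injective f},
    forall y, y \in component t -> y != t -> g (f (par y)) (f y) &
    forall y, y \in component t -> f y \in
      (if col y == col t then if z == Some y then X2 else X1 else Y)].
Proof.
move=> tt ch zt X10 zcol hX hY1 hY2.
pose S y := if col y == col t then if z == Some y then X2 else X1 else Y.
suff H n : forall D : {set Q}, #|D| = n.+1 -> D \subset component t -> t \in D ->
    (forall y, y \in D -> y != t -> par y \in D) ->
    exists f : Q -> V, [/\ {in D &, injective f},
      forall y, y \in D -> y != t -> g (f (par y)) (f y) &
      forall y, y \in D -> f y \in S y].
  have tc := comp_top tt.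
  have c0 : #|component t| = #|component t|.-1.+1 by rewrite prednK //; apply/card_gt0P; exists t.
  by apply: (H _ _ c0) => // y yc yt; case: (comp_par yc yt).
elim: n => [|n IH] D cD sD tD pD.
  have eD : D = [set t].
    by apply/eqP; rewrite eq_sym eqEcard sub1set tD cD cards1.
  have [e|[v vX]] := set_0Vmem X1; first by rewrite e eqxx in X10.
  exists (fun=> v); rewrite eD; split.
  - by move=> x y /set1P-> /set1P->.
  - by move=> y /set1P->; rewrite eqxx.
  by move=> y /set1P->; rewrite /S eqxx (negPf zt).
pose P y := (y \in D) && (y != t).
have [y0 Py0] : exists y0, P y0.
  have : 0 < #|D :\ t| by have := cardsD1 t D; rewrite tD cD; lia.
  by case/card_gt0P=> y; rewrite !inE andbC => ?; exists y.
(* A deepest vertex is a leaf of D and can be placed last. *)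
case: (arg_maxnP dp Py0) => y /andP[yD yt] ymax.
have [yr _] := comp_par (subsetP sD _ yD) yt.
have pyD := pD y yD yt.
have npar y' : y' \in D :\ y -> y' != t -> par y' != y.
  move=> /setD1P[y'y y'D] y't; apply/eqP=> e.
  have [y'r _] := comp_par (subsetP sD _ y'D) y't.
  have := ymax y'; rewrite /P y'D y't => /(_ isT) /=.
  by rewrite (dp_par y'r) e ltnn.
have [| | |y' y'D y't|f [fi fg fS]] := IH (D :\ y).
- by have := cardsD1 y D; rewrite yD cD; lia.
- exact: subset_trans (subsetDl _ _) sD.
- by rewrite !inE tD eq_sym yt.
- by rewrite !inE npar //=; apply: pD => //; case/setD1P: y'D.
have pyD' : par y \in D :\ y.
  rewrite !inE pyD andbT; apply/eqP=> e.
  by have := dp_par yr; rewrite e; lia.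
have hS : h <= deg_in g (f (par y)) (S y).
  have := fS _ pyD'; have := col_edge (par_edge yr); rewrite /S.
  case: (eqVneq (col y) (col t)) => [-> ne|ne ne'].
    rewrite eq_sym (negPf ne) => fY; case: ifP => _; [exact: hY2|exact: hY1].
  have -> : col (par y) == col t by move: ne ne'; case: (col y) (col t) (col (par y)) => [] [] [].
  by move=> fX; apply: hX; rewrite inE; case: ifP fX => _ ->; rewrite ?orbT.
have [v vS vn] : exists2 v, v \in S y /\ g (f (par y)) v & v \notin f @: (D :\ y).
  case: (boolP [exists v, [&& v \in S y, g (f (par y)) v & v \notin f @: (D :\ y)]]).
    by case/existsP=> v /and3P[? ? ?]; exists v.
  move=> no; exfalso.
  have : [set v in S y | g (f (par y)) v] \subset f @: (D :\ y).
    apply/subsetP=> v; rewrite inE => /andP[vS gv]; apply: contraNT no => vn.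
    by apply/existsP; exists v; rewrite vS gv vn.
  move=> /subset_leq_card; rewrite -/(deg_in g _ _).
  have := leq_imset_card f (D :\ y); have := cardsD1 y D; rewrite yD.
  have := subset_leq_card sD; move: hS ch; clear; lia.
case: vS => vS gv.
exists (fun q => if q == y then v else f q); split.
- move=> a b aD bD; case: (eqVneq a y) => [->|ay]; case: (eqVneq b y) => [->|b_y] //.
  + by move=> e; case/negP: vn; rewrite e; apply: imset_f; rewrite !inE b_y.
  + by move=> e; case/negP: vn; rewrite -e; apply: imset_f; rewrite !inE ay.
  by apply: fi; rewrite !inE ?ay ?b_y.
- move=> a aD at'; case: (eqVneq a y) => [->|ay].
    by case: eqP pyD' => // ->; rewrite !inE eqxx.
  have aD' : a \in D :\ y by rewrite !inE ay.
  by rewrite (negPf (npar a aD' at')); apply: fg.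
move=> a aD; case: (eqVneq a y) => [->//|ay].
by apply: fS; rewrite !inE ay.
Qed.

Variables (P : finType) (HP : rel P) (part : P -> {set V}) (m e e0 h : nat).
Variable (d : bool -> P -> nat).
Hypothesis part_disjoint : forall p q x, x \in part p -> x \in part q -> p = q.
Hypothesis card_part : forall p, #|part p| = m.
Hypothesis HPsym : symmetric HP.
Hypothesis HPfree : forall p q, HP p q -> holefree g e0 h (part p) (part q).
Hypothesis e0_gt0 : 0 < e0.
Hypothesis card_comp : forall t, top t -> #|component t| <= h.
Hypothesis eW : 3 * e0 + #|W| <= e.

Definition item (t : Q) : bool * (nat * nat) :=
  (col (par t), (#|[set x in component t | col x == col t]|,
                 #|[set x in component t | col x != col t]|)).

Definition partial_embedding (D : {set Q}) (f : Q -> V) : Prop :=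
  {in D &, injective f} /\ {in D &, forall x y, edge x y -> g (f x) (f y)}.

Lemma imset_sub_card (f : Q -> V) (A : {set Q}) (B : {set V}) (C : {set Q}) :
  (forall x, x \in A -> f x \in B -> x \in C) -> #|f @: A :&: B| <= #|C|.
Proof.
move=> hC; apply: leq_trans (leq_imset_card f C); apply/subset_leq_card/subsetP=> v.
case/setIP=> /imsetP[x xA ->] fB; apply: imset_f; exact: hC.
Qed.

Lemma free_card (f : Q -> V) (D : {set Q}) (A B : {set V}) n k :
  A \subset B -> #|f @: D :&: B| <= n -> n + k <= #|A| -> k <= #|A :\: f @: D|.
Proof.
move=> sA c1 c2; have := cardsID (f @: D) A.
have : #|A :&: f @: D| <= #|f @: D :&: B|.
  by apply: subset_leq_card; rewrite setIC setIS.
by move: c1 c2; clear; lia.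
Qed.

Lemma embed_step (D : {set Q}) (f : Q -> V) (t : Q) (p q : P) (use : P -> nat) :
  W \subset D -> top t -> [disjoint D & component t] ->
  (forall t', top t' -> t' != t -> component t' \subset D \/ [disjoint D & component t']) ->
  partial_embedding D f ->
  (forall w r', w \in W -> d (col w) r' <= deg_in g (f w) (part r')) ->
  (forall r', #|f @: D :&: part r'| <= use r' + #|W|) ->
  HP p q -> use p + e <= d (item t).1 p -> use q + e <= m ->
  exists f' : Q -> V, [/\ partial_embedding (D :|: component t) f',
    forall x, x \in D -> f' x = f x &
    forall r', #|f' @: (D :|: component t) :&: part r'| <=
       bump use p q (item t).2.1 (item t).2.2 r' + #|W|].
Proof.
move=> sWD tt dD tD [fi fg] dW hu Hpq hp hq.
have [tr ptW] := top_par tt.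
(* The lower seed, if there is one. It has the colour of the upper seed [par t], so the same bound
   [d] holds for the neighbourhoods [N1] and [N2] of both seeds in [part p]. *)
pose z := [pick x | [&& x \in W, x != r & par x \in component t]].
pose N1 := [set v in part p | g (f (par t)) v].
pose N2 := if z is Some x then [set v in part p | g (f x) v] else N1.
have zE : (exists x, z = Some x) \/ z = None.
  by move: z @N2 => o _; case: o => [x|]; [left; exists x|right].
have sN1 : N1 \subset part p by apply/subsetP=> v; rewrite inE => /andP[].
have sN2 : N2 \subset part p.
  case: zE => [[x E]|E]; rewrite /N2 E //.
  by apply/subsetP=> v; rewrite inE => /andP[].
(* A part contains at most |W| occupied vertices beyond those counted by [use], so 3 e0 free
   neighbours remain. *)
have bN1 : use p + #|W| + 3 * e0 <= #|N1|.
  apply: leq_trans (dW _ p ptW); apply: leq_trans hp.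
  by move: eW; clear; lia.
have bN2 : use p + #|W| + 3 * e0 <= #|N2|.
  case: zE => [[x E]|E]; rewrite /N2 E //; move: E; rewrite /z; case: pickP => // x'.
  case/and3P=> xW xr px [e']; rewrite -e'.
  have [cx _] := lower_col tt xW xr px.
  apply: leq_trans (dW _ p xW); rewrite cx; apply: leq_trans hp.
  by move: eW; clear; lia.
have bq : use q + #|W| + 3 * e0 <= #|part q|.
  by rewrite card_part; apply: leq_trans hq; move: eW; clear; lia.
have lt23 : 2 * e0 <= 3 * e0 by rewrite leq_mul2r orbT.
have qp : HP q p by rewrite HPsym.
have [|||X1 [X2 [Y [[s1 s2 sY X10] [hX hY1 hY2]]]]] :=
  min_degree_triple e0_gt0 (HPfree Hpq) (HPfree qp)
    (subset_trans (subsetDl N1 (f @: D)) sN1) (subset_trans (subsetDl N2 (f @: D)) sN2)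
    (subsetDl (part q) (f @: D)).
- by apply: leq_trans lt23 (free_card sN1 (hu p) bN1).
- by apply: leq_trans lt23 (free_card sN2 (hu p) bN2).
- exact: free_card (subxx _) (hu q) bq.
pose z' := omap par z.
have zP x : z = Some x -> [/\ x \in W, x != r & par x \in component t].
  by rewrite /z; case: pickP => // x' /and3P[? ? ?] [<-].
have z't : z' != Some t.
  case: zE => [[x E]|E]; rewrite /z' E //=; apply/eqP=> -[e'].
  by have [xW xr px] := zP _ E; have [_] := lower_col tt xW xr px; rewrite e' eqxx.
have z'col x : z' = Some x -> col x = col t.
  case: zE => [[y E]|E]; rewrite /z' E //= => -[<-].
  have [yW yr py] := zP _ E; have [c _] := lower_col tt yW yr py.
  have := col_edge (par_edge yr); have := col_edge (par_edge tr); rewrite c.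
  by case: (col _) (col _) (col _) => [] [] [].
have [f1 [f1i f1g f1S]] := comp_embed tt (card_comp tt) z't X10 z'col hX hY1 hY2.
pose f' x := if x \in component t then f1 x else f x.
have f'D x : x \in D -> f' x = f x by move=> xD; rewrite /f' (disjointFr dD xD).
have f'c x : x \in component t -> f' x = f1 x by rewrite /f' => ->.
have f1n x : x \in component t -> f1 x \notin f @: D.
  move=> xc; have := f1S x xc; case: ifP => _; last by move/(subsetP sY); case/setDP.
  by case: ifP => _; [move/(subsetP s2)|move/(subsetP s1)]; case/setDP.
have f1p x : x \in component t -> f1 x \in part (if col x == col t then p else q).
  move=> xc; have := f1S x xc; case: ifP => _; last by move/(subsetP sY); case/setDP.
  by case: ifP => _; [move/(subsetP s2)/setDP => -[/(subsetP sN2)]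
                     |move/(subsetP s1)/setDP => -[/(subsetP sN1)]].
(* Edges from the piece to D join [t] to the upper seed or the vertex of [z'] to the lower seed. *)
have f1W x w : x \in component t -> w \in D -> edge x w -> g (f1 x) (f w).
  move=> xc wD exw.
  case: (edge_cases exw) => [[xW _]|[xr e']|[wr e']].
  - by case/negP: (comp_notW xc).
  - have xt : x = t.
      apply/eqP/negPn/negP=> xt; have [_] := comp_par xc xt.
      by rewrite e' (disjointFr dD wD).
    have := f1S x xc; rewrite xt eqxx (negPf z't) => /(subsetP s1)/setDP[].
    by rewrite inE => /andP[_ gg] _; rewrite gs -e' xt.
  have wW : w \in W.
    apply/negPn/negP=> wW; have [t' tt' wc] := comp_cover wW.
    have t't : t' != t by apply/eqP=> e''; rewrite e'' (disjointFr dD wD) in wc.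
    case: (eqVneq w t') => [wt|wt].
      by have [_] := top_par tt'; rewrite -wt e' => xW; case/negP: (comp_notW xc).
    have [_ pw] := comp_par wc wt; rewrite e' in pw.
    by case/eqP: t't; exact: comp_disjoint tt' tt pw xc.
  have zw : z = Some w.
    rewrite /z; case: pickP => [w' /and3P[w'W w'r pw']|/(_ w)].
      by congr Some; apply: (@lower_unique t) => //; rewrite e'.
    by rewrite wW wr e' xc.
  have := f1S x xc; rewrite (z'col x) ?eqxx; last by rewrite /z' zw /= e'.
  rewrite /z' zw /= e' eqxx => /(subsetP s2)/setDP[]; rewrite /N2 zw inE.
  by case/andP=> _ gg _; rewrite gs.
exists f'; split.
- split.
    move=> x y /setUP[xD|xc] /setUP[yD|yc].
    + by rewrite (f'D x) // (f'D y) //; apply: fi.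
    + rewrite (f'D x) // (f'c y) // => e'.
      by case/negP: (f1n y yc); rewrite -e' imset_f.
    + rewrite (f'c x) // (f'D y) // => e'.
      by case/negP: (f1n x xc); rewrite e' imset_f.
    by rewrite (f'c x) // (f'c y) //; apply: f1i.
  move=> x y /setUP[xD|xc] /setUP[yD|yc] exy.
  + by rewrite (f'D x) // (f'D y) //; apply: fg.
  + by rewrite (f'D x) // (f'c y) // gs; apply: f1W => //; rewrite edge_sym.
  + by rewrite (f'c x) // (f'D y) //; apply: f1W.
  rewrite (f'c x) // (f'c y) //.
  have rootedge a b : a \in component t -> b \in component t -> a != r -> par a = b -> g (f1 b) (f1 a).
    move=> ac bc ar e'; case: (eqVneq a t) => [at'|at']; last by rewrite -e'; apply: f1g.
    by case/negP: (comp_notW bc); rewrite -e' at'.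
  case: (edge_cases exy) => [[xW _]|[xr e']|[yr e']].
  + by case/negP: (comp_notW xc).
  + by rewrite gs; apply: rootedge.
  exact: rootedge.
- exact: f'D.
move=> r'; rewrite imsetU setIUl.
apply: leq_trans (leq_card_setU _ _).1 _; rewrite /bump.
have e1 : f' @: D = f @: D by apply: eq_in_imset => x; apply: f'D.
have e2 : f' @: component t = f1 @: component t by apply: eq_in_imset => x; apply: f'c.
rewrite e1 e2; have hu' := hu r'.
suff : #|f1 @: component t :&: part r'| <= (r' == p) * (item t).2.1 + (r' == q) * (item t).2.2.
  by move: hu'; clear; lia.
pose A := [set x in component t | col x == col t]; pose B := [set x in component t | col x != col t].
have : f1 @: component t :&: part r' \subset (f1 @: A :&: part r') :|: (f1 @: B :&: part r').
  apply/subsetP=> v /setIP[/imsetP[x xc ->] vr]; rewrite !in_setU !in_setI vr !andbT.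
  case: (boolP (col x == col t)) => cx; apply/orP; [left|right];
    by apply: imset_f; rewrite inE xc cx.
move=> /subset_leq_card /leq_trans; apply.
apply: leq_trans (leq_card_setU _ _).1 _; apply: leq_add.
  have c : #|f1 @: A :&: part r'| <= #|if r' == p then A else set0|.
    apply: imset_sub_card => x; rewrite inE => /andP[xc cx] fr.
    have := f1p x xc; rewrite cx => fp; rewrite (part_disjoint fr fp) eqxx.
    by rewrite inE xc cx.
  by apply: leq_trans c _; case: ifP => _; rewrite ?cards0 ?mul1n.
have c : #|f1 @: B :&: part r'| <= #|if r' == q then B else set0|.
  apply: imset_sub_card => x; rewrite inE => /andP[xc cx] fr.
  have := f1p x xc; rewrite (negPf cx) => fp; rewrite (part_disjoint fr fp) eqxx.
  by rewrite inE xc cx.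
by apply: leq_trans c _; case: ifP => _; rewrite ?cards0 ?mul1n.
Qed.

Lemma embed_all (s : seq Q) (D : {set Q}) (f : Q -> V) (use : P -> nat) :
  uniq s -> all top s -> sched HP d m e use (map item s) ->
  W \subset D -> (forall t, top t -> t \notin s -> component t \subset D) ->
  (forall t, t \in s -> [disjoint D & component t]) ->
  partial_embedding D f ->
  (forall w r', w \in W -> d (col w) r' <= deg_in g (f w) (part r')) ->
  (forall r', #|f @: D :&: part r'| <= use r' + #|W|) ->
  exists f' : Q -> V, partial_embedding setT f'.
Proof.
elim: s D f use => [|t s IH] D f use.
  move=> _ _ _ sWD cD _ pe _ _; exists f; suff <- : D = setT by [].
  apply/setP=> y; rewrite inE; case: (boolP (y \in W)) => [/(subsetP sWD)//|yW].
  by have [t tt yc] := comp_cover yW; apply: subsetP (cD t tt _) _ yc.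
move=> /= /andP[ts us] /andP[tt ts'] [p [q [Hpq hp hq hs]]] sWD cD dD pe dW hu.
have dDt : [disjoint D & component t] by apply: dD; rewrite inE eqxx.
have [t' tt' t't|f' [pe' f'D hu']] := embed_step sWD tt dDt _ pe dW hu Hpq hp hq.
  case: (boolP (t' \in s)) => t's; first by right; apply: dD; rewrite inE t's orbT.
  by left; apply: cD => //; rewrite inE negb_or t't.
apply: (IH (D :|: component t) f' _ us ts' hs) => //.
- by apply: subset_trans sWD (subsetUl _ _).
- move=> t' tt' t's; case: (eqVneq t' t) => [->|t't]; first exact: subsetUr.
  by apply: subset_trans (subsetUl _ _); apply: cD => //; rewrite inE negb_or t't.
- move=> t' t's; apply/pred0P=> y /=; apply/negP=> /andP[/setUP[yD|yc] yc'].
    have dt' : [disjoint D & component t'] by apply: dD; rewrite inE t's orbT.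
    by rewrite (disjointFr dt' yD) in yc'.
  have tt' := allP ts' _ t's.
  by move: ts; rewrite (comp_disjoint tt tt' yc yc') t's.
by move=> w r' wW; rewrite f'D ?(subsetP sWD) //; apply: dW.
Qed.

End Embed.

(** * Cleaning the host graph *)

Lemma sum_deg_in (V : finType) (R : rel V) (A B : {set V}) :
  \sum_(x in A) deg_in R x B = #|[set p : V * V | [&& p.1 \in A, p.2 \in B & R p.1 p.2]]|.
Proof.
rewrite -sum1_card (partition_big fst (mem A)) /=; last first.
  by move=> p; rewrite inE => /andP[].
apply: eq_bigr => x xA; rewrite sum1dep_card /deg_in.
rewrite -(card_imset [set y in B | R x y] (f := pair x)); last by move=> y y' [].
apply: eq_card => -[x' y]; rewrite !inE /=; apply/imsetP/idP.
  by case=> y'; rewrite inE => /andP[yB Rxy] [-> ->]; rewrite xA yB Rxy eqxx.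
case/andP=> /and3P[xA' yB Rxy] /eqP e; rewrite e in Rxy *; exists y => //.
by rewrite inE yB.
Qed.

(** Vertices that would lose at least del/2 neighbours are isolated altogether; each of the others
    loses less than del/2 and at most |Bad| more. *)
Lemma cleanup (V : finType) (g R : rel V) (del : nat) :
  symmetric g -> symmetric R -> exists (g' : rel V) (Bad : {set V}),
  [/\ symmetric g', forall x y, g' x y -> [/\ g x y, ~~ R x y & x \notin Bad],
      del * #|Bad| <= 2 * #|[set p : V * V | g p.1 p.2 && R p.1 p.2]| &
      forall x, x \notin Bad -> 2 * deg_in g x setT <= 2 * deg_in g' x setT + del + 2 * #|Bad|].
Proof.
move=> gs Rs; pose gR x y := g x y && R x y.
pose Bad := [set x | del <= 2 * deg_in gR x setT].
exists (fun x y => [&& g x y, ~~ R x y, x \notin Bad & y \notin Bad]), Bad; split.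
- by move=> x y; rewrite gs Rs; congr (_ && (_ && _)); rewrite andbC.
- by move=> x y /and4P[].
- rewrite mulnC -sum_nat_const.
  have -> : [set p : V * V | g p.1 p.2 && R p.1 p.2] =
    [set p : V * V | [&& p.1 \in [set: V], p.2 \in [set: V] & gR p.1 p.2]].
    by apply/setP=> p; rewrite !inE.
  rewrite -sum_deg_in big_distrr /= [leqRHS](bigID (mem Bad)) /=.
  apply: leq_trans (leq_addr _ _); rewrite big_mkcond [leqRHS]big_mkcond /=.
  by apply: leq_sum => x _; rewrite !inE /=; case: ifP.
move=> x xB; set g' := fun _ _ => _.
have h : deg_in g x setT <= deg_in g' x setT + deg_in gR x setT + #|Bad|.
  have : [set y in [set: V] | g x y] \subset
    ([set y in [set: V] | g' x y] :|: [set y in [set: V] | gR x y]) :|: Bad.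
    apply/subsetP=> y; rewrite in_set in_setT /= => gxy.
    rewrite in_setU; case: (boolP (y \in Bad)) => yB; rewrite ?orbT // orbF.
    rewrite in_setU [y \in [set _ in _ | g' x _]]in_set.
    rewrite [y \in [set _ in _ | gR x _]]in_set in_setT /= /g' /gR.
    by rewrite gxy xB yB; case: (R x y).
  move=> /subset_leq_card /leq_trans; apply.
  apply: leq_trans (leq_card_setU _ _).1 _; rewrite leq_add2r.
  exact: (leq_card_setU _ _).1.
by move: h xB; rewrite inE -ltnNge; clear; lia.
Qed.

Lemma card_sparse_pairs (V Y : finType) (g : rel V) (ty : V -> Y) (D E : nat) :
  0 < #|V| -> #|Y| ^ 2 * E <= D ->
  let sparse a b := D * \sum_(x in [set x | ty x == a]) deg_in g x [set y | ty y == b] < #|V| ^ 2 in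
  E * #|[set p : V * V | g p.1 p.2 && sparse (ty p.1) (ty p.2)]| <= #|V| ^ 2.
Proof.
move=> n0 hD; set sparse := fun a b => _; move=> /=.
have Y0 : 0 < #|Y| by have /card_gt0P[x _] := n0; apply/card_gt0P; exists (ty x).
rewrite -(@leq_pmul2l (#|Y| ^ 2)) ?expn_gt0 ?Y0 // mulnA.
apply: leq_trans (leq_mul hD (leqnn _)) _.
rewrite -[X in D * X <= _]sum1_card (partition_big (fun p => (ty p.1, ty p.2)) xpredT) //= big_distrr /=.
apply: (@leq_trans (\sum_(ab : Y * Y) #|V| ^ 2)); last first.
  by rewrite sum_nat_const card_prod mulnn.
apply: leq_sum => -[a b] _; rewrite sum1dep_card.
case: (boolP (sparse a b)) => sp; last first.
  rewrite (_ : [set p | _] = set0) ?cards0 ?muln0 //; apply/setP=> p.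
  rewrite !inE; apply/negP=> /andP[/andP[_ sp'] /eqP[ea eb]].
  by rewrite ea eb (negPf sp) in sp'.
apply: leq_trans (ltnW sp); rewrite leq_mul2l; apply/orP; right.
rewrite sum_deg_in; apply/subset_leq_card/subsetP=> p.
by rewrite !inE => /andP[/andP[-> _] /eqP[-> ->]]; rewrite !eqxx.
Qed.

(** * The interface between the cut tree and the embedding *)

Record decomposition (Q : sgraph) (h : nat) (r : Q) (par : Q -> Q) (dp : Q -> nat)
    (col : Q -> bool) (W : {set Q}) (component : Q -> {set Q}) (top : pred Q) : Prop :=
  Decomposition {
  dec_root : r \in W;
  dec_dp : forall x, x != r -> dp x = (dp (par x)).+1;
  dec_par : forall x, x != r -> edge x (par x);
  dec_col : forall x y : Q, edge x y -> col x != col y;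
  dec_edge : forall x y : Q, edge x y ->
    [\/ x \in W /\ y \in W, x != r /\ par x = y | y != r /\ par y = x];
  dec_top : forall t, top t -> t \in component t;
  dec_top_par : forall t, top t -> t != r /\ par t \in W;
  dec_comp_par : forall t y, y \in component t -> y != t -> y != r /\ par y \in component t;
  dec_notW : forall t y, y \in component t -> y \notin W;
  dec_disjoint : forall t t' y, top t -> top t' -> y \in component t -> y \in component t' -> t = t';
  dec_cover : forall y, y \notin W -> exists2 t, top t & y \in component t;
  dec_lower : forall t x x', x \in W -> x' \in W -> x != r -> x' != r ->
    par x \in component t -> par x' \in component t -> x = x';
  dec_lower_col : forall t x, top t -> x \in W -> x != r -> par x \in component t ->
    col x = col (par t) /\ par x != t;
  dec_card : forall t, top t -> #|component t| <= h }.

Lemma decompose (Q : sgraph) (k c h tau : nat) :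
  connected Q -> bipartite Q -> #|Q| = k.+1 -> #|edges Q| <= k + c -> 0 < h ->
  k.+1 %/ h + (2 * c + 1) <= tau ->
  exists r par dp col W component top, @decomposition Q h r par dp col W component top /\
    #|W| <= 2 * (tau.+1 * tau * (2 + tau)).
Proof.
move=> conn [A bip] cQ cE h0 htau.
have [r _] : exists r : Q, r \in Q.
  by have /card_gt0P : 0 < #|Q| by rewrite cQ.
have [par [dp [pr dr dpp ep]]] := spanning_tree r conn.
have r_in : r \in off_tree r par by rewrite setU11.
(* Connectedness makes the colour a parity of depth, so seeds of even depth share a colour. *)
have colE : forall x, (x \in A) = (r \in A) (+) odd (dp x).
  move=> x; move: {2}(dp x) (erefl (dp x)) => n; elim: n x => [|n IH] x dx.
    have -> : x = r by apply/eqP/negPn/negP=> /dpp; rewrite dx.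
    by rewrite dr addbF.
  have xr : x != r by apply/eqP=> e; move: dx; rewrite e dr.
  have := dpp x xr; have := bip _ _ (ep x xr); rewrite dx => ne [dp'].
  have := IH (par x) (esym dp'); rewrite -dp' /=; move: ne.
  by case: (x \in A); case: (par x \in A); case: (r \in A); case: (odd n).
(* The total weight is k + 1 plus [h] for each prescribed seed. *)
have wt : wtot (off_tree r par) h %/ h <= tau.
  apply: leq_trans htau; rewrite /wtot /weight big_split /= sum1_card -big_distrr /=.
  have -> : \sum_y (y \in off_tree r par) = #|off_tree r par|.
    by rewrite -sum1_card [RHS]big_mkcond; apply: eq_bigr => y _; case: (_ \in _).
  rewrite cQ mulnC addnC divnMDl // addnC leq_add2l.
  exact: card_off_tree dr dpp ep cQ cE.
exists r, par, dp, (fun x => x \in A), (W3 r par dp (off_tree r par) h),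
  (component r par dp (off_tree r par) h), (top r par dp (off_tree r par) h).
split; last first.
  have := card_W3 pr dr dpp (off_tree r par) h0; move/leq_trans; apply.
  by rewrite leq_mul2l /= leq_mul // leq_mul.
have W0W x : x \in off_tree r par -> x \in W3 r par dp (off_tree r par) h.
  by move=> xW; apply/W2_W3/W1_W2; apply: W0_W1.
split=> //.
- exact: W0W.
- move=> x y exy; case: (boolP ((x != r) && (par x == y))) => [/andP[xr /eqP e]|n1].
    by constructor 2.
  case: (boolP ((y != r) && (par y == x))) => [/andP[yr /eqP e]|n2].
    by constructor 3.
  constructor 1; split; apply: W0W; rewrite !inE; apply/orP; right; apply/existsP.
    by exists y; rewrite exy n1 n2.
  by exists x; rewrite edge_sym exy n1 n2.
- by move=> t; apply: comp_top.
- by move=> t /and3P[].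
- by move=> t y; apply: comp_par.
- by move=> t y; apply: comp_notW.
- by move=> t t' y; apply: comp_disjoint.
- by move=> y; apply: comp_cover.
- move=> t x x' xW x'W xr x'r px px'.
  by apply: (@lower_unique _ r par dp pr dr dpp _ h h0 r_in t);
    rewrite /lower ?xW ?x'W ?xr ?x'r ?px ?px'.
- move=> t x tt xW xr px.
  have lx : lower r par dp (off_tree r par) h t x by rewrite /lower xW xr px.
  have [ox ot pt] := lower_even pr dr dpp h0 r_in tt lx.
  by split=> //=; rewrite (colE x) (colE (par t)) (negPf ox) (negPf ot).
by move=> t; apply: card_comp.
Qed.

Definition tops (Q : sgraph) (top : pred Q) : seq Q := [seq t <- enum Q | top t].

Lemma dec_total (Q : sgraph) h r par dp col W component top k :
  @decomposition Q h r par dp col W component top -> #|Q| = k.+1 ->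
  total (map (item par col component) (tops top)) <= k.
Proof.
move=> dec cQ; rewrite /total big_map /tops big_filter big_enum_cond /=.
rewrite (eq_bigr (fun t => #|component t|)); last first.
  move=> t _; rewrite -(cardsID [set x | col x == col t] (component t)); congr (_ + _).
    by apply: eq_card => x; rewrite !inE.
  by apply: eq_card => x; rewrite !inE andbC.
have : \sum_(t | top t) #|component t| = #|\bigcup_(t | top t) component t|.
  rewrite -sum1_card.
  under eq_bigr => t tt do rewrite -sum1_card.
  rewrite [RHS](partition_big (fun x => odflt x [pick t | top t && (x \in component t)]) top) /=.
    apply: eq_bigr => t tt; apply: eq_bigl => x; apply/idP/andP => [xc|[]].
      split; first by apply/bigcupP; exists t.
      case: pickP => [t' /andP[tt' xc']|/(_ t)]; last by rewrite tt xc.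
      by rewrite /=; apply/eqP; apply: (dec_disjoint dec tt' tt xc' xc).
    case/bigcupP=> t' tt' xc'; case: pickP => [t2 /andP[tt2 xc2] /eqP <- //|/(_ t')].
    by rewrite tt' xc'.
  move=> x /bigcupP[t tt xc]; case: pickP => [t2 /andP[] //|/(_ t)].
  by rewrite tt xc.
move=> ->; have : \bigcup_(t | top t) component t \subset ~: W.
  by apply/bigcupsP=> t _; apply/subsetP=> x /(dec_notW dec); rewrite inE.
move=> /subset_leq_card /leq_trans; apply.
have W0 : 0 < #|W| by apply/card_gt0P; exists r; apply: dec_root dec.
by have := cardsC W; rewrite cQ; move: W0; lia.
Qed.

Lemma dec_item (Q : sgraph) h r par dp col W component top it :
  @decomposition Q h r par dp col W component top ->
  it \in map (item par col component) (tops top) -> it.2.1 + it.2.2 <= h.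
Proof.
move=> dec /mapP[t]; rewrite mem_filter => /andP[tt _] -> /=.
apply: leq_trans (dec_card dec tt).
rewrite -(cardsID [set x | col x == col t] (component t)); apply: leq_add.
  by apply/subset_leq_card/subsetP=> x; rewrite !inE.
by apply/subset_leq_card/subsetP=> x; rewrite !inE andbC.
Qed.

(* The seeds go into the two sides of a complete bipartite graph, so that all edges of Q between
   seeds, in particular all those off the spanning tree, are present. *)
Lemma embed_from_biclique (Q : sgraph) h r par dp col W component top (s : seq Q)
    (V P : finType) (g : rel V) (HP : rel P) (part : P -> {set V}) (m e e0 : nat)
    (d : bool -> P -> nat) (S : bool -> {set V}) :
  @decomposition Q h r par dp col W component top ->
  uniq s -> (forall t, top t = (t \in s)) ->
  symmetric g -> irreflexive g ->
  (forall p q x, x \in part p -> x \in part q -> p = q) ->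
  (forall p, #|part p| = m) -> symmetric HP ->
  (forall p q, HP p q -> holefree g e0 h (part p) (part q)) -> 0 < e0 ->
  3 * e0 + #|W| <= e -> (forall b, #|W| <= #|S b|) ->
  {in S true & S false, forall x y, g x y} ->
  (forall b v p, v \in S b -> d b p <= deg_in g v (part p)) ->
  sched HP d m e (fun=> 0) (map (item par col component) s) ->
  exists2 f : Q -> V, injective f & forall x y, edge x y -> g (f x) (f y).
Proof.
move=> dec us sE gs girr pd cp HPs HPf e00 eW WS gS dS hs.
have dS01 x : x \in S true -> x \in S false -> False.
  by move=> x1 x2; have := gS x x x1 x2; rewrite girr.
have [f0 [f0S f0i]] : exists f0 : Q -> V,
    {in W, forall x, f0 x \in S (col x)} /\ {in W &, injective f0}.
  have hlt b x : x \in W -> index x (enum W) < size (enum (S b)).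
    by move=> xW; rewrite -cardE (leq_trans _ (WS b)) // cardE index_mem mem_enum.
  have [Wz|[w wW]] := set_0Vmem W.
    by have := dec_root dec; rewrite Wz inE.
  have [v0 _] : exists v, v \in S true.
    by apply/card_gt0P; apply: leq_trans (WS true); apply/card_gt0P; exists w.
  (* The position in [enum W] separates seeds of equal colour; the two sides are disjoint as [g] has
     no loops. *)
  pose f0 x := nth v0 (enum (S (col x))) (index x (enum W)).
  have f0S : {in W, forall x, f0 x \in S (col x)}.
    by move=> x xW; rewrite -mem_enum mem_nth // hlt.
  exists f0; split=> // x y xW yW e'.
  have cxy : col x = col y.
    have := f0S x xW; have := f0S y yW; rewrite e'.
    by case: (col x) (col y) => [] [] // h1 h2; [case: (dS01 _ h2 h1)|case: (dS01 _ h1 h2)].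
  move: e' => /eqP; rewrite /f0 cxy nth_uniq ?enum_uniq ?hlt // => /eqP e'.
  have := congr1 (nth x (enum W)) e'; rewrite !nth_index ?mem_enum //.
have [|||||||||f' [fi fg]] := @embed_all Q r par dp col W component top (dec_dp dec) (dec_par dec)
  (dec_col dec) (dec_edge dec) (dec_top dec) (dec_top_par dec) (dec_comp_par dec)
  (dec_notW dec) (dec_disjoint dec) (dec_cover dec) (dec_lower dec) (dec_lower_col dec)
  V g gs P HP part m e e0 h d pd cp HPs HPf e00 (dec_card dec) eW s W f0 (fun=> 0).
- exact: us.
- by apply/allP=> t; rewrite sE.
- exact: hs.
- exact: subxx.
- by move=> t tt; rewrite -sE tt.
- move=> t _; apply/pred0P=> x /=; apply/negP=> /andP[xW xc].
  by case/negP: (dec_notW dec xc).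
- split=> // x y xW yW exy; have := dec_col dec exy.
  have := f0S x xW; have := f0S y yW.
  case: (col x) (col y) => [] [] // h1 h2 _; last by rewrite gs; apply: gS.
  exact: gS.
- by move=> w p wW; apply: dS; apply: f0S.
- move=> p; rewrite add0n; apply: leq_trans (leq_imset_card f0 W).
  by apply/subset_leq_card/subsetIl.
exists f'.
  by move=> x y; apply: fi; rewrite inE.
by move=> x y; apply: fg; rewrite inE.
Qed.

(* Halving turns a 2-matching of the clusters into a matching of the halves. *)
Lemma halve_cells (V T : finType) (C : V -> option T) (s : nat) :
  (forall i, #|cell C i| = s) ->
  exists part : T * bool -> {set V}, [/\
    forall p q x, x \in part p -> x \in part q -> p = q,
    forall p, #|part p| = s %/ 2, forall p, part p \subset cell C p.1 &
    forall (g : rel V) x (D : {set T}), deg_in g x (span C D) <=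
      \sum_(i in D) (deg_in g x (part (i, true)) + deg_in g x (part (i, false)) + 1)].
Proof.
move=> cs; have cellE i x : (x \in cell C i) = (C x == Some i) by rewrite inE.
pose half i := [set x in take (s %/ 2) (enum (cell C i))].
pose half' i := [set x in take (s %/ 2) (drop (s %/ 2) (enum (cell C i)))].
have ce i : size (enum (cell C i)) = s by rewrite -cardE cs.
have s2 : s %/ 2 <= s - s %/ 2 by lia.
pose part (p : T * bool) := if p.2 then half p.1 else half' p.1.
have sub p : part p \subset cell C p.1.
  by apply/subsetP=> x; rewrite /part; case: p.2; rewrite inE => /mem_take; [|move/mem_drop];
    rewrite mem_enum.
exists part; split=> //.
- move=> [i b] [j b'] x xp xq.
  have := subsetP (sub _) _ xp; have := subsetP (sub _) _ xq; rewrite !cellE /= => /eqP-> /eqP[e].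
  subst j; move: xp xq; rewrite /part /=.
  have := enum_uniq (cell C i); rewrite -{1}(cat_take_drop (s %/ 2) (enum _)) cat_uniq.
  case/and3P=> _ /hasPn hn _.
  case: b; case: b' => //; rewrite !inE => x1 x2; exfalso.
    by have /negP[] := hn x (mem_take x2).
  by have /negP[] := hn x (mem_take x1).
- move=> [i b]; rewrite /part /=; case: b; rewrite cardsE (card_uniqP _).
  + by rewrite size_take ce; case: ltnP => // h; lia.
  + by rewrite take_uniq // enum_uniq.
  + by rewrite size_take size_drop ce; case: ltnP => // h; lia.
  + by rewrite take_uniq // drop_uniq // enum_uniq.
move=> g x D; have -> : span C D = \bigcup_(i in D) cell C i.
  apply/setP=> y; apply/spanP/bigcupP => -[i iD h]; exists i => //.
    by rewrite cellE h.
  by apply/eqP; rewrite -cellE.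
elim/big_rec2: _ => [|i n A iD IH]; first by rewrite (leq_trans (deg_in_le _ _ _)) ?cards0.
apply: leq_trans (deg_inU _ _ _ _) _; apply: leq_add => //.
(* A cluster of odd size has one vertex in neither half, which is the summand 1. *)
have : cell C i \subset part (i, true) :|: part (i, false) :|:
    [set y in drop (s %/ 2) (drop (s %/ 2) (enum (cell C i)))].
  apply/subsetP=> y; rewrite -mem_enum -{1}(cat_take_drop (s %/ 2) (enum _)) mem_cat.
  case/orP=> h; first by rewrite /part !inE h.
  move: h; rewrite -{1}(cat_take_drop (s %/ 2) (drop _ _)) mem_cat /part !inE => /orP[]->;
    by rewrite ?orbT.
move=> /(deg_inS g x) /leq_trans; apply; apply: leq_trans (deg_inU _ _ _ _) _.
apply: leq_add (deg_inU _ _ _ _) _; apply: leq_trans (deg_in_le _ _ _) _.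
rewrite cardsE; apply: leq_trans (card_size _) _; rewrite !size_drop ce; lia.
Qed.

Lemma mem_tops (Q : sgraph) (top : pred Q) t : (t \in tops top) = top t.
Proof. by rewrite mem_filter mem_enum andbT. Qed.

(** * From each of the two cluster structures to an embedding *)

Section Finish.

Variables (Q : sgraph) (h : nat) (r : Q) (par : Q -> Q) (dp : Q -> nat) (col : Q -> bool)
  (W : {set Q}) (component : Q -> {set Q}) (top : pred Q) (k : nat).
Hypothesis dec : decomposition h r par dp col W component top.
Hypothesis cQ : #|Q| = k.+1.

Variables (V T : finType) (g : rel V) (C : V -> option T) (H : rel T) (s : nat).
Variables (part : T * bool -> {set V}) (e e0 K : nat).
Hypothesis gs : symmetric g.
Hypothesis girr : irreflexive g.
Hypothesis Hs : symmetric H.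
Hypothesis part_disjoint : forall p q x, x \in part p -> x \in part q -> p = q.
Hypothesis card_part : forall p, #|part p| = s %/ 2.
Hypothesis part_deg : forall x (D : {set T}), deg_in g x (span C D) <=
  \sum_(i in D) (deg_in g x (part (i, true)) + deg_in g x (part (i, false)) + 1).
Hypothesis Hfree : forall p q, H p.1 q.1 -> holefree g e0 h (part p) (part q).
Hypothesis e00 : 0 < e0.
Hypothesis eW : 3 * e0 + #|W| <= e.
Hypothesis he : h <= e.
Hypothesis hK : k + #|T| * (30 * e + 2) + s + 2 <= K.

Definition HPart (p q : T * bool) : bool := H p.1 q.1.
(** Rounding down to a multiple of [e] gives a lower bound shared by all vertices of one type, at a
    loss of less than [e] per part. *)
Definition rdeg (w : bool -> V) (b : bool) (p : T * bool) : nat :=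
  e * (deg_in g (w b) (part p) %/ e).

Variables (w : bool -> V) (S : bool -> {set V}).
Hypothesis cS : forall b, #|W| <= #|S b|.
Hypothesis gS : {in S true & S false, forall x y, g x y}.
Hypothesis Sw : forall b v p, v \in S b ->
  deg_in g v (part p) %/ e = deg_in g (w b) (part p) %/ e.

Lemma e_gt0 : 0 < e. Proof. by apply: leq_trans eW; lia. Qed.

Lemma rdeg_le b v p : v \in S b -> rdeg w b p <= deg_in g v (part p).
Proof. by move=> vS; rewrite /rdeg -(Sw p vS) mulnC leq_trunc_div. Qed.

Lemma rdeg_max b p : rdeg w b p <= s %/ 2.
Proof.
rewrite /rdeg -(card_part p) mulnC; apply: leq_trans (leq_trunc_div _ _) _.
exact: deg_in_le.
Qed.

Lemma HPart_sym : symmetric HPart.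
Proof. by move=> p q; rewrite /HPart Hs. Qed.

Lemma rdeg_span b (D : {set T}) : deg_in g (w b) (span C D) <=
  \sum_(i in D) (rdeg w b (i, true) + rdeg w b (i, false)) + #|T| * (2 * e + 1).
Proof.
apply: leq_trans (part_deg _ _) _.
have ht p : deg_in g (w b) (part p) <= rdeg w b p + e.
  rewrite /rdeg mulnC {1}(divn_eq (deg_in g (w b) (part p)) e) leq_add2l.
  by rewrite ltnW // ltn_mod e_gt0.
apply: (@leq_trans (\sum_(i in D) (rdeg w b (i, true) + rdeg w b (i, false) + (2 * e + 1)))).
  by apply: leq_sum => i _; have := ht (i, true); have := ht (i, false); lia.
by rewrite big_split /= sum_nat_const leq_add2l leq_mul2r max_card orbT.
Qed.

Lemma embed_sched (l : seq Q) : uniq l -> (forall t, top t = (t \in l)) ->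
  sched HPart (rdeg w) (s %/ 2) e (fun=> 0) (map (item par col component) l) ->
  exists2 f : Q -> V, injective f & forall x y, edge x y -> g (f x) (f y).
Proof.
move=> ul lE; apply: (embed_from_biclique dec ul lE gs girr part_disjoint card_part
  HPart_sym _ e00 eW cS gS); last by move=> b v p; apply: rdeg_le.
by move=> p q; apply: Hfree.
Qed.

Lemma finish_I (D : {set T}) : matched H D D ->
  (forall b, K <= deg_in g (w b) (span C D)) ->
  exists2 f : Q -> V, injective f & forall x y, edge x y -> g (f x) (f y).
Proof.
case=> F [Fi FH] hD; apply: (@embed_sched (tops top)).
- by rewrite filter_uniq // enum_uniq.
- by move=> t; rewrite mem_tops.
(* One half of a cluster is paired with the other half of its image; as F permutes D, every half of
   a cluster of D is used exactly once. *)
pose f (x : 'I_#|D| * bool) : T * bool :=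
  if x.2 then (enum_val x.1, true) else (F (enum_val x.1), false).
have fi : injective f.
  move=> [i b] [j b']; rewrite /f /=; case: b; case: b' => // -[].
    by move/enum_val_inj->.
  by move/(Fi _ _ (enum_valP i) (enum_valP j))/enum_val_inj->.
have fH i : HPart (f (i, true)) (f (i, false)).
  by rewrite /HPart /f /=; case: (FH _ (enum_valP i)).
apply: (sched_I (be := h) HPart_sym rdeg_max fi fH (k := k)).
- by move=> it; apply: dec_item dec.
- exact: dec_total dec cQ.
move=> b; rewrite card_ord; have := hD b; have := rdeg_span b D.
have -> : \sum_i psum f (rdeg w b) i =
    \sum_(i in D) (rdeg w b (i, true) + rdeg w b (i, false)).
  rewrite !big_split /=; congr (_ + _); first by rewrite [RHS]big_enum_val.
  have FD : F @: D = D.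
    apply/eqP; rewrite eqEcard card_in_imset // leqnn andbT.
    by apply/subsetP=> _ /imsetP[i iD ->]; case: (FH i iD).
  transitivity (\sum_(i in D) rdeg w b (F i, false)); first by rewrite [RHS]big_enum_val.
  by rewrite -[in RHS]FD big_imset.
have : #|D| * (2 * e + 2 * h) <= #|T| * (4 * e).
  by apply: leq_mul; [apply: max_card|move: he; clear; lia].
move: hK; rewrite !mulnDr; clear; lia.
Qed.

Lemma finish_II (y : bool) (L A B A' B' : {set T}) :
  2 * side_total y (map (item par col component) (tops top)) <= k ->
  [disjoint A & B] -> matched H A B -> K <= deg_in g (w (~~ y)) (span C A) ->
  [disjoint A' & B'] -> matched H A' B' -> #|B'| = #|A'| ->
  (forall i, i \in L -> K <= s * #|[set j | H i j]|) ->
  K <= 2 * deg_in g (w y) (span C (L :|: (A' :|: B'))) ->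
  exists2 f : Q -> V, injective f & forall x y, edge x y -> g (f x) (f y).
Proof.
move=> hy dAB [F [Fi FH]] hA dAB' [F' [Fi' FH']] cB hL hv.
set l := map _ _ in hy.
pose l1 := [seq t <- tops top | (item par col component t).1 == y].
pose l2 := [seq t <- tops top | (item par col component t).1 == ~~ y].
have utop : uniq (tops top) by rewrite filter_uniq // enum_uniq.
apply: (@embed_sched (l1 ++ l2)).
- rewrite cat_uniq; apply/and3P; split; [exact: filter_uniq| |exact: filter_uniq].
  apply/hasPn=> t; rewrite /l1 /l2 !(mem_filter _ t (tops top)).
  by case/andP=> /eqP-> _; case: (y).
- move=> t; rewrite /l1 /l2 mem_cat !(mem_filter _ t (tops top)) mem_tops.
  by case: (y); case: ((item par col component t).1); case: (top t).
have -> : map (item par col component) (l1 ++ l2) =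
    [seq it <- l | it.1 == y] ++ [seq it <- l | it.1 == ~~ y].
  by rewrite map_cat /l !filter_map.
(* The two sides of the matching are disjoint, so equal halves can be paired. *)
pose f0 (x : ('I_#|A'| * bool) * bool) : T * bool :=
  if x.2 then (enum_val x.1.1, x.1.2) else (F' (enum_val x.1.1), x.1.2).
pose f1 (x : ('I_#|A| * bool) * bool) : T * bool :=
  if x.2 then (enum_val x.1.1, x.1.2) else (F (enum_val x.1.1), x.1.2).
have f0i : injective f0.
  move=> [[i b] z] [[j b'] z']; rewrite /f0 /=; case: z; case: z' => /= -[].
  - by move=> /enum_val_inj-> ->.
  - move=> e' _; have [jB _] := FH' _ (enum_valP j).
    by have := disjointFr dAB' (enum_valP i); rewrite e' jB.
  - move=> e' _; have [jB _] := FH' _ (enum_valP i).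
    by have := disjointFr dAB' (enum_valP j); rewrite -e' jB.
  by move=> /(Fi' _ _ (enum_valP i) (enum_valP j))/enum_val_inj-> ->.
have f1i : injective f1.
  move=> [[i b] z] [[j b'] z']; rewrite /f1 /=; case: z; case: z' => /= -[].
  - by move=> /enum_val_inj-> ->.
  - move=> e' _; have [jB _] := FH _ (enum_valP j).
    by have := disjointFr dAB (enum_valP i); rewrite e' jB.
  - move=> e' _; have [jB _] := FH _ (enum_valP i).
    by have := disjointFr dAB (enum_valP j); rewrite -e' jB.
  by move=> /(Fi _ _ (enum_valP i) (enum_valP j))/enum_val_inj-> ->.
have f0H i : HPart (f0 (i, true)) (f0 (i, false)).
  by rewrite /HPart /f0 /=; case: (FH' _ (enum_valP i.1)).
have f1H i : HPart (f1 (i, true)) (f1 (i, false)).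
  by rewrite /HPart /f1 /=; case: (FH _ (enum_valP i.1)).
have FB : F' @: A' = B'.
  apply/eqP; rewrite eqEcard card_in_imset // cB leqnn andbT.
  by apply/subsetP=> _ /imsetP[i iD ->]; case: (FH' i iD).
(* Clusters of the matching are excluded here so that no capacity is counted twice. *)
pose LP : {set T * bool} := [set p | p.1 \in L :\: (A' :|: B')].
pose R b i := rdeg w b (i, true) + rdeg w b (i, false).
have sum2 (X : {set T}) b : \sum_(x : 'I_#|X| * bool) rdeg w b (enum_val x.1, x.2) =
    \sum_(i in X) R b i.
  rewrite -(pair_bigA _ (fun (i : 'I_#|X|) z => rdeg w b (enum_val i, z))) /=.
  by rewrite [RHS]big_enum_val; apply: eq_bigr => i _; rewrite big_bool.
have cTb : #|{: T * bool}| = 2 * #|T| by rewrite card_prod card_bool mulnC.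
have cJ (X : {set T}) : #|{: 'I_#|X| * bool}| <= 2 * #|T|.
  by rewrite card_prod card_bool card_ord mulnC leq_mul2l max_card orbT.
have s1 : \sum_i psum f0 (rdeg w y) i = \sum_(i in A' :|: B') R y i.
  rewrite big_split /=; transitivity (\sum_(i in A') R y i + \sum_(i in B') R y i).
    congr (_ + _); first exact: sum2.
    rewrite -[in RHS]FB big_imset //= [RHS]big_enum_val.
    rewrite -(pair_bigA _ (fun (i : 'I_#|A'|) z => rdeg w y (F' (enum_val i), z))) /=.
    by apply: eq_bigr => i _; rewrite big_bool.
  by rewrite -bigU //=; apply: eq_bigl => i; rewrite !inE.
have s2 : \sum_(p in LP) rdeg w y p = \sum_(i in L :\: (A' :|: B')) R y i.
  rewrite (eq_bigl (fun p => (p.1 \in L :\: (A' :|: B')) && true)); last first.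
    by move=> p; rewrite inE andbT.
  rewrite (eq_bigr (fun p => rdeg w y (p.1, p.2))); last by case.
  rewrite -(pair_big_dep (fun i => i \in L :\: (A' :|: B')) (fun _ _ => true) (fun i z => rdeg w y (i, z))) /=.
  by apply: eq_bigr => i _; rewrite big_bool.
have s3 : \sum_i rdeg w (~~ y) (f1 (i, true)) = \sum_(i in A) R (~~ y) i by exact: sum2.
have eh : 2 * e + 2 * h <= 4 * e by move: he; clear; lia.
have t1 : #|{: 'I_#|A'| * bool}| * (2 * e + 2 * h) <= 2 * #|T| * (4 * e) by apply: leq_mul.
have t2 : #|{: 'I_#|A| * bool}| * e <= 2 * #|T| * e by rewrite leq_mul2r cJ orbT.
have hK' : k + 30 * (#|T| * e) + 2 * #|T| + s + 2 <= K.
  by move: hK; rewrite mulnDr; clear; lia.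
apply: (sched_II (be := h) (k := k) (LP := LP) HPart_sym rdeg_max f0i f0H f1i f1H).
- by move=> it; apply: dec_item dec.
- exact: dec_total dec cQ.
- exact: hy.
- move=> [i b]; rewrite inE /= => /setDP[iL _].
  have -> : #|[set q | HPart (i, b) q]| = 2 * #|[set j | H i j]|.
    rewrite -card_bool mulnC -cardsT -cardsX.
    by apply: eq_card => -[j b']; rewrite !inE /HPart andbT.
  rewrite cTb; have := hL i iL; have := max_card [set j | H i j].
  have s2e : s <= 2 * (s %/ 2) + 1 by lia.
  set a := #|[set j | H i j]| => ha hsa; have := leq_mul s2e (leqnn a).
  by move: (s %/ 2) hsa hK' ha; clear; nia.
- move=> [i b]; rewrite inE /= => /setDP[_ iN]; apply: contra iN.
  case/codomP=> -[[j b'] z]; rewrite /f0 /=; case: z => /= -[-> _].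
    by rewrite inE enum_valP.
  by rewrite inE; have [-> _] := FH' _ (enum_valP j); rewrite orbT.
- rewrite s3; have := rdeg_span (~~ y) A; rewrite -/(R _ _) => hs.
  have := leq_trans hA hs; move: t2 hK'; rewrite mulnDr.
  set u := \sum_(i in A) _; set v := _ * e; clear; lia.
rewrite s1 s2 cTb; have := rdeg_span y (L :|: (A' :|: B')).
have -> : \sum_(i in L :|: (A' :|: B')) (rdeg w y (i, true) + rdeg w y (i, false)) =
    \sum_(i in A' :|: B') R y i + \sum_(i in L :\: (A' :|: B')) R y i.
  rewrite (big_setID (A' :|: B')) /= (setIidPr _) ?subsetUr //; congr (_ + _).
  set U := A' :|: B'; apply: eq_bigl => i.
  by rewrite !in_setD [i \in L :|: U]in_setU; case: (i \in U); rewrite ?orbF.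
move: (\sum_(i in A' :|: B') _) (\sum_(i in _ :\: _) _) => u v.
have -> : #|T| * (2 * e + 1) = 2 * (#|T| * e) + #|T| by rewrite mulnDr muln1; lia.
have -> : 2 * #|T| * e = 2 * (#|T| * e) by rewrite mulnA.
have t1' : #|{: 'I_#|A'| * bool}| * (2 * e + 2 * h) <= 8 * (#|T| * e).
  by apply: leq_trans t1 _; rewrite !mulnA; lia.
move: t1' hv hK'; move: (_ * (2 * e + 2 * h)) (deg_in _ _ _) (#|T| * e) #|T|.
by clear; lia.
Qed.

End Finish.

(** * The main argument *)

(** Otherwise all edges at [big] end outside [L]. There are at most |big| vertices outside [L], and
    their degrees are smaller by 3 del, which contradicts double counting as [Bad] is too small to
    make up for it. *)
Lemma exists_heavy_edge (V : finType) (g' : rel V) (big L Bad : {set V}) (k del : nat) :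
  symmetric g' -> 0 < del -> 20 * #|Bad| <= del -> 7 * del <= #|V| -> k <= #|V| ->
  #|V| <= 2 * #|big| -> big \subset L ->
  (forall x, x \in big -> x \notin Bad -> k + 7 * del <= deg_in g' x setT) ->
  (forall x, x \notin L -> deg_in g' x setT <= k + 4 * del) ->
  exists x y, [/\ x \in L, y \in L & g' x y].
Proof.
move=> gs d0 hB h7 hk hbig sL hhi hlo.
case: (boolP [exists x in L, exists y in L, g' x y]) => [|no].
  by case/exists_inP=> x xL /exists_inP[y yL gxy]; exists x, y.
exfalso; pose B1 := big :\: Bad.
have h1 : #|B1| * (k + 7 * del) <= \sum_(x in B1) deg_in g' x (~: L).
  rewrite -sum_nat_const; apply: leq_sum => x /setDP[xb xB].
  apply: leq_trans (hhi x xb xB) _; apply/subset_leq_card/subsetP=> y.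
  rewrite !inE /= => gxy; rewrite gxy andbT; apply: contra no => yL.
  by apply/exists_inP; exists x; [exact: (subsetP sL)|apply/exists_inP; exists y].
have h2 : \sum_(x in B1) deg_in g' x (~: L) <= #|~: L| * (k + 4 * del).
  rewrite double_count // -sum_nat_const; apply: leq_sum => y; rewrite inE => yL.
  by apply: leq_trans (deg_inS _ _ (subsetT _)) (hlo y yL).
have h3 : #|~: L| <= #|big|.
  by have := cardsC L; have := subset_leq_card sL; move: hbig; clear; lia.
have h4 : #|big| <= #|B1| + #|Bad|.
  rewrite -(cardsID Bad big) addnC leq_add2l; apply/subset_leq_card/subsetIr.
move: (leq_trans h1 h2) h3 h4 hbig hk h7 hB d0.
move: #|B1| #|~: L| #|big| #|Bad| #|V| => B l bg b n; clear.
move=> h1 h3 h4 h5 h6 h7 h8 d0.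
have h9 : bg * (k + 7 * del) <= bg * (k + 4 * del) + b * (k + 7 * del).
  have := leq_mul h4 (leqnn (k + 7 * del)); have := leq_mul h3 (leqnn (k + 4 * del)).
  by rewrite mulnDl; move: h1; lia.
have h10 : b * (k + 7 * del) <= b * (4 * bg) by apply: leq_mul => //; lia.
have : bg * (3 * del) <= bg * (4 * b) by rewrite !mulnDr in h9 h10 *; lia.
have : 0 < bg by lia.
by move=> bg0; rewrite leq_pmul2l //; lia.
Qed.

(** This is the hypothesis [small_err] of [structure] for K = k + 3 del and K - K' = del. *)
Lemma small_error (n k del F b gam : nat) :
  0 < F -> k <= n -> 3 * del <= n -> n <= F * del -> (b + gam) * (10 * F) <= del ->
  4 * (k + 3 * del) * (b + gam) + (2 * b + gam) * del <= del * del.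
Proof.
move=> F0 hk h3 hF hb.
have h1 : (k + 3 * del) * (b + gam) <= (2 * (F * del)) * (b + gam).
  by apply: leq_mul => //; lia.
have h2 : (2 * b + gam) * del <= (F * del) * (2 * (b + gam)).
  rewrite mulnC; apply: leq_mul; last by lia.
  by rewrite leq_pmull.
have h3' := leq_mul (leqnn del) hb.
have -> : 4 * (k + 3 * del) * (b + gam) = 4 * ((k + 3 * del) * (b + gam)) by rewrite mulnA.
have e : del * ((b + gam) * (10 * F)) = 10 * (F * del * (b + gam)).
  by rewrite [del * _]mulnC -!mulnA; lia.
rewrite e in h3'; move: h1 h2 h3'.
rewrite -[2 * (F * del) * _]mulnA [F * del * (2 * _)]mulnCA.
move: (F * del * (b + gam)) ((k + 3 * del) * (b + gam)) ((2 * b + gam) * del).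
by clear; lia.
Qed.

(** [del] is the unit in which slack is measured. From 8 E^2 del <= n <= E k follows 8 E del <= k,
    so degree (1 + 1/E)k exceeds k by eight units. *)
Lemma unit_of_slack (E F k n : nat) : let del := n %/ (8 * E ^ 2) in
  0 < E -> F = 16 * E ^ 2 -> 8 * E ^ 2 <= n -> n <= E * k ->
  [/\ 0 < del, n <= F * del, 8 * del <= n & E * (k + 8 * del) <= E.+1 * k].
Proof.
move=> del E0 FE hn hk.
have EE : 0 < 8 * E ^ 2 by rewrite muln_gt0 expn_gt0 E0.
have d0 : 0 < del by rewrite divn_gt0.
have h1 := leq_trunc_div n (8 * E ^ 2); rewrite -/del in h1.
have h2 : n < del.+1 * (8 * E ^ 2) by rewrite -ltn_divLR.
have E2 : E <= E ^ 2 by rewrite -{1}(expn1 E) leq_pexp2l.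
split=> //.
- rewrite FE; apply: leq_trans (ltnW h2) _; apply: (@leq_trans (2 * del * (8 * E ^ 2))).
    by rewrite leq_mul2r; apply/orP; right; lia.
  by rewrite mulnC mulnA -(mulnA 8) (mulnC (E ^ 2)); lia.
- apply: leq_trans h1; rewrite mulnC leq_mul2l; apply/orP; right.
  by rewrite leq_pmulr // expn_gt0 E0.
rewrite mulnDr mulSn addnC leq_add2r -(@leq_pmul2l E) //.
apply: leq_trans hk; apply: leq_trans h1; rewrite -mulnn; lia.
Qed.

(** All losses of the scheduling fit into two units of slack: those proportional to s are small
    because E5 is much larger than F, and the others depend only on N and M. *)
Lemma errors_small (n del F E5 N M s T k : nat) :
  let e := 3 * (s %/ E5).+1 + M in
  16 <= F -> E5 = 400 * F ^ 3 -> n <= F * del -> E5 * s <= n -> T * s <= n -> T <= N ->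
  4 * (N * (92 + 30 * M) + 2) <= del ->
  k + T * (30 * e + 2) + s + 2 <= k + 2 * del.
Proof.
move=> e F16 E5E nF sE Ts TN hd.
have F0 : 0 < F by lia.
have F3 : F <= F ^ 3 by rewrite -{1}(expn1 F) leq_pexp2l.
have h400 : 400 * F <= E5 by rewrite E5E leq_mul2l F3 orbT.
have h1 : E5 * (T * (s %/ E5)) <= n.
  apply: leq_trans Ts; rewrite mulnCA leq_mul2l; apply/orP; right.
  by rewrite mulnC leq_trunc_div.
have small x : E5 * x <= n -> 400 * x <= del.
  move=> hx; rewrite -(@leq_pmul2l F) //; apply: leq_trans nF; apply: leq_trans hx.
  by rewrite mulnA (mulnC F) leq_mul2r h400 orbT.
have h2 := small _ h1; have h3 := small _ sE.
have h4 : T * (92 + 30 * M) <= N * (92 + 30 * M) by rewrite leq_mul2r TN orbT.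
have -> : T * (30 * e + 2) = 90 * (T * (s %/ E5)) + T * (92 + 30 * M).
  by rewrite /e; move: (s %/ E5) => x; clear; lia.
by move: h2 h3 h4 hd; move: (T * (s %/ E5)) (T * (92 + _)) (N * _); clear; lia.
Qed.

Lemma garbage_small (n del F E5 b gam : nat) :
  16 <= F -> E5 = 400 * F ^ 3 -> 0 < del -> n <= F * del ->
  E5 * (del * b) <= 20 * n ^ 2 -> E5 * gam <= n -> (b + gam) * (10 * F) <= del.
Proof.
move=> F16 E5E d0 nF hb hg; have F0 : 0 < F by lia.
have F2 : 0 < F ^ 2 by rewrite expn_gt0 F0.
have n2 : n ^ 2 <= F ^ 2 * del ^ 2 by rewrite -expnMn leq_exp2r.
have hb' : 20 * F * b <= del.
  have p : 0 < 20 * F ^ 2 * del by rewrite !muln_gt0 ?F2 ?F0 d0.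
  rewrite -(leq_pmul2l p); apply: leq_trans (_ : 20 * (F ^ 2 * del ^ 2) <= _); last first.
    by rewrite -mulnn; lia.
  apply: leq_trans (leq_mul (leqnn 20) n2); apply: leq_trans hb.
  by rewrite E5E (expnS F 2); lia.
have hg' : 20 * F * gam <= del.
  rewrite -(leq_pmul2l F0); apply: leq_trans nF; apply: leq_trans hg.
  rewrite E5E (expnS F 2) -mulnn mulnA leq_mul2r; apply/orP; right.
  have : F * F <= F * (F * F) by rewrite leq_pmull.
  by lia.
have -> : (b + gam) * (10 * F) = 10 * F * b + 10 * F * gam by lia.
move: hb' hg'; rewrite -!mulnA; move: (F * b) (F * gam); clear; lia.
Qed.

Lemma holefree_of_not_holey (V : finType) (g : rel V) (E s h : nat) (A B A' B' : {set V}) :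
  A' \subset A -> B' \subset B -> ~~ holey g E s h A B -> 0 < E ->
  holefree g (s %/ E).+1 h A' B'.
Proof.
move=> sA sB nh E0 X Y sX sY cX cY.
have big Z : s %/ E < Z -> s <= E * Z.
  by rewrite ltn_divLR // mulnC => /ltnW.
case: (boolP [exists x in X, h <= deg_in g x Y]) => [/exists_inP[x ? ?]|no]; first by exists x.
case/negP: nh; apply/existsP; exists X; apply/existsP; exists Y.
rewrite (subset_trans sX sA) (subset_trans sY sB) !big //=; apply/forall_inP=> x xX.
by rewrite ltnNge; apply: contra no => hx; apply/exists_inP; exists x.
Qed.

(** Edges are deleted that lie outside the cluster pairs without holes or between sparse types. Both
    conditions are symmetrised, because [holey] is not symmetric and holes must be excluded in both
    directions. *)
Lemma clean_graph (V T Y : finType) (g : rel V) (C : V -> option T) (ty : V -> Y)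
    (E s h del D : nat) :
  symmetric g -> 0 < #|V| -> #|Y| ^ 2 * E <= D ->
  E * #|bad_pairs g C E s h| <= 4 * #|V| ^ 2 ->
  exists (g' : rel V) (Bad : {set V}), [/\ symmetric g',
    forall x y, g' x y -> [/\ g x y, x \notin Bad &
      exists i j, [/\ C x = Some i, C y = Some j,
        ~~ holey g E s h (cell C i) (cell C j) & ~~ holey g E s h (cell C j) (cell C i)]],
    forall x y, g' x y -> #|V| * #|V| <= D *
      \sum_(z in [set z | ty z == ty x]) deg_in g z [set z | ty z == ty y],
    E * (del * #|Bad|) <= 20 * #|V| ^ 2 &
    forall x, x \notin Bad ->
      2 * deg_in g x setT <= 2 * deg_in g' x setT + del + 2 * #|Bad|].
Proof.
move=> gs n0 hD hbad.
pose sparse a b := D * \sum_(x in [set x | ty x == a]) deg_in g x [set y | ty y == b]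
  < #|V| ^ 2.
pose R0 x y := ((x, y) \in bad_pairs g C E s h) || sparse (ty x) (ty y).
pose R x y := R0 x y || R0 y x.
have Rs : symmetric R by move=> x y; rewrite /R orbC.
have [g' [Bad [g's g'P cBad g'd]]] := cleanup del gs Rs.
exists g', Bad; split=> // [x y gxy|x y gxy|].
- have [gg nR xB] := g'P x y gxy; split=> //.
  have gg' : g y x by rewrite gs.
  move: nR; rewrite /R /R0 !negb_or !in_set /= gg gg' /=.
  case Cx: (C x) => [i|]; case Cy: (C y) => [j|] //=.
  by case/andP=> /andP[h1 _] /andP[h2 _]; exists i, j.
- have [gg nR _] := g'P x y gxy; move: nR; rewrite /R /R0 !negb_or /sparse -leqNgt.
  by rewrite mulnn; case/andP=> /andP[].
pose A := bad_pairs g C E s h.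
pose B := [set p : V * V | g p.1 p.2 && sparse (ty p.1) (ty p.2)].
pose sw (p : V * V) := (p.2, p.1).
have swi : injective sw by move=> [x y] [x' y'] [-> ->].
have sR : [set p : V * V | g p.1 p.2 && R p.1 p.2] \subset
    (A :|: B) :|: (sw @: (A :|: B)).
  apply/subsetP=> -[x y]; rewrite in_set /= /R /R0 => /andP[gxy] /orP[] h0.
    rewrite in_setU; apply/orP; left; rewrite in_setU; case/orP: h0 => [->//|h0].
    by rewrite [_ \in B]in_set /= gxy h0 orbT.
  rewrite in_setU; apply/orP; right; apply/imsetP; exists (y, x) => //.
  rewrite in_setU; case/orP: h0 => [->//|h0].
  by rewrite [_ \in B]in_set /= gs gxy h0 orbT.
have cB : E * #|B| <= #|V| ^ 2 := card_sparse_pairs g ty n0 hD.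
have cR : #|[set p : V * V | g p.1 p.2 && R p.1 p.2]| <= 2 * (#|A| + #|B|).
  apply: leq_trans (subset_leq_card sR) _; apply: leq_trans (leq_card_setU _ _).1 _.
  by rewrite card_imset // mul2n -addnn leq_add // (leq_card_setU _ _).1.
apply: leq_trans (leq_mul (leqnn E) (leq_trans cBad (leq_mul (leqnn 2) cR))) _.
(* One factor 2 comes from [cleanup], the other from symmetrising; with the bounds 4 |V|^2 and |V|^2
   this gives 4(4 + 1) = 20. *)
have -> : E * (2 * (2 * (#|A| + #|B|))) = 4 * (E * #|A|) + 4 * (E * #|B|).
  by move: #|A| #|B|; clear; lia.
by move: hbad cB; rewrite -/A; move: (#|V| ^ 2) (E * #|A|) (E * #|B|); clear; lia.
Qed.

Lemma card_biclique_sides (V Y : finType) (g : rel V) (ty : V -> Y) (D M nb : nat) u v :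
  (forall (V : finType) (g : rel V) (A B : {set V}), symmetric g -> nb <= #|V| ->
     #|V| * #|V| <= D * \sum_(x in A) deg_in g x B ->
     exists S T : {set V}, [/\ S \subset A, T \subset B, #|S| = M, #|T| = M &
       {in S & T, forall x y, g x y}]) ->
  symmetric g -> nb <= #|V| ->
  #|V| * #|V| <= D * \sum_(z in [set z | ty z == ty u]) deg_in g z [set z | ty z == ty v] ->
  exists S : bool -> {set V}, [/\ forall b, #|S b| = M,
    forall b x, x \in S b -> ty x = ty (if b then u else v) &
    {in S true & S false, forall x y, g x y}].
Proof.
move=> hb gs nV hd; have [S [T [sS sT cS cT gST]]] := hb V g _ _ gs nV hd.
exists (fun b => if b then S else T); split=> // -[] // x.
  by move/(subsetP sS); rewrite inE => /eqP.
by move/(subsetP sT); rewrite inE => /eqP.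
Qed.

Lemma side_total_add y l : side_total y l + side_total (~~ y) l = total l.
Proof.
rewrite /side_total /total !big_filter [RHS](bigID (fun it => it.1 == y)) /=.
by congr (_ + _); apply: eq_bigl => -[[] ?]; case: y.
Qed.

Lemma pieces_bound (n k a : nat) : k <= n -> 0 < n -> 0 < a -> 0 < n %/ a ->
  k.+1 %/ (n %/ a) <= 4 * a.
Proof.
move=> kn n0 a0 h0; have hh : n < (n %/ a).+1 * a by rewrite -ltn_divLR.
rewrite -(@leq_pmul2r (n %/ a)) //; apply: leq_trans (leq_trunc_div _ _) _.
move: hh h0; set h := n %/ a => hh h0.
have : h.+1 * a <= (2 * h) * a by rewrite leq_mul2r; apply/orP; right; lia.
by rewrite -mulnA (mulnC h a) -mulnA; move: (a * h) hh kn n0; clear; lia.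
Qed.

Lemma lks_nat (E c : nat) : 0 < E -> exists n0, forall (G : sgraph) (k : nat),
  n0 <= #|G| -> #|G| <= E * k ->
  #|G| <= 2 * #|[set x : G | E.+1 * k <= E * degree x]| ->
  forall Q : sgraph, connected Q -> bipartite Q -> #|Q| = k.+1 -> #|edges Q| <= k + c ->
  subgraph Q G.
Proof.
move=> E0.
(* F is chosen with n <= F del, and E5 so large that bad and unassigned vertices are few compared
   with del / F. *)
have [F FE] : exists x, x = 16 * E ^ 2 by eexists.
have [E5 E5E] : exists x, x = 400 * F ^ 3 by eexists.
have F16 : 16 <= F by rewrite FE leq_pmulr // expn_gt0 E0.
have E50 : 0 < E5 by rewrite E5E muln_gt0 expn_gt0 (leq_trans _ F16).
(* The two initial classes are the vertices of large and of small degree, so no cluster mixes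
   them. *)
have [N hN] := regularity 2 E50.
(* 4 N E5 bounds (k + 1) / h and 2c + 1 the prescribed seeds; [M] then bounds the number of all
   seeds. *)
have [tau tauE] : exists x, x = 4 * N * E5 + (2 * c + 1) by eexists.
have [M ME] : exists x, x = 2 * (tau.+1 * tau * (2 + tau)) by eexists.
(* A type gives one of E5 + 1 values to each of at most 2N half clusters. *)
have [D DE] : exists x, x = (E5.+1 ^ (2 * N)) ^ 2 * E5 by eexists.
have D0 : 0 < D by rewrite DE muln_gt0 !expn_gt0 E50.
have [nb hnb] := biclique M D0.
exists ((8 * E ^ 2) * (4 * (N * (92 + 30 * M) + 2)).+1 + N + nb + N * E5) => G k hn hk hbig Q conn bip cQ cE.
set n := #|G| in hn hk hbig.
have EE : 0 < 8 * E ^ 2 by rewrite muln_gt0 expn_gt0 E0.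
pose del := n %/ (8 * E ^ 2).
have hdel : 4 * (N * (92 + 30 * M) + 2) <= del.
  rewrite leq_divRL // mulnC; apply: leq_trans hn; rewrite -!addnA.
  by apply: leq_trans (leq_addr _ _); rewrite leq_mul2l leqnSn orbT.
have hn8 : 8 * E ^ 2 <= n.
  apply: leq_trans hn; rewrite -!addnA; apply: leq_trans (leq_addr _ _).
  by rewrite leq_pmulr.
have nN : N <= n by apply: leq_trans hn; move: (_ * _.+1) (N * E5); clear; lia.
have nnb : nb <= n by apply: leq_trans hn; move: (_ * _.+1) (N * E5); clear; lia.
have nNE : N * E5 <= n by apply: leq_trans hn; apply: leq_addl.
have [d0 nF h8 hEk] := @unit_of_slack E F k n E0 FE hn8 hk.
rewrite -/del in d0 nF h8 hEk.
have npos : 0 < n by apply: leq_trans EE hn8.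
pose g : rel G := @edge G.
have gs : symmetric g := @edge_sym G.
have degE (x : G) : deg_in g x setT = degree x.
  by apply: eq_card => y; rewrite !inE.
set big := [set x | _] in hbig.
have bigP x : x \in big -> k + 8 * del <= degree x.
  by rewrite inE => hx; rewrite -(@leq_pmul2l E) // (leq_trans hEk).
have kn : k <= n.
  have /card_gt0P[x xb] : 0 < #|big|.
    by rewrite lt0n; apply/eqP=> b0; move: hbig npos; rewrite b0 muln0 leqn0 => /eqP ->.
  by apply: leq_trans (leq_addr _ _) (leq_trans (bigP x xb) (max_card _)).
(* The threshold lies midway between k and the degrees in [big]: the gap above it forces an edge
   between large vertices, the gap below absorbs the losses. *)
pose Lv := [set x : G | k + 4 * del <= degree x].
have sbig : big \subset Lv.
  apply/subsetP=> x /bigP hx; rewrite inE; apply: leq_trans hx.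
  by rewrite leq_add2l leq_mul2r orbT.
have N0 : 0 < N.
  rewrite lt0n; apply/eqP=> Nz.
  have [T [C [s [[_ _ hh _] _]]]] := hN G g 1 _ (fun x => x \in Lv) gs nN npos isT (eq_leq card_bool).
  by move: hh npos; rewrite -/n Nz mul0n leqn0 => /eqP ->.
have NE0 : 0 < N * E5 by rewrite muln_gt0 N0 E50.
(* This keeps the n N h edges in dead pairs below n^2 / E5. *)
pose h := n %/ (N * E5).
have h0 : 0 < h by rewrite divn_gt0.
have [T [C [s [[s0 cT nNs Es] [cs homL cgarb cbad]]]]] :=
  hN G g h _ (fun x => x \in Lv) gs nN npos h0 (eq_leq card_bool).
rewrite -/n in nNs Es cgarb cbad.
have hNh : E5 * (n * N * h) <= n ^ 2.
  have := leq_trunc_div n (N * E5); rewrite -/h -mulnn => hh.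
  apply: leq_trans (leq_mul (leqnn n) hh); rewrite mulnCA -!mulnA leq_mul2l.
  by apply/orP; right; rewrite mulnCA mulnA (mulnC _ h) mulnA mulnC mulnA; clear; lia.
have hT : #|T| * s <= n.
  rewrite mulnC -cardsT -(card_span cs); exact: max_card.
have [part [pdisj pcard psub pdeg]] := halve_cells cs.
pose e0 := (s %/ E5).+1; pose e := 3 * e0 + M.
have he0 : s < E5 * e0 by rewrite mulnC -ltn_divLR.
have hh_e : h <= e.
  apply: (@leq_trans e0); last by rewrite /e; clear; lia.
  apply: leqW; apply: (@leq_trans ((N * s) %/ (N * E5))); first exact: leq_div2r.
  by rewrite divnMl.
have e_pos : 0 < e by rewrite /e addn_gt0 muln_gt0.
have degdiv x p : deg_in g x (part p) %/ e < E5.+1.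
  rewrite ltnS -ltnS ltn_divLR //; apply: leq_ltn_trans (deg_in_le _ _ _) _.
  rewrite pcard; apply: leq_ltn_trans (leq_div _ _) _; apply: leq_trans he0 _.
  by apply: leq_mul => //; apply: leq_trans (leq_addr _ _); rewrite leq_pmull.
pose ty (x : G) : {ffun T * bool -> 'I_E5.+1} :=
  [ffun p => inord (deg_in g x (part p) %/ e)].
have tyP x y : ty x = ty y -> forall p,
    deg_in g x (part p) %/ e = deg_in g y (part p) %/ e.
  move=> exy p; have /(congr1 val) := congr1 (fun f : {ffun _} => f p) exy.
  by rewrite /= !ffunE !inordK.
have cty : #|{ffun T * bool -> 'I_E5.+1}| ^ 2 * E5 <= D.
  rewrite card_ffun card_ord card_prod card_bool DE leq_mul2r; apply/orP; right.
  rewrite leq_exp2r // leq_pexp2l // mulnC leq_mul2l cT orbT //.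
have cbad4 : E5 * #|bad_pairs g C E5 s h| <= 4 * n ^ 2.
  by move: cbad hNh; move: (E5 * #|_|) (E5 * (n * N * h)) (n ^ 2); clear; lia.
have [g' [Bad [g's g'P g'ty cBad g'd]]] :=
  @clean_graph _ _ _ g C ty E5 s h del D gs npos cty cbad4.
rewrite -/n in cBad g'ty.
have hsmall := garbage_small F16 E5E d0 nF cBad cgarb.
set gam := #|[set x | C x == None]| in cgarb hsmall.
have cB20 : 20 * #|Bad| <= del.
  apply: leq_trans hsmall; rewrite mulnC; apply: leq_mul; first exact: leq_addr.
  by move: F16; clear; lia.
have g'deg x : x \notin Bad -> degree x <= deg_in g' x setT + del.
  by move=> /g'd; rewrite degE; move: cB20; clear; lia.
have g'le x (A : {set G}) : deg_in g' x A <= deg_in g x A.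
  apply/subset_leq_card/subsetP=> y; rewrite !inE => /andP[-> gxy].
  by have [] := g'P x y gxy.
pose L : {set T} := [set i | [exists x in Lv, C x == Some i]].
have LP x i : C x = Some i -> (i \in L) = (x \in Lv).
  move=> Cx; rewrite inE; apply/exists_inP/idP => [[y yL /eqP Cy]|xL].
    by rewrite (homL x y) ?Cx ?Cy.
  by exists x; rewrite ?Cx.
have heavy : exists x y, [/\ x \in Lv, y \in Lv & g' x y].
  apply: (@exists_heavy_edge _ g' big Lv Bad k del) => //.
  - by apply: leq_trans h8; rewrite leq_mul2r orbT.
  - by move=> x /bigP xb /g'deg; move: xb; clear; lia.
  move=> x; rewrite inE -ltnNge => /ltnW hx; apply: leq_trans hx; rewrite -degE.
  exact: g'le.
(* Dropping edges between vertices of small degree makes the small clusters independent in [H] and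
   leaves the degrees of large vertices unchanged. *)
pose gL x y := g' x y && ((x \in Lv) || (y \in Lv)).
have gLs : symmetric gL by move=> x y; rewrite /gL g's orbC.
have gLg x y : gL x y -> g' x y by case/andP.
have gLle x (A : {set G}) : deg_in gL x A <= deg_in g x A.
  apply: leq_trans (g'le x A); apply/subset_leq_card/subsetP=> y.
  by rewrite !inE => /andP[-> /gLg].
pose H i j := [exists x, exists y, [&& C x == Some i, C y == Some j & gL x y]].
have HE i j : reflect (exists x y, [/\ C x = Some i, C y = Some j & gL x y]) (H i j).
  apply: (iffP existsP) => [[x /existsP[y /and3P[/eqP ? /eqP ? ?]]]|[x [y [Cx Cy gxy]]]].
    by exists x, y.
  by exists x; apply/existsP; exists y; rewrite Cx Cy !eqxx.
have Hs : symmetric H.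
  by move=> i j; apply/HE/HE => -[x [y [? ? ?]]]; exists y, x; split=> //; rewrite gLs.
have gLC x y : gL x y -> C x != None.
  by case/gLg/g'P => _ _ [i [j [-> _ _ _]]].
have degL x : x \in Lv -> x \notin Bad -> k + 3 * del <= deg_in gL x setT.
  move=> xL xB; have -> : deg_in gL x setT = deg_in g' x setT.
    by apply: eq_card => y; rewrite !inE /gL; move: xL; rewrite inE => ->; rewrite andbT.
  by have := g'deg x xB; move: xL; rewrite inE; clear; lia.
have degLi x y i : C x = Some i -> i \in L -> gL x y -> k + 3 * del <= deg_in gL x setT.
  move=> Cx iL /gLg /g'P[_ xB _]; apply: degL => //.
  by rewrite -(LP x i Cx).
(* Large vertices keep degree k + 3 del unless they are in [Bad], small ones exceed this by at most
   del, and k + 2 del is what the scheduling needs. *)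
have st : caseI gL C H (k + 2 * del) \/ caseII gL C H L (k + 2 * del).
  have eK : k + 3 * del - (k + 2 * del) = del by clear; lia.
  apply: (@structure _ _ gL C H L s (k + 3 * del) (k + 2 * del) del gam #|Bad|) => //.
  - move=> i j iL jL; apply/HE=> -[x [y [Cx Cy /andP[_]]]].
    by rewrite -(LP x i Cx) -(LP y j Cy) (negPf iL) (negPf jL).
  - move=> x i Cx; rewrite (LP x i Cx) inE -ltnNge => /ltnW hx.
    apply: leq_trans (gLle x setT) _; rewrite degE; apply: leq_trans hx _.
    by clear; lia.
  - rewrite -!(card_span cs).
    have h1 : #|span C (~: L)| <= #|~: Lv|.
      apply/subset_leq_card/subsetP=> x /spanP[i iL Cx].
      by rewrite inE -(LP x i Cx); rewrite inE in iL.
    have h2 : #|Lv| <= #|span C L| + gam.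
      apply: leq_trans (leq_card_setU _ _).1; apply/subset_leq_card/subsetP=> x xL.
      rewrite in_setU [x \in [set _ | _]]in_set.
      case Cx: (C x) => [i|]; rewrite ?orbT //; apply/orP; left; apply/spanP.
      by exists i; rewrite // (LP x i Cx).
    apply: leq_trans h2; apply: leq_trans h1 _.
    rewrite -(leq_add2l #|Lv|) cardsC addnn -mul2n; apply: leq_trans hbig _.
    by rewrite leq_mul2l subset_leq_card.
  - have [x [y [xL yL gxy]]] := heavy; have [_ _ [i [j [Cx Cy _ _]]]] := g'P x y gxy.
    exists i, j; rewrite (LP x i Cx) (LP y j Cy); split=> //; apply/HE; exists x, y.
    by split=> //; rewrite /gL gxy xL.
  - apply/subset_leq_card/subsetP=> x; rewrite in_set => /andP[/spanP[i iL Cx] /eqP dx].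
    apply: contraTT iL => xB; rewrite (LP x i Cx); apply/negP=> xL.
    have := degL x xL xB; rewrite dx leqn0; move: d0; clear; lia.
  - by rewrite leq_add2l leq_mul2r orbT.
  - by rewrite eK.
  - by clear; lia.
  - rewrite eK; apply: (@small_error n k del F) => //.
      by move: F16; clear; lia.
    by apply: leq_trans h8; rewrite leq_mul2r orbT.
  by rewrite eK.
have [r [par [dp [col [W [component [top [dec cW]]]]]]]] : exists r par dp col W component top,
    @decomposition Q h r par dp col W component top /\ #|W| <= M.
  rewrite ME; apply: (decompose conn bip cQ cE h0); rewrite tauE leq_add2r.
  by rewrite -mulnA; exact: pieces_bound kn npos NE0 h0.
have eW : 3 * e0 + #|W| <= e by rewrite /e leq_add2l.
have Hfree p q : H p.1 q.1 -> holefree g e0 h (part p) (part q).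
  case/HE=> x [y [Cx Cy /gLg/g'P[_ _ [i [j [Cx' Cy' nh _]]]]]].
  move: Cx' Cy' nh; rewrite Cx Cy => -[<-] [<-] nh.
  exact: holefree_of_not_holey (psub p) (psub q) nh E50.
have hK : k + #|T| * (30 * e + 2) + s + 2 <= k + 2 * del.
  exact: errors_small F16 E5E nF Es hT cT hdel.
have girr : irreflexive g := @edge_irrefl G.
have seeds (w : bool -> G) : g' (w true) (w false) -> exists S : bool -> {set G},
   [/\ forall b, #|W| <= #|S b|, {in S true & S false, forall x y, g x y} &
    forall b v p, v \in S b ->
      deg_in g v (part p) %/ e = deg_in g (w b) (part p) %/ e].
  move=> /g'ty hw; have [S [cS tS gS]] := card_biclique_sides hnb gs nnb hw.
  exists S; split=> // [b|b v p vS]; first by rewrite cS.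
  by apply: tyP; rewrite (tS b v vS); case: (b).
case: st => [[u [v [DD [guv mD hu hv]]]]|].
  pose w b := if b then u else v.
  have [S [cS gS Sw]] := seeds w (gLg _ _ guv).
  have [|f fi fe] := finish_I dec cQ gs girr Hs pdisj pcard (pdeg g) Hfree isT eW hh_e hK cS gS Sw mD;
    last by exists f.
  by case; [apply: leq_trans hu _|apply: leq_trans hv _]; apply: gLle.
case=> u [v [A [B [A' [B' [[guv dAB mAB hu] [dAB' _ [B'' [sB'' mAB'' cB'' hv]]]]]]]]].
set l := map (item par col component) (tops top).
(* One of the two colours has seeds that carry at most k/2 vertices; v takes this colour. *)
have [y hy] : exists y, 2 * side_total y l <= k.
  have := side_total_add true l; have := dec_total dec cQ; rewrite -/l /=.
  case: (leqP (2 * side_total true l) k) => h1 h2 h3; first by exists true.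
  by exists false; move: h1 h2 h3; clear; lia.
pose w b := if b == y then v else u.
have gw : g' (w true) (w false).
  by rewrite /w; case: (y) => /=; [rewrite g's|]; apply: gLg.
have [S [cS gS Sw]] := seeds w gw.
(* Only clusters with an edge are kept: the neighbours of a vertex of degree at least k + 3 del show
   that their neighbouring clusters are large in total. *)
pose L' := [set i in L | [exists j, H i j]].
have [||||f fi fe] := @finish_II _ _ _ _ _ _ _ _ _ _ dec cQ _ _ _ _ _ _ _ _ _ _ gs girr Hs
  pdisj pcard (pdeg g) Hfree isT eW hh_e hK w S cS gS Sw y L' A B A' B'' hy dAB mAB _ _ mAB'' cB'';
  last by exists f.
- by apply: leq_trans hu _; rewrite /w; case: (y) => /=; apply: gLle.
- exact: disjointWr sB'' dAB'.
- move=> i; rewrite inE => /andP[iL /existsP[j /HE[x [z [Cx Cz gxz]]]]].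
  apply: leq_trans (_ : k + 3 * del <= _); first by rewrite leq_add2l leq_mul2r orbT.
  apply: leq_trans (degLi x z i Cx iL gxz) _; rewrite -(card_span cs).
  apply/subset_leq_card/subsetP=> z'; rewrite in_set in_setT /= => gxz'.
  have [_ _ [i' [j' [Cx' Cz' _ _]]]] := g'P _ _ (gLg _ _ gxz').
  apply/spanP; exists j' => //; rewrite inE; apply/HE; exists x, z'.
  by split.
apply: leq_trans hv _; rewrite leq_mul2l /=.
have -> : w y = v by rewrite /w eqxx.
apply/subset_leq_card/subsetP=> z /setIdP[/spanP[i iL Cz] gvz].
have [gg _ [j [i' [Cv _ _ _]]]] := g'P v z (gLg v z gvz).
apply/setIdP; split=> //; apply/spanP; exists i => //.
case/setUP: iL => iL; rewrite in_setU ?iL ?orbT //; apply/orP; left.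
rewrite in_set iL /=; apply/existsP; exists j; apply/HE; exists z, v.
by split=> //; rewrite gLs.
Qed.

(** * Passage from the real parameters to an integer *)

Import Order.TTheory GRing.Theory Num.Theory.
Local Open Scope ring_scope.

Theorem theorem4 (R : realType) (eta q : R) (heta : 0 < eta) (hq : 0 < q)
    (c : nat) :
  exists n0 : nat, forall (G : sgraph) (k : nat),
    (n0 <= #|G|)%N ->
    q * #|G|%:R <= k%:R ->
    #|G|%:R / 2 <= (#|[set x : G | (1 + eta) * k%:R <= (degree x)%:R]|)%:R :> R ->
    forall Q : sgraph,
      connected Q -> bipartite Q ->
      #|Q| = k.+1 -> (#|edges Q| <= k + c)%N ->
      subgraph Q G.
Proof.
(* One integer with 1/E <= eta and 1/E <= q replaces both real parameters. *)
pose E := Num.bound (eta^-1 + q^-1).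
have hE : eta^-1 + q^-1 < E%:R.
  by rewrite archi_boundP // addr_ge0 // invr_ge0 ltW.
have e0 : 0 < eta^-1 by rewrite invr_gt0.
have q0 : 0 < q^-1 by rewrite invr_gt0.
have E0 : (0 < E)%N by rewrite -(ltr0n R) (lt_trans _ hE) // addr_gt0.
have Eeta : 1 <= E%:R * eta.
  by rewrite -ler_pdivrMr // div1r ltW // (lt_trans _ hE) // ltrDl.
have Eq : 1 <= E%:R * q.
  by rewrite -ler_pdivrMr // div1r ltW // (lt_trans _ hE) // ltrDr.
have [n0 hn0] := lks_nat c E0; exists n0 => G k hn hk hbig Q conn bip cQ cE.
apply: (hn0 G k hn _ _ Q conn bip cQ cE).
  rewrite -(ler_nat R) natrM; apply: le_trans (ler_wpM2l (ler0n _ E) hk).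
  by rewrite mulrA ler_peMl // ler0n.
rewrite ler_pdivrMr ?ltr0n // -natrM ler_nat mulnC in hbig.
apply: leq_trans hbig _; rewrite leq_mul2l; apply/subset_leq_card/subsetP=> x.
rewrite !inE => hx; rewrite -(ler_nat R) !natrM -addn1 natrD.
apply: le_trans (ler_wpM2l (ler0n _ E) hx).
by rewrite mulrDl mul1r mulrDl mul1r mulrDr lerD2l mulrA ler_peMl // ler0n.
Qed.
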